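(* Let $0<\alpha<1$, $\theta>0$, $b,c>0$, and set $p=c^\alpha/(1+c^\alpha)$, $q=1-p$. A GGC$^{(b,c)}(\alpha\theta,\varrho_\alpha)$ random variable has Lévy measure $\alpha\theta s^{-1}e^{-(c/b)s}\,\mathbb{E}[e^{-s/(bX_\alpha)}]\,ds$, $s>0$. In particular GGC$^{(c,c)}(\alpha\theta,\varrho_\alpha)$ coincides with GGC$(\alpha\theta,\Lambda_{\alpha,p})$, with Lévy measure $\alpha\theta s^{-1}\mathbb{E}[e^{-s/A_{\alpha,p}}]\,ds$. For $L_c$ a GGC$(\alpha\theta,\Lambda_{\alpha,p})$ random variable: (i) For all $\theta>0$, $L_c\overset{d}{=}G_{\theta\alpha}P_{\alpha,\alpha\theta}(C)\overset{d}{=}G_{\theta\alpha}M_{\alpha\theta}(\Lambda_{\alpha,p})$; hence $M_{\alpha\theta}(\Lambda_{\alpha,p})\overset{d}{=}P_{\alpha,\alpha\theta}(C)$. (ii) As a special case, when $\theta=1$, $A^{br}_{\alpha,p}\overset{d}{=}M_\alpha(\Lambda_{\alpha,p})$. (iii) When $\theta=1$, $L_c\overset{d}{=}G_1A^*_{\alpha,p}\overset{d}{=}G_1B_{\alpha,1-\alpha}M_\alpha(\Lambda_{\alpha,p})\overset{d}{=}G_1B_{\alpha,1-\alpha}P_{\alpha,\alpha}(C)$, where $A^*_{\alpha,p}\overset{d}{=}B_{\alpha,1-\alpha}M_\alpha(\Lambda_{\alpha,p})\overset{d}{=}B_{\alpha,1-\alpha}P_{\alpha,\alpha}(C)\overset{d}{=}M_1(\Lambda^{(\alpha)}_{\alpha,p})$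 has law $$\frac{1-x}{1-p}\,\Lambda_{\alpha,p}(dx),\qquad 0<x<1.$$
   Context: Factors in products are independent; $G_a$: Gamma(shape $a$, scale 1); $B_{a,b}$: Beta$(a,b)$. $X_\alpha\overset{d}{=}S_\alpha/S'_\alpha$ with $S_\alpha,S_\alpha'$ independent positive $\alpha$-stable, $\mathbb{E}[e^{-\lambda S_\alpha}]=e^{-\lambda^\alpha}$; its density is $\varrho_\alpha(y)=\frac{\sin(\pi\alpha)}{\pi}\frac{y^{\alpha-1}}{y^{2\alpha}+2y^\alpha\cos(\pi\alpha)+1}$, $y>0$. $A_{\alpha,p}\overset{d}{=}cX_\alpha/(1+cX_\alpha)$ with $c=(p/q)^{1/\alpha}$ (the time spent positive up to time 1 by a $p$-skew Bessel process of dimension $2-2\alpha$); $\Lambda_{\alpha,p}$ is its law. For a probability $H$ on $[0,\infty)$ with $\int\log(1+x)H(dx)<\infty$ and $\tau>0$: $M_\tau(H)$ is the mean of a Dirichlet process with shape $\tau H$, characterized by $\mathbb{E}[(1+\lambda M_\tau(H))^{-\tau}]=\exp(-\tau\int\log(1+\lambda x)H(dx))$; GGC$(\tau,H)$ is the law of $G_\tau M_\tau(H)$; if $f_L$ is its density, GGC$^{(b,c)}(\tau,H)$ is the law with density proportional to $e^{-(c/b)w}b^{-1}f_L(w/b)$; $H^{(r)}:=rH+(1-r)\delta_0$ for $0<r\le1$. $P_{\alpha,\alpha\theta}=\sum_kP_k\delta_{Z_k}$ is the two-parameter Poisson–Dirichlet random probability measure: $(P_k)$ has the PD$(\alpha,\alpha\theta)$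 law, obtained from the normalized ranked jumps $(J_k/T)$ of an $\alpha$-stable subordinator on $[0,1]$ (total $T=\sum_k J_k\overset{d}{=}S_\alpha$) by changing measure with density proportional to $T^{-\alpha\theta}$, and $(Z_k)$ are iid with a non-atomic law, independent of $(P_k)$; $C$ is a set with $\mathbb{E}[P_{\alpha,\alpha\theta}(C)]=\mathbb{P}(Z_1\in C)=p$. It is known that $\mathbb{E}[(1+\lambda P_{\alpha,\alpha\theta}(C))^{-\alpha\theta}]=(q+p(1+\lambda)^\alpha)^{-\theta}$, and this characterizes the law. $A^{br}_{\alpha,p}$, the time spent positive up to time 1 by a $p$-skew Bessel bridge of dimension $2-2\alpha$, has the law of $P_{\alpha,\alpha}(C)$. *)

(* Defs.v *)
From HB Require Import structures.
From mathcomp Require Import all_boot all_order all_algebra.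
From mathcomp Require Import all_classical all_reals all_analysis.
Set Implicit Arguments.
Unset Strict Implicit.
Unset Printing Implicit Defensive.
Import Order.TTheory GRing.Theory Num.Theory numFieldNormedType.Exports.
Local Open Scope classical_set_scope.
Local Open Scope ring_scope.

(* Laws of real random variables are elements of [probability R R]; equality in
   distribution is equality on measurable sets, the value of a measure on a
   non-measurable set being unspecified. *)
Definition same_law (R : realType) (mu nu : set R -> \bar R) : Prop :=
  forall A : set R, measurable A -> mu A = nu A.

Definition has_density d (T : measurableType d) (R : realType)
    (m : {measure set T -> \bar R}) (D : set T) (f : T -> R)
    (mu : set T -> \bar R) : Prop :=
  [/\ measurable_fun D f,
      forall x, D x -> 0 <= f x &
      forall A : set T, measurable A ->
        mu A = (\int[m]_(x in A `&` D) (f x)%:E)%E].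

Definition has_density_prop_to d (T : measurableType d) (R : realType)
    (m : {measure set T -> \bar R}) (D : set T) (f : T -> R)
    (mu : set T -> \bar R) : Prop :=
  exists2 k : R, 0 < k & has_density m D (fun x => k * f x) mu.

Definition gamma_law (R : realType) (a : R) (G : probability R R) : Prop :=
  has_density_prop_to lebesgue_measure `]0, +oo[
    (fun x => x `^ (a - 1) * expR (- x)) G.

Definition beta_law (R : realType) (a b : R) (B : probability R R) : Prop :=
  has_density_prop_to lebesgue_measure `]0, 1[
    (fun x => x `^ (a - 1) * (1 - x) `^ (b - 1)) B.

Definition mul2 (R : realType) (z : R * R) : R := z.1 * z.2.

Lemma measurable_mul2 (R : realType) : measurable_fun [set: R * R] (@mul2 R).
Proof. exact: (measurable_realfun.measurable_funM measurable_fst measurable_snd). Qed.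

HB.instance Definition _ (R : realType) :=
  isMeasurableFun.Build _ _ _ _ (@mul2 R) (@measurable_mul2 R).

(* The law of X * Y for independent X ~ mu and Y ~ nu. *)
Definition prod_law (R : realType) (mu nu : probability R R) :
    probability R R :=
  distribution (mu \x nu)%E (@mul2 R).

Definition positive_stable_law (R : realType) (alpha : R)
    (S : probability R R) : Prop :=
  S [set` `]0%R, +oo[ ] = 1%E /\
  forall lam : R, 0 <= lam ->
    (\int[S]_(x in `]0%R, +oo[) (expR (- (lam * x)))%:E)%E =
    (expR (- (lam `^ alpha)))%:E.

(* The law varrho_alpha of X_alpha = S / S', S and S' independent positive
   alpha-stable; its density is known to be
     sin(pi alpha) / pi * y^(alpha-1) / (y^(2 alpha) + 2 y^alpha cos(pi alpha) + 1)
   for y > 0. *)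
Definition lamperti_law (R : realType) (alpha : R)
    (rho : probability R R) : Prop :=
  exists2 S : probability R R, positive_stable_law alpha S &
    same_law rho (pushforward (S \x S)%E (fun z : R * R => z.1 / z.2 : R)).

(* The law Lambda_{alpha,p} of c X / (1 + c X), X = X_alpha. *)
Definition skew_occupation_law (R : realType) (alpha p : R)
    (Lam : probability R R) : Prop :=
  exists2 rho : probability R R, lamperti_law alpha rho &
    let c := (p / (1 - p)) `^ alpha^-1 in
    same_law Lam (pushforward rho (fun x : R => c * x / (1 + c * x) : R)).

(* The law of M_tau(H), through the Markov-Krein (Cifarelli-Regazzini)
   identity that characterizes it. *)
Definition dirichlet_mean_law (R : realType) (tau : R) (H : probability R R)
    (M : probability R R) : Prop :=
  [/\ 0 < tau,
      H [set` `[0%R, +oo[ ] = 1%E /\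
        H.-integrable `[0, +oo[ (fun x : R => (ln (1 + x))%:E),
      M [set` `[0%R, +oo[ ] = 1%E &
      forall lam : R, 0 <= lam ->
        (\int[M]_(m in `[0%R, +oo[) ((1 + lam * m) `^ (- tau))%:E)%E =
        (expR (- (tau * \int[H]_(x in `[0, +oo[) ln (1 + lam * x))))%:E].

Definition GGC_law (R : realType) (tau : R) (H : probability R R)
    (L : probability R R) : Prop :=
  exists G M : probability R R,
    [/\ gamma_law tau G, dirichlet_mean_law tau H M & same_law L (prod_law G M)].

(* GGC^{(b,c)}(tau, H). *)
Definition GGC_tilted_law (R : realType) (b c tau : R) (H : probability R R)
    (nu : probability R R) : Prop :=
  exists (L : probability R R) (fL : R -> R),
    [/\ GGC_law tau H L,
        has_density lebesgue_measure `]0, +oo[ fL L &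
        has_density_prop_to lebesgue_measure `]0, +oo[
          (fun w => expR (- (c / b * w)) * (b^-1 * fL (w / b))) nu].

(* H^{(r)} = r H + (1 - r) delta_0. *)
Definition zero_mixture (R : realType) (r : R) (H : set R -> \bar R) :
    set R -> \bar R :=
  fun A => (r%:E * H A + (1 - r)%:E * \d_(0%R : R) A)%E.

(* The law [nu] on [0, +oo[ is infinitely divisible, without drift, with Levy
   measure l(s) ds. *)
Definition has_levy_density (R : realType) (nu : probability R R)
    (l : R -> R) : Prop :=
  [/\ nu [set` `[0%R, +oo[ ] = 1%E,
      measurable_fun (`]0, +oo[ : set R) l /\
        (forall s : R, 0 < s -> 0 <= l s),
      (\int[lebesgue_measure]_(s in `]0%R, +oo[)
        (Num.min 1 s * l s)%:E < +oo)%E &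
      forall lam : R, 0 <= lam ->
        (\int[nu]_(x in `[0%R, +oo[) (expR (- (lam * x)))%:E =
         expeR (- \int[lebesgue_measure]_(s in `]0%R, +oo[)
                    ((1 - expR (- (lam * s))) * l s)%:E))%E].

(* An alpha-stable subordinator on [0, 1]; the values [xi t] for t outside
   [0, 1] are irrelevant. *)
Definition stable_subordinator (R : realType) (alpha : R) d
    (Om : measurableType d) (P : probability Om R)
    (xi : R -> {RV P >-> R}) : Prop :=
  [/\ {ae P, forall w,
        [/\ xi 0 w = 0,
            forall s t, 0 <= s -> s <= t -> t <= 1 -> xi s w <= xi t w &
            forall t, 0 <= t < 1 -> xi s w @[s --> t^'+] --> xi t w]},
      forall (n : nat) (t : nat -> R) (A : nat -> set R),
        0 <= t 0 -> (forall i, (i < n)%N -> t i <= t i.+1) -> t n <= 1 ->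
        (forall i, measurable (A i)) ->
        P (\bigcap_(i < n) [set w | A i (xi (t i.+1) w - xi (t i) w)]) =
        (\prod_(i < n) P [set w | A i (xi (t i.+1) w - xi (t i) w)%R])%E &
      forall s t lam, 0 <= s -> s <= t -> t <= 1 -> 0 <= lam ->
        (\int[P]_w (expR (- (lam * (xi t w - xi s w))))%:E)%E =
        (expR (- ((t - s) * lam `^ alpha)))%:E].

Definition jump (R : realType) (x : R -> R) (t : R) : R :=
  x t - lim (x s @[s --> t^'-]).

(* [J] lists in nonincreasing order, with multiplicity, the (infinitely many)
   jumps on ]0, 1] of the path [x]. *)
Definition ranked_jumps (R : realType) (x : R -> R) (J : nat -> R) : Prop :=
  nonincreasing_seq J /\
  exists tau : nat -> R,
    [/\ injective tau,
        range tau = [set t | 0 < t <= 1 /\ jump x t != 0] &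
        forall k, J k = jump x (tau k)].

Definition total (R : realType) (J : nat -> R) : R := limn (series J).

(* The finite-dimensional distributions of [Q] under [P'] are those of the
   normalized ranked jumps J_k / T, T = \sum_k J_k, of an alpha-stable
   subordinator on [0, 1], under the change of measure with density proportional
   to T^{-vartheta}. *)
Definition PD_sequence (R : realType) (alpha vartheta : R) d'
    (Om' : measurableType d') (P' : probability Om' R)
    (Q : nat -> {RV P' >-> R}) : Prop :=
  exists (d : measure_display) (Om : measurableType d) (P : probability Om R)
         (xi : R -> {RV P >-> R}) (J : nat -> {RV P >-> R}) (k : R),
    [/\ stable_subordinator alpha xi,
        {ae P, forall w, ranked_jumps (xi ^~ w) (J ^~ w)},
        0 < k &
        forall (n : nat) (A : nat -> set R), (forall i, measurable (A i)) ->
          P' (\bigcap_(i < n) [set w | A i (Q i w)]) =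
          (\int[P]_(w in \bigcap_(i < n)
                           [set w | A i (J i w / total (J ^~ w))%R])
             (k * total (J ^~ w) `^ (- vartheta))%:E)%E].

(* [Z] is iid with law [F] and independent of the sequence [Q]. *)
Definition iid_independent_of (R : realType) d (Om : measurableType d)
    (P : probability Om R) (Q : nat -> {RV P >-> R}) dE (E : measurableType dE)
    (F : probability E R) (Z : nat -> {RV P >-> E}) : Prop :=
  forall (n : nat) (A : nat -> set R) (D : nat -> set E),
    (forall i, measurable (A i)) -> (forall i, measurable (D i)) ->
    P (\bigcap_(i < n) [set w | A i (Q i w) /\ D i (Z i w)]) =
    (P (\bigcap_(i < n) [set w | A i (Q i w)]) * \prod_(i < n) F (D i))%E.

Definition non_atomic d (E : measurableType d) (R : realType)
    (F : probability E R) : Prop :=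
  forall A : set E, measurable A -> (0 < F A)%E ->
    exists B : set E, [/\ measurable B, B `<=` A & (0 < F B < F A)%E].

(* The law of P_{alpha,vartheta}(C) = \sum_k Q_k 1{Z_k \in C}, where
   P(Z_k \in C) = p. *)
Definition PD_mass_law (R : realType) (alpha vartheta p : R)
    (mu : probability R R) : Prop :=
  exists (d : measure_display) (Om : measurableType d) (P : probability Om R)
         (Q : nat -> {RV P >-> R})
         (dE : measure_display) (E : measurableType dE) (F : probability E R)
         (Z : nat -> {RV P >-> E}) (C : set E),
    [/\ PD_sequence alpha vartheta Q, non_atomic F, iid_independent_of Q F Z,
        measurable C /\ F C = p%:E &
        same_law mu
          (pushforward P
             (fun w => total (fun k => Q k w * \1_C (Z k w)) : R))].

(* The time spent positive up to time 1 by a p-skew Bessel bridge of dimension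
   2 - 2 alpha has the law of P_{alpha,alpha}(C). *)
Definition skew_bridge_occupation_law (R : realType) (alpha p : R)
    (mu : probability R R) : Prop :=
  PD_mass_law alpha alpha p mu.

(* Main.v *)
(** Every law in the statement is identified by one transform.  For independent
    positive stable [S], [S'] the Frullani integral evaluates
    [E ln (b S + S') - E ln (a S + S')], which makes the Laplace exponents of the
    GGC laws logarithms of [1 - p + p (1 + lam)^alpha].  A gamma variable of shape
    [alpha theta] independent of [P_{alpha,alpha theta}(C)] undoes the change of
    measure [T^(-alpha theta)] by the scaling [t = T u], and what remains is
    [E prod_k ((1 - p) e^(-u J_k) + p e^(-(1 + lam) u J_k))]; replacing the jumps by
    the increments over finer and finer grids identifies it as
    [exp (- u^alpha (1 - p + p (1 + lam)^alpha))].  For the size-biased law,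
    weighting by [1 - x] turns [(1 + lam x)^-1], [x = c X / (1 + c X)], into
    [(1 + c (1 + lam) X)^-1], whose mean is [(1 + (c (1 + lam))^alpha)^-1]. *)

Require Import Defs.
From HB Require Import structures.
From mathcomp Require Import all_boot all_order all_algebra.
From mathcomp Require Import all_classical all_reals all_analysis.
From mathcomp Require Import measurable_realfun ring lra.
Set Implicit Arguments.
Unset Strict Implicit.
Unset Printing Implicit Defensive.
Import Order.TTheory GRing.Theory Num.Theory numFieldNormedType.Exports.
Local Open Scope classical_set_scope.
Local Open Scope ring_scope.

(** * Integrals on the half line *)

(** The hypotheses give laws only through transforms or finite-dimensional distributions, and this
    shapes the proof. Uniqueness: a Stieltjes transform of order [tau] is the Laplace transform of a
    gamma law weighted by the Laplace transform of the unknown law, so Laplace uniqueness, used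
    twice, covers it. Existence: passing between [GGC_tilted_law] and [GGC_law] requires Dirichlet
    means of [Lam] and of [rho]; both come from one reweighted pair of stable variables. Jumps:
    [stable_subordinator] constrains only increments, so the absence of drift (the jumps sum to
    [xi 1] almost surely) must be proved, which uses [alpha < 1]. Likewise the convergence of the
    series of the [Q i] is recovered from finite-dimensional distributions, [total] being a default
    value when the series diverges. The constants of the gamma and beta laws and of the change of
    measure are never computed: they cancel or are fixed by a total mass equal to 1. *)

Lemma measurable_inv (R : realType) : measurable_fun [set: R] (@GRing.inv R).
Proof.
have -> : @GRing.inv R =
    fun x => if 0 <= x then x `^ (-1) else - ((- x) `^ (-1)).
  apply/funext => x; case: ifPn => [x0|]; first by rewrite powR_inv1.
  by rewrite -ltNge => x0; rewrite powR_inv1 ?oppr_ge0 1?ltW// invrN opprK.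
apply: measurable_fun_ifT => //=.
- exact: measurable_fun_ler.
- apply: measurableT_comp => //.
refine (@measurableT_comp _ _ _ _ _ _ (@powR R ^~ (-1)) setT (fun x : R => - x) (@measurable_powR _ _) _).
exact: oppr_measurable.
Qed.

(** Recursion on the shape of the function; a subgoal outside the grammar is returned to the caller
    instead of failing. *)
Ltac meas :=
  lazymatch goal with
  | |- measurable_fun _ (fun x => x) => exact: measurable_id
  | |- measurable_fun _ (fun _ => ?c) => exact: measurable_cst
  | |- measurable_fun _ (fun x => (@?h x)%:E) => apply/measurable_EFinP; meas
  | |- measurable_fun _ (EFin \o _) => apply/measurable_EFinP; meas
  | |- measurable_fun _ (fun x => (@?h x * @?k x)%E) => apply: emeasurable_funM; meas
  | |- measurable_fun _ (fun x => @?h x * @?k x) => apply: measurable_funM; meas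
  | |- measurable_fun _ (fun x => @?h x - @?k x) => apply: measurable_funB; meas
  | |- measurable_fun _ (fun x => @?h x + @?k x) => apply: measurable_funD; meas
  | |- measurable_fun _ (fun x => - (@?g x)) => apply: measurable_funN; meas
  | |- measurable_fun ?D (fun x => expR (@?g x)) =>
    refine (@measurableT_comp _ _ _ _ _ _ _ D g (@measurable_expR _) _); meas
  | |- measurable_fun ?D (fun x => ln (@?g x)) =>
    refine (@measurableT_comp _ _ _ _ _ _ _ D g (@measurable_ln _) _); meas
  | |- measurable_fun ?D (fun x => (@?g x) `^ ?p) =>
    refine (@measurableT_comp _ _ _ _ _ _ _ D g (@measurable_powR _ p) _); meas
  | |- measurable_fun ?D (fun x => (@?g x)^-1) =>
    refine (@measurableT_comp _ _ _ _ _ _ _ D g (@measurable_inv _) _); meas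
  | |- measurable_fun ?D (fun x => \1_?A (@?g x)) =>
    refine (@measurableT_comp _ _ _ _ _ _ _ D g (@measurable_indic _ _ _ setT A _) _);
    [by []|meas]
  | |- measurable_fun ?D (fun x => fst (@?g x)) =>
    refine (@measurableT_comp _ _ _ _ _ _ _ D g measurable_fst _); meas
  | |- measurable_fun ?D (fun x => snd (@?g x)) =>
    refine (@measurableT_comp _ _ _ _ _ _ _ D g measurable_snd _); meas
  | |- measurable_fun ?D (+%R ?a) => change (measurable_fun D (fun x => a + x)); meas
  | |- measurable_fun ?D ( *%R ?a) => change (measurable_fun D (fun x => a * x)); meas
  | |- measurable_fun _ (@expR _) => exact: measurable_expR
  | |- measurable_fun _ (@ln _) => exact: measurable_ln
  | |- measurable_fun _ (@GRing.inv _) => exact: measurable_inv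
  | |- measurable_fun _ (-%R) => exact: oppr_measurable
  | |- measurable_fun _ (@fst _ _) => exact: measurable_fst
  | |- measurable_fun _ (@snd _ _) => exact: measurable_snd
  | H : measurable_fun _ ?f |- measurable_fun _ ?f => exact: H
  | _ => idtac
  end.

Lemma ae_of_null d (T : measurableType d) (R : realType)
    (m : {measure set T -> \bar R}) (D : set T) (P : T -> Prop) :
  measurable D -> m (~` D) = 0%E -> (forall x, D x -> P x) ->
  {ae m, forall x, P x}.
Proof.
move=> mD m0 DP; exists (~` D); split => //; first exact: measurableC.
by move=> x /= nP /DP.
Qed.

Section probability_of.
Context d (T : measurableType d) (R : realType) (m : {measure set T -> \bar R}).

(** An alias of [m] that carries the proof of total mass 1, so that the instances below can attach
    the probability structure to it. *)
Definition probability_of (m1 : m [set: T] = 1%E) : set T -> \bar R := m.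

Variable m1 : m [set: T] = 1%E.

HB.instance Definition _ := isMeasure.Build d T R (probability_of m1)
  (measure0 m) (fun=> measure_ge0 m _) (@measure_semi_sigma_additive _ _ _ m).

HB.instance Definition _ :=
  Measure_isProbability.Build d T R (probability_of m1) m1.

End probability_of.

Lemma probability_ex d (T : measurableType d) (R : realType)
    (m : {measure set T -> \bar R}) : m [set: T] = 1%E ->
  exists P : probability T R, forall A, P A = m A.
Proof. by move=> m1; exists (probability_of m1). Qed.

Section integral_tools.
Context d (T : measurableType d) (R : realType).
Local Open Scope ereal_scope.

Lemma integral_full (m : {measure set T -> \bar R}) (D : set T)
    (f : T -> \bar R) :
  measurable D -> m (~` D) = 0 -> measurable_fun [set: T] f ->
  \int[m]_(x in D) f x = \int[m]_x f x.
Proof.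
move=> mD mC mf; rewrite integral_mkcond.
apply: ae_eq_integral => //.
- by apply/(measurable_restrictT _ _).1 => //; exact: measurable_funTS.
- by apply: (ae_of_null mD mC) => x Dx _; rewrite patchE mem_set.
Qed.

Lemma integral_fullP (P : probability T R) (D : set T) (f : T -> \bar R) :
  measurable D -> P D = 1 -> measurable_fun [set: T] f ->
  \int[P]_(x in D) f x = \int[P]_x f x.
Proof.
move=> mD PD mf; apply: integral_full => //.
by have /= -> := probability_setC P mD; rewrite PD subee.
Qed.

Import HBNNSimple.

(** [m] is an arbitrary measure and [F] may take the value [+oo], so both sides are reached by
    simple functions and monotone convergence. *)
Lemma integral_density (m nu : {measure set T -> \bar R}) (F : T -> \bar R) :
  measurable_fun [set: T] F -> (forall x, 0 <= F x) ->
  (forall A, measurable A -> nu A = \int[m]_(x in A) F x) ->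
  forall g : T -> \bar R, measurable_fun [set: T] g -> (forall x, 0 <= g x) ->
  \int[nu]_x g x = \int[m]_x (g x * F x).
Proof.
move=> mF F0 nuE g mg g0.
pose g_ := nnsfun_approx measurableT mg.
have cg x : (g_ n x)%:E @[n --> \oo] --> g x by exact: cvg_nnsfun_approx.
have ndg x : {homo (fun n => (g_ n x)%:E) : a b / (a <= b)%N >-> a <= b}.
  by move=> a b ab; rewrite lee_fin; exact/lefP/nd_nnsfun_approx.
transitivity (limn (fun n => \int[nu]_x (g_ n x)%:E)).
  rewrite -monotone_convergence//.
  - by apply: eq_integral => x _; apply/esym/cvg_lim => //; exact: cg.
  - by move=> n; exact/measurable_EFinP.
  - by move=> n x _; rewrite lee_fin.
have -> : \int[m]_x (g x * F x) =
    limn (fun n => \int[m]_x ((g_ n x)%:E * F x)).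
  rewrite -monotone_convergence//.
  - apply: eq_integral => x _; apply/esym/cvg_lim => //.
    (* Products of 0 and [+oo] break the continuity of multiplication by [F x], hence the separate
       cases [F x = 0] and [F x = +oo]. *)
    have [Fx0|Fx0] := eqVneq (F x) 0.
      by under eq_fun do rewrite Fx0 mule0; rewrite Fx0 mule0; exact: cvg_cst.
    have [Fxy|Fxy] := eqVneq (F x) +oo.
      have [gx0|gx0] := eqVneq (g x) 0.
        rewrite gx0 mul0e (_ : (fun _ => _) = cst 0); first exact: cvg_cst.
        apply/funext => n /=; have : (g_ n x)%:E <= g x.
          have := cg x => /cvg_lim <- //.
          by apply: lime_ge; [apply/cvg_ex; exists (g x)|exists n => // k /= nk; exact: ndg].
        rewrite gx0 => gn0; have /eqP -> : (g_ n x)%:E == 0.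
          by rewrite eq_le gn0 lee_fin/=.
        by rewrite mul0e.
      have gx1 : 0 < g x by rewrite lt_def gx0/= g0.
      rewrite Fxy gt0_muley//; apply: cvg_near_cst.
      have : \forall n \near \oo, 0 < (g_ n x)%:E.
        by apply: (cg x [set y | 0 < y]); exact: open_ereal_gt'.
      by apply: filterS => n gn; rewrite gt0_muley.
    have Ff : F x \is a fin_num by rewrite ge0_fin_numE// lt_def eq_sym Fxy leey.
    by apply: cvgeMr => //; exact: cg.
  - by move=> n; apply: emeasurable_funM => //; exact/measurable_EFinP.
  - by move=> n x _; rewrite mule_ge0// lee_fin.
  - by move=> x _ a b ab; rewrite lee_wpmul2r//; exact: ndg.
congr (limn _); apply/funext => n.
rewrite integral_nnsfun// sintegralE.
have -> : g_ n \_ setT = g_ n by apply/funext => x; rewrite patchE mem_set.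
under [RHS]eq_integral do rewrite fimfunE -fsumEFin//.
transitivity (\int[m]_x \sum_(i \in range (g_ n))
    ((i * \1_(g_ n @^-1` [set i]) x)%:E * F x)); last first.
  by apply: eq_integral => x _; rewrite ge0_mule_fsuml// => r; exact: nnfun_muleindic_ge0.
rewrite ge0_integral_fsum//; last 2 first.
- move=> r; apply: emeasurable_funM => //.
  by apply/measurable_EFinP; exact: measurable_funM.
- by move=> r x _; rewrite mule_ge0//; exact: nnfun_muleindic_ge0.
apply: eq_fsbigr => r /set_mem[t _ <-].
under eq_integral do rewrite EFinM -muleA.
rewrite ge0_integralZl//; last 3 first.
- by apply: emeasurable_funM => //; apply/measurable_EFinP.
- by move=> x _; rewrite mule_ge0// lee_fin.
- by rewrite lee_fin.
rewrite nuE// integral_mkcond; congr (_ * _); apply: eq_integral => x _.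
by rewrite patchE indicE; case: ifPn => _; rewrite ?mul1e ?mul0e.
Qed.

Lemma density_measure_ex (m : {measure set T -> \bar R}) (F : T -> \bar R) :
  measurable_fun [set: T] F -> (forall x, 0 <= F x) ->
  exists nu : {measure set T -> \bar R},
    forall A, measurable A -> nu A = \int[m]_(x in A) F x.
Proof.
move=> mF F0; pose nu := fun A : set T => \int[m]_(x in A) F x.
have nu0 : nu set0 = 0 by rewrite /nu integral_set0.
have nu_ge0 A : 0 <= nu A by apply: integral_ge0.
have nuS : semi_sigma_additive nu.
  move=> A mA tA mUA; rewrite /nu ge0_integral_bigcup//; last exact: measurable_funTS.
  by apply: is_cvg_ereal_nneg_natsum_cond => n _ _; exact: integral_ge0.
pose mnu := isMeasure.Build d T R nu nu0 nu_ge0 nuS.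
pose nu' : {measure set T -> \bar R} := HB.pack nu mnu.
by exists nu'.
Qed.

End integral_tools.

Section tonelli_on.
Context d1 d2 (T1 : measurableType d1) (T2 : measurableType d2) (R : realType).
Variables (m1 : {sigma_finite_measure set T1 -> \bar R})
  (m2 : {sigma_finite_measure set T2 -> \bar R}).
Variables (D1 : set T1) (D2 : set T2).
Hypotheses (mD1 : measurable D1) (mD2 : measurable D2).
Variable f : T1 -> T2 -> R.
Hypothesis mf : measurable_fun [set: T1 * T2] (fun z => f z.1 z.2).
Hypothesis f0 : forall x y, D1 x -> D2 y -> 0 <= f x y.

(** The integrand is nonnegative only on [D1 * D2]; the indicators make it so everywhere, as Tonelli
    on the whole product demands. *)
Let g z := (\1_D1 z.1 * \1_D2 z.2 * f z.1 z.2)%:E.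

Let mg : measurable_fun [set: T1 * T2] g.
Proof.
by rewrite /g; meas.
Qed.

Let g0 z : (0 <= g z)%E.
Proof.
rewrite lee_fin !indicE.
have [/set_mem D1z|_] := boolP (z.1 \in D1); last by rewrite !mul0r.
have [/set_mem D2z|_] := boolP (z.2 \in D2); last by rewrite mulr0 mul0r.
by rewrite !mul1r f0.
Qed.

Let gE1 x y : D1 x -> g (x, y) = ((fun y => (f x y)%:E) \_ D2) y.
Proof.
move=> D1x; rewrite /g !indicE/= mem_set// mul1r patchE.
by case: ifPn => _; rewrite ?mul1r ?mul0r.
Qed.

Let gE2 x y : D2 y -> g (x, y) = ((fun x => (f x y)%:E) \_ D1) x.
Proof.
move=> D2x; rewrite /g !indicE/= [y \in D2]mem_set// mulr1 patchE.
by case: ifPn => _; rewrite ?mul1r ?mul0r.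
Qed.

Lemma measurable_integral_param :
  measurable_fun D1 (fun x => \int[m2]_(y in D2) (f x y)%:E)%E.
Proof.
apply: (eq_measurable_fun (fun x => \int[m2]_y g (x, y))%E).
  move=> x /set_mem D1x; rewrite [RHS]integral_mkcond.
  by apply: eq_integral => y _; exact: gE1.
apply: measurable_funTS; exact: (measurable_fun_fubini_tonelli_F g).
Qed.

Lemma tonelli_on :
  (\int[m1]_(x in D1) \int[m2]_(y in D2) (f x y)%:E =
   \int[m2]_(y in D2) \int[m1]_(x in D1) (f x y)%:E)%E.
Proof.
transitivity (\int[m1]_x \int[m2]_y g (x, y))%E.
  rewrite integral_mkcond; apply: eq_integral => x _; rewrite patchE.
  case: ifPn => [/set_mem D1x|D1x].
    by rewrite integral_mkcond; apply: eq_integral => y _; rewrite gE1.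
  rewrite integral0_eq// => y _.
  by rewrite /g indicE (negbTE D1x)/= !mul0r.
rewrite (fubini_tonelli g mg g0).
rewrite [RHS]integral_mkcond; apply: eq_integral => y _; rewrite patchE.
case: ifPn => [/set_mem D2y|D2y].
  by rewrite [RHS]integral_mkcond; apply: eq_integral => x _; rewrite gE2.
rewrite integral0_eq// => x _.
by rewrite /g [\1_D2 _]indicE (negbTE D2y)/= mulr0 mul0r.
Qed.

End tonelli_on.

(** * Fundamental theorem of calculus, scaling and the Frullani integral *)

Section real_line.
Variable R : realType.
Local Notation mu := (@lebesgue_measure R).

Lemma ge0_FTC_cc (f F : R -> R) (a b : R) : a <= b ->
  (forall x, a <= x <= b -> {for x, continuous f}) ->
  (forall x, a <= x <= b -> is_derive x 1 F (f x)) ->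
  (\int[mu]_(x in `[a, b]) (f x)%:E = (F b - F a)%:E)%E.
Proof.
rewrite le_eqVlt => /predU1P[->|ab] cf dF.
  by rewrite set_itv1 integral_set1 subrr.
have cF x : a <= x <= b -> {for x, continuous F}.
  move=> /dF dFx; apply: differentiable_continuous; apply/derivable1_diffP.
  exact: ex_derive.
rewrite EFinB; apply: continuous_FTC2 => //.
- by apply: continuous_in_subspaceT => x; rewrite inE/= in_itv/=; exact: cf.
- split.
  + move=> x; rewrite in_itv/= => /andP[ax xb].
    by have := dF x; rewrite !ltW// => /(_ isT) ?; exact: ex_derive.
  + by apply: cvg_at_right_filter; apply: cF; rewrite lexx ltW.
  + by apply: cvg_at_left_filter; apply: cF; rewrite lexx ltW.
- move=> x; rewrite in_itv/= => /andP[ax xb].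
  have := dF x; rewrite !ltW// => /(_ isT) ?.
  by rewrite derive1E derive_val.
Qed.

Lemma ge0_FTC_0y (f F : R -> R) (l0 l : R) :
  (forall x, 0 < x -> 0 <= f x) ->
  (forall x, 0 < x -> {for x, continuous f}) ->
  (forall x : R, 0 < x -> is_derive x 1 F (f x)) ->
  F x @[x --> 0^'+] --> l0 -> F x @[x --> +oo] --> l ->
  (\int[mu]_(x in `]0%R, +oo[) (f x)%:E = (l - l0)%:E)%E.
Proof.
move=> f0 cf dF Fl0 Fl.
have cF x : 0 < x -> {for x, continuous F}.
  move=> /dF dFx; apply: differentiable_continuous; apply/derivable1_diffP.
  exact: ex_derive.
(* The integrand may blow up at 0, where [F] has only a limit, so the half line is exhausted by
   closed rays on which the ordinary theorem applies. *)
pose A n : set R := `[n.+1%:R^-1, +oo[%classic.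
have UA : \bigcup_n A n = `]0, +oo[%classic.
  apply/seteqP; split=> x /=.
    move=> [n _]; rewrite /A/= !in_itv/= !andbT; apply: lt_le_trans.
    by rewrite invr_gt0.
  rewrite in_itv/= andbT => x0; exists (Num.truncn x^-1) => //.
  rewrite /A/= in_itv/= andbT invf_ple ?posrE//; exact/ltW/Num.Theory.truncnS_gt.
have cI : (\int[mu]_(x in A n) (f x)%:E @[n --> \oo] -->
           \int[mu]_(x in `]0%R, +oo[) (f x)%:E)%E.
  rewrite -UA; apply: ge0_nondecreasing_set_cvg_integral => //.
  - move=> m n mn; apply/subsetPset => x; rewrite /A/= !in_itv/= !andbT.
    by apply: le_trans; rewrite lef_pV2 ?posrE// ler_nat.
  - by move=> n; exact: measurable_itv.
  - move=> n; apply/measurable_EFinP.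
    apply: (measurable_funS (measurable_itv `]0, +oo[)).
      by rewrite -UA; exact: bigcup_sup.
    apply: open_continuous_measurable_fun => //.
    by move=> x; rewrite inE/= in_itv/= andbT; exact: cf.
  - by move=> n x; rewrite /A/= in_itv/= andbT => nx; rewrite lee_fin f0// (lt_le_trans _ nx).
have IE n : (\int[mu]_(x in A n) (f x)%:E = (l - F n.+1%:R^-1)%:E)%E.
  have n0 : 0 < n.+1%:R^-1 :> R by rewrite invr_gt0.
  rewrite EFinB; apply: ge0_continuous_FTC2y => //.
  - by move=> x nx; rewrite f0// (lt_le_trans _ nx).
  - apply: continuous_in_subspaceT => x; rewrite inE/= in_itv/= andbT => nx.
    by apply: cf; rewrite (lt_le_trans _ nx).
  - move=> x nx; by have := dF x (lt_trans n0 nx) => ?; exact: ex_derive.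
  - by apply: cvg_at_right_filter; exact: cF.
  - move=> x; rewrite in_itv/= andbT => nx.
    by have := dF x (lt_trans n0 nx); rewrite derive1E => ?; rewrite derive_val.
apply: (cvg_unique _ cI) => //.
rewrite (funext IE).
apply: cvg_EFin; first exact: nearW.
apply: cvgB; first exact: cvg_cst.
have /cvg_at_rightP := Fl0; apply; split.
  by move=> n; rewrite invr_gt0.
exact: cvg_harmonic.
Qed.

(** The image of Lebesgue measure under [x |-> a x], multiplied by [a], has the right value on
    intervals, hence is Lebesgue measure. *)
Lemma ge0_integral_scale (f : R -> \bar R) (a : R) : 0 < a ->
  measurable_fun [set: R] f -> (forall x : R, 0 < x -> (0 <= f x)%E) ->
  (\int[mu]_(x in `]0%R, +oo[) f x =
   a%:E * \int[mu]_(x in `]0%R, +oo[) f (a * x)%R)%E.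
Proof.
move=> a0 mf f0.
have ma : measurable_fun setT (fun x : R => a * x) by exact: measurable_funM.
have a0' := ltW a0.
pose phi : R -> measurableTypeR R := fun x => a * x.
have mphi : measurable_fun setT phi by [].
pose nu_ := mscale (NngNum a0') (pushforward mu phi).
pose nu := nu_ mphi.
have muE A : measurable A -> mu A = nu A.
  apply: lebesgue_measure_unique => _ [[u v]] _ <-.
  rewrite /nu/nu_/= /mscale/= /pushforward.
  have -> : phi @^-1` `]u, v] = `]a^-1 * u, a^-1 * v]%classic.
    apply/seteqP; split => x /=; rewrite /phi !in_itv/= ltr_pdivrMl//;
    by rewrite ler_pdivlMl.
  rewrite !lebesgue_measure_itv/= !lte_fin ltr_pM2l ?invr_gt0//.
  case: ifPn => _; last by rewrite mule0.
  by rewrite -!EFinD -EFinM -mulrBr mulrA divff ?gt_eqF// mul1r.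
rewrite (@eq_measure_integral _ _ _ _ nu); last by move=> A mA _; exact: muE.
rewrite ge0_integral_mscale//; last 2 first.
- exact: measurable_funTS.
- by move=> x /=; rewrite in_itv/= andbT; exact: f0.
rewrite ge0_integral_pushforward//; last 2 first.
- exact: measurable_funTS.
- by move=> x; rewrite inE/= in_itv/= andbT; exact: f0.
congr (_ * integral _ _ _)%E.
by apply/seteqP; split => x /=; rewrite /phi !in_itv/= !andbT pmulr_rgt0.
Qed.

Lemma is_derive_expR_powR (u a t : R) : 0 < t ->
  is_derive t 1 (fun x => expR (- (u * x `^ a)))
    (- (u * (a * t `^ (a - 1)) * expR (- (u * t `^ a)))).
Proof.
move=> t0.
have H := is_derive1_powR a t0.
have H2 : is_derive t 1 (fun x => - (u * x `^ a)) (- (u * (a * t `^ (a - 1)))).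
  exact: is_deriveN.
have := @is_derive1_comp R (@expR R) (fun x => - (u * x `^ a)) t _ _ (is_derive_expR _) H2.
by rewrite mulrN mulrC -mulNr.
Qed.

Lemma continuous_powR_gt0 (a t : R) : 0 < t -> {for t, continuous ((@powR R) ^~ a)}.
Proof.
move=> t0; apply: differentiable_continuous; apply/derivable1_diffP.
by apply: derivable_powR; rewrite in_itv/= andbT.
Qed.

Lemma cvg_expR_powR0 (u a : R) : 0 < a ->
  expR (- (u * x `^ a)) @[x --> 0^'+] --> (1 : R).
Proof.
move=> a0; suff : expR (- (u * x `^ a)) @[x --> 0^'+] --> expR (- (u * 0)).
  by rewrite mulr0 oppr0 expR0.
apply: (@cvg_comp _ _ _ (fun x => - (u * x `^ a)) expR _ (nbhs (- (u * 0)))).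
  by apply: cvgN; apply: cvgM; [exact: cvg_cst|exact: powR_cvg0].
exact: continuous_expR.
Qed.

Lemma cvg_expR_powRy (u a : R) : 0 < u -> 0 < a ->
  expR (- (u * x `^ a)) @[x --> +oo] --> (0 : R).
Proof.
move=> u0 a0; apply: (@cvg_comp _ _ _ (fun x => u * x `^ a) (fun y => expR (- y)) _ (pinfty_nbhs R)); last exact: cvgr_expR.
apply: gt0_cvgMry => //; apply/cvgryPge => M.
exists (`|M| `^ a^-1 + 1); split; first exact: num_real.
move=> x Mx; apply: (le_trans (ler_norm M)).
rewrite -[leLHS]powRr1// -(mulVf (lt0r_neq0 a0)) powRrM.
apply: ge0_ler_powR; rewrite ?nnegrE ?powR_ge0// ltW//.
  by rewrite (lt_trans _ Mx)// ltr_pwDr// powR_ge0.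
by rewrite (lt_trans _ Mx)// ltrDl.
Qed.

Lemma integral_powR_expR (u a : R) : 0 < u -> 0 < a ->
  (\int[mu]_(t in `]0%R, +oo[) (t `^ (a - 1) * expR (- (u * t `^ a)))%:E
   = (a * u)^-1%:E)%E.
Proof.
move=> u0 a0.
have -> : (a * u)^-1 = - (a * u)^-1 * 0 - (- (a * u)^-1 * 1) by ring.
apply: (@ge0_FTC_0y (fun t => t `^ (a - 1) * expR (- (u * t `^ a)))
  (fun t => - (a * u)^-1 * expR (- (u * t `^ a)))).
- by move=> x x0; rewrite mulr_ge0// ?powR_ge0// expR_ge0.
- move=> x x0; apply: continuousM; first exact: continuous_powR_gt0.
  apply: (@continuous_comp _ _ _ (fun y => - (u * y `^ a)) expR); last exact: continuous_expR.
  apply: continuousN; apply: continuousM; first exact: cst_continuous.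
  exact: continuous_powR_gt0.
- move=> x x0.
  have H := is_derive_expR_powR u a x0.
  apply: (is_derive_eq (@is_deriveZ _ _ _ (fun t => expR (- (u * t `^ a))) (- (a * u)^-1) x 1 _ H)).
  by rewrite /GRing.scale/=; field; rewrite ?gt_eqF.
- by apply: cvgM; [exact: cvg_cst|exact: cvg_expR_powR0].
- by apply: cvgM; [exact: cvg_cst|exact: cvg_expR_powRy].
Qed.

Lemma integral_expR_inv (a b t : R) : 0 < t -> a <= b ->
  (\int[mu]_(u in `[a, b]) (expR (- (u * t)))%:E =
   ((expR (- (a * t)) - expR (- (b * t))) / t)%:E)%E.
Proof.
move=> t0 ab.
have -> : (expR (- (a * t)) - expR (- (b * t))) / t =
  - t^-1 * expR (- (b * t)) - - t^-1 * expR (- (a * t)) by ring.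
apply: (@ge0_FTC_cc (fun u => expR (- (u * t))) (fun u => - t^-1 * expR (- (u * t)))) => //.
- move=> x _; apply: (@continuous_comp R R R (fun y => - (y * t)) expR); last exact: continuous_expR.
  by apply: continuousN; apply: continuousM; [exact: cvg_id|exact: cvg_cst].
- move=> x _.
  have H1 : is_derive x 1 (fun y : R => - (y * t)) (- t).
    by apply: is_deriveN; apply: is_derive_eq; rewrite /GRing.scale/= mulr1 mulr0 add0r.
  have H := @is_derive1_comp R (@expR R) (fun y => - (y * t)) x _ _ (is_derive_expR _) H1.
  apply: (is_derive_eq (@is_deriveZ _ _ _ (fun y : R => expR (- (y * t))) (- t^-1) x 1 _ H)).
  by rewrite /GRing.scale/=; field; rewrite gt_eqF.
Qed.

Lemma integral_inv_cc (a b : R) : 0 < a -> a <= b ->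
  (\int[mu]_(u in `[a, b]) (u^-1)%:E = (ln b - ln a)%:E)%E.
Proof.
move=> a0 ab.
apply: (@ge0_FTC_cc (fun u => u^-1) (@ln R)) => //.
- move=> x /andP[ax _]; apply: inv_continuous.
  by rewrite gt_eqF// (lt_le_trans a0).
- by move=> x /andP[ax _]; apply: is_derive1_ln; rewrite (lt_le_trans a0).
Qed.

(** The difference of exponentials over [t] is the integral over [u] in [[a, b]] of
    [t^(al-1) e^(-u t^al)]; after the exchange, the integral in [t] is [1 / (al u)]. *)
Lemma frullani (a b al : R) : 0 < a -> a <= b -> 0 < al ->
  (\int[mu]_(t in `]0%R, +oo[)
     ((expR (- (a * t `^ al)) - expR (- (b * t `^ al))) / t)%:E =
   (al^-1 * (ln b - ln a))%:E)%E.
Proof.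
move=> a0 ab al0.
transitivity (\int[mu]_(t in `]0%R, +oo[) \int[mu]_(u in `[a, b])
    (t `^ (al - 1) * expR (- (u * t `^ al)))%:E)%E.
  apply: eq_integral => t /set_mem/=; rewrite in_itv/= andbT => t0.
  under eq_integral do rewrite EFinM.
  rewrite ge0_integralZl//; last 2 first.
  - by apply: measurable_funTS; meas.
  - by rewrite lee_fin powR_ge0.
  rewrite integral_expR_inv ?powR_gt0// -EFinM powRB; last by rewrite (gt_eqF t0) implybT.
  rewrite powRr1 1?ltW//; congr EFin; field.
  by rewrite !gt_eqF// powR_gt0.
rewrite tonelli_on//=; last 2 first.
- meas.
- by move=> x y _ _; rewrite mulr_ge0 ?powR_ge0 ?expR_ge0.
transitivity (\int[mu]_(u in `[a, b]) ((al^-1)%:E * (u^-1)%:E))%E.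
  apply: eq_integral => u /set_mem/=; rewrite in_itv/= => /andP[au _].
  by rewrite integral_powR_expR//; [rewrite invfM EFinM|exact: lt_le_trans au].
rewrite ge0_integralZl//; last 3 first.
- apply: measurable_funTS; apply/measurable_EFinP; exact: measurable_inv.
- by move=> x /=; rewrite in_itv/= => /andP[ax _]; rewrite lee_fin invr_ge0 ltW// (lt_le_trans a0).
- by rewrite lee_fin invr_ge0 ltW.
by rewrite integral_inv_cc.
Qed.

End real_line.

(** * Laplace and Stieltjes transforms *)

Section laplace_uniqueness.
Variable R : realType.
Local Notation D := (`[0%R, +oo[%classic : set R).

(** With [K] the exponent, [K e^(-n^2 x)] is about [e^(n^2 (a - x) + n)]: it tends to 0 when
    [x > a], because squares beat [n], and is at least [e^n] when [x <= a]. The extra [n] makes the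
    limit 0 at [x = a], as the open ray requires. *)
Lemma cvg_laplace_indic (a x : R) : 0 <= a -> 0 <= x ->
  (1 - expR (- (n%:R ^+ 2 * x))) ^+ (Num.truncn (expR (n%:R ^+ 2 * a + n%:R))).+1
    @[n --> \oo] --> (\1_(`]a, +oo[) x : R).
Proof.
move=> a0 x0.
set K := fun n => (Num.truncn (expR (n%:R ^+ 2 * a + n%:R : R))).+1.
have y01 n : 0 <= expR (- (n%:R ^+ 2 * x)) <= 1.
  by rewrite expR_ge0 expR_le1 oppr_le0 mulr_ge0.
have f0 n : 0 <= (1 - expR (- (n%:R ^+ 2 * x))) ^+ K n.
  by rewrite exprn_ge0// subr_ge0; case/andP: (y01 n).
rewrite indicE mem_setE in_itv/= andbT; case: ltP => ax.
- have d0 : 0 < x - a by rewrite subr_gt0.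
  have lower : \forall n \near \oo, 1 - 2 * expR (- n%:R) <=
      (1 - expR (- (n%:R ^+ 2 * x))) ^+ K n.
    (* For such [n], [n (x - a) >= 2], so [n^2 (a - x) + n <= -n] and, as [a >= 0], also
       [n^2 x >= n]: Bernoulli's inequality then loses at most [2 e^(-n)]. *)
    exists (Num.truncn (2 / (x - a))).+1 => // n /= nd.
    have nd2 : 2 <= n%:R * (x - a).
      rewrite -ler_pdivrMr// ltW// (lt_le_trans (Num.Theory.truncnS_gt _))//.
      by rewrite ler_nat.
    have Kn : (K n)%:R <= expR (n%:R ^+ 2 * a + n%:R) + 1 :> R.
      by rewrite /K -natr1 lerD2r Num.Theory.truncn_le// expR_ge0.
    have bern y m : 0 <= y <= 1 -> 1 - m%:R * y <= (1 - y) ^+ m :> R.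
      move=> /andP[y0 y1]; elim: m => [|m IH]; first by rewrite mul0r subr0 expr0.
      rewrite exprS; apply: (@le_trans _ _ ((1 - y) * (1 - m%:R * y))).
        rewrite -natr1 -subr_ge0.
        have -> : (1 - y) * (1 - m%:R * y) - (1 - (m%:R + 1) * y) = m%:R * (y * y) by ring.
        by rewrite !mulr_ge0.
      by rewrite ler_wpM2l// subr_ge0.
    apply: le_trans (bern _ _ (y01 n)).
    rewrite lerD2l lerN2; apply: (@le_trans _ _ ((expR (n%:R ^+ 2 * a + n%:R) + 1) * expR (- (n%:R ^+ 2 * x)))).
      by rewrite ler_wpM2r// expR_ge0.
    rewrite mulrDl mul1r mulr_natl mulr2n -expRD.
    have n0 : 0 <= n%:R :> R by [].
    apply: lerD; rewrite ler_expR; nra.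
  have bnd : \forall n \near \oo, 1 - 2 * expR (- n%:R) <=
      (1 - expR (- (n%:R ^+ 2 * x))) ^+ K n <= 1.
    apply: filterS lower => n ->/=; rewrite exprn_ile1//.
      by rewrite subr_ge0; case/andP: (y01 n).
  apply: (squeeze_cvgr bnd).
  + rewrite -[X in _ --> X]subr0 -(mulr0 2).
    by apply: cvgB; [exact: cvg_cst|apply: cvgM; [exact: cvg_cst|exact: cvgn_expR]].
  + exact: cvg_cst.
- have bnd : \forall n \near \oo, 0 <=
      (1 - expR (- (n%:R ^+ 2 * x))) ^+ K n <= expR (- n%:R).
    apply: nearW => n; rewrite f0/=.
    apply: (@le_trans _ _ (expR (- expR (- (n%:R ^+ 2 * x))) ^+ K n)).
      rewrite lerXn2r ?nnegrE ?expR_ge0//.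
        by rewrite subr_ge0; case/andP: (y01 n).
      exact: expR_ge1Dx.
    rewrite -expRM_natr ler_expR mulNr lerN2.
    apply: (@le_trans _ _ (expR (- (n%:R ^+ 2 * x)) * expR (n%:R ^+ 2 * a + n%:R))).
      rewrite -expRD; apply: le_trans (expR_ge1Dx _).
      have n0 : 0 <= n%:R :> R by [].
      nra.
    by rewrite ler_wpM2l ?expR_ge0// ltW// Num.Theory.truncnS_gt.
  by apply: (squeeze_cvgr bnd); [exact: cvg_cst|exact: cvgn_expR].
Qed.

Variables m1 m2 : {measure set R -> \bar R}.
Hypotheses (m1oo : (m1 setT < +oo)%E) (m2oo : (m2 setT < +oo)%E).
Hypotheses (m1D : m1 (~` D) = 0%E) (m2D : m2 (~` D) = 0%E).
Hypothesis lap : forall lam : R, 0 <= lam ->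
  (\int[m1]_(x in D) (expR (- (lam * x)))%:E =
   \int[m2]_(x in D) (expR (- (lam * x)))%:E)%E.

Let y01 (c : R) x : 0 <= c -> D x -> 0 <= expR (- (c * x)) <= 1.
Proof.
move=> c0; rewrite /= in_itv/= andbT => x0.
by rewrite expR_ge0 expR_le1 oppr_le0 mulr_ge0.
Qed.

(** With [y = e^(-c x)], [y^j (1 - y)^K] splits as [y^j (1 - y)^(K+1) + y^(j+1) (1 - y)^K]. The
    induction subtracts a finite integral and avoids signed binomial sums. *)
Let laplace_poly (c : R) (K j : nat) : 0 <= c ->
  (\int[m1]_(x in D) (expR (- (c * x)) ^+ j * (1 - expR (- (c * x))) ^+ K)%:E =
   \int[m2]_(x in D) (expR (- (c * x)) ^+ j * (1 - expR (- (c * x))) ^+ K)%:E)%E.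
Proof.
move=> c0; elim: K j => [|K IH] j.
  have E x : (expR (- (c * x)) ^+ j * (1 - expR (- (c * x))) ^+ 0)%:E =
      (expR (- (j%:R * c * x)))%:E.
    by rewrite expr0 mulr1 -expRM_natl mulrN mulrA.
  under eq_integral do rewrite E.
  under [RHS]eq_integral do rewrite E.
  by apply: lap; rewrite mulr_ge0.
pose F k l (x : R) := (expR (- (c * x)) ^+ k * (1 - expR (- (c * x))) ^+ l)%:E.
have mF k l : measurable_fun D (F k l).
  apply/measurable_EFinP; apply: measurable_funM; apply: measurable_funX;
  by apply: measurable_funTS; meas.
have F0 k l x : D x -> (0 <= F k l x)%E.
  by move=> /(y01 c0) /andP[? ?]; rewrite lee_fin mulr_ge0 ?exprn_ge0// subr_ge0.
have F1 k l x : D x -> (F k l x <= 1)%E.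
  move=> /(y01 c0) /andP[? ?]; rewrite lee_fin mulr_ile1 ?exprn_ge0 ?exprn_ile1// ?subr_ge0//.
have FD k l x : (F k l x = F k l.+1 x + F k.+1 l x)%E.
  by rewrite -EFinD; congr EFin; rewrite !exprS; ring.
have fin (m : {measure set R -> \bar R}) k l : (m setT < +oo)%E ->
    (\int[m]_(x in D) F k l x)%E \is a fin_num.
  move=> moo; rewrite ge0_fin_numE; last by apply: integral_ge0; exact: F0.
  apply: (@le_lt_trans _ _ (\int[m]_(x in D) 1)%E).
    by apply: ge0_le_integral => //; [exact: F0|exact: F1].
  rewrite integral_cst// mul1e (le_lt_trans _ moo)//.
  by apply: le_measure; rewrite ?inE.
have add (m : {measure set R -> \bar R}) k l :
    (\int[m]_(x in D) F k l x = \int[m]_(x in D) F k l.+1 x + \int[m]_(x in D) F k.+1 l x)%E.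
  rewrite -ge0_integralD//; [|exact: F0|exact: F0].
  by apply: eq_integral => x _; exact: FD.
have IH' k : (\int[m1]_(x in D) F k K x = \int[m2]_(x in D) F k K x)%E := IH k.
have := add m1 j K; rewrite (IH' j) (IH' j.+1) (add m2 j K).
move=> /(congr1 (fun z => z - \int[m2]_(x in D) F j.+1 K x)%E).
by rewrite !addeK ?fin.
Qed.

Let laplace_ray (a : R) : 0 <= a -> m1 `]a, +oo[%classic = m2 `]a, +oo[%classic.
Proof.
move=> a0.
pose f n (x : R) := ((1 - expR (- (n%:R ^+ 2 * x))) ^+
  (Num.truncn (expR (n%:R ^+ 2 * a + n%:R))).+1)%:E.
have E n : (\int[m1]_(x in D) f n x = \int[m2]_(x in D) f n x)%E.
  have := @laplace_poly (n%:R ^+ 2) (Num.truncn (expR (n%:R ^+ 2 * a + n%:R))).+1 0.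
  have fE (m : {measure set R -> \bar R}) : (\int[m]_(x in D) f n x =
      \int[m]_(x in D) (expR (- (n%:R ^+ 2 * x)) ^+ 0 * (1 - expR (- (n%:R ^+ 2 * x))) ^+
      (Num.truncn (expR (n%:R ^+ 2 * a + n%:R))).+1)%:E)%E.
    by apply: eq_integral => x _; rewrite expr0 mul1r.
  by rewrite !fE; apply; exact: sqr_ge0.
have lim (m : {measure set R -> \bar R}) : (m setT < +oo)%E ->
    (\int[m]_(x in D) f n x)%E @[n --> \oo] --> m `]a, +oo[%classic.
  move=> moo.
  have aD : `]a, +oo[ `<=` D.
    by move=> x /=; rewrite !in_itv/= !andbT => /ltW; apply: le_trans.
  have -> : m `]a, +oo[%classic = (\int[m]_(x in D) (\1_(`]a, +oo[) x)%:E)%E.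
    by rewrite integral_indic// setIidl.
  apply: (@dominated_cvg _ _ _ m D _ f _ (cst 1%E)) => //.
  - move=> n; apply/measurable_EFinP/measurable_funX/measurable_funTS.
    by meas.
  - move=> x Dx; apply: cvg_EFin; first exact: nearW.
    by apply: cvg_laplace_indic => //; move: Dx; rewrite /= in_itv/= andbT.
  - apply/integrableP; split => //; under eq_integral do rewrite abse1.
    rewrite integral_cst// mul1e (le_lt_trans _ moo)//.
    by apply: le_measure; rewrite ?inE.
  - move=> n x Dx; rewrite gee0_abs lee_fin.
      apply: exprn_ile1; have /andP[? ?] := @y01 (n%:R ^+ 2) x (sqr_ge0 _) Dx.
        by rewrite subr_ge0.
      by rewrite gerBl.
    by rewrite exprn_ge0// subr_ge0; have /andP[] := @y01 (n%:R ^+ 2) x (sqr_ge0 _) Dx.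
apply: (cvg_unique _ (lim m1 m1oo)) => //.
by rewrite (funext E); exact: lim.
Qed.

(** Open rays are stable under intersection and generate the Borel sets. [laplace_ray] covers
    [0 <= a]; a ray with [a < 0] contains [D], which carries all the mass. *)
Lemma laplace_unique A : measurable A -> m1 A = m2 A.
Proof.
have full (m : {measure set R -> \bar R}) (B : set R) : m (~` D) = 0%E ->
    measurable B -> D `<=` B -> m B = m D.
  move=> m0 mB DB; apply/eqP; rewrite eq_le; apply/andP; split; last first.
    by apply: le_measure; rewrite ?inE.
  apply: (@le_trans _ _ (m (D `|` ~` D))).
    by apply: le_measure; rewrite ?inE ?setUv.
  apply: (le_trans (measureU2 _ _ _)) => //; first exact: measurableC.
  by rewrite [X in (_ + X)%E]m0 adde0.
have mDE : m1 D = m2 D.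
  have e (m : {measure set R -> \bar R}) :
      (\int[m]_(x in D) (expR (- (0 * x)))%:E = m D)%E.
    by under eq_integral do rewrite mul0r oppr0 expR0; rewrite integral_cst// mul1e.
  by have := lap (lexx 0); rewrite !e.
apply: (@measure_unique _ _ _ (@RGenOInfty.G R) (fun n => `](- n%:R)%R, +oo[%classic)) => //.
- exact: RGenOInfty.measurableE.
- move=> _ _ [x ->] [y ->]; exists (Num.max x y).
  by apply/seteqP; split => z /=; rewrite !in_itv/= !andbT gt_max => /andP.
- by move=> n; eexists.
- apply/seteqP; split => // x _; exists (Num.truncn `|x|).+1 => //=.
  rewrite in_itv/= andbT ltrNl (le_lt_trans (ler_norm _))// normrN.
  exact: Num.Theory.truncnS_gt.
- move=> _ [a ->]; have [a0|a0] := leP 0 a; first exact: laplace_ray.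
  have Da : D `<=` `]a, +oo[.
    by move=> x /=; rewrite !in_itv/= !andbT; exact: lt_le_trans.
  by rewrite (full m1)// (full m2).
- move=> k; apply: le_lt_trans m1oo.
  by apply: le_measure; rewrite ?inE//; exact: measurable_itv.
Qed.

End laplace_uniqueness.

Lemma same_law_integral (R : realType) (mu nu : {measure set R -> \bar R})
    (D : set R) (f : R -> \bar R) : same_law mu nu ->
  (\int[mu]_(x in D) f x = \int[nu]_(x in D) f x)%E.
Proof. by move=> h; apply: eq_measure_integral => A mA _; exact: h. Qed.

Lemma probability_null d (T : measurableType d) (R : realType)
    (P : probability T R) (D : set T) :
  measurable D -> P D = 1%E -> P (~` D) = 0%E.
Proof. by move=> mD PD; rewrite probability_setC// PD subee. Qed.

Lemma density_null d (T : measurableType d) (R : realType)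
    (m N : {measure set T -> \bar R}) (D : set T) (F : T -> \bar R) :
  measurable D -> m (~` D) = 0%E -> measurable_fun [set: T] F ->
  (forall A, measurable A -> N A = \int[m]_(x in A) F x)%E -> N (~` D) = 0%E.
Proof.
move=> mD mD0 mF NE; have mC := measurableC mD; rewrite NE//.
by apply: null_set_integral => //; exact: measurable_funTS.
Qed.

Section densities.
Context d (T : measurableType d) (R : realType).
Variables (m nu : {measure set T -> \bar R}) (D : set T) (f : T -> R).
Hypotheses (mD : measurable D) (nuf : has_density m D f nu).

Lemma has_density_integral (g : T -> \bar R) :
  measurable_fun [set: T] g -> (forall x, 0 <= g x)%E ->
  (\int[nu]_x g x = \int[m]_(x in D) (g x * (f x)%:E))%E.
Proof.
case: nuf => mf f0 nuE mg g0.
rewrite (@integral_density _ _ _ m nu ((fun x => (f x)%:E) \_ D))//.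
- rewrite [RHS]integral_mkcond; apply: eq_integral => x _.
  by rewrite !patchE; case: ifPn => _; rewrite ?mule0.
- by apply/(measurable_restrictT _ _).1 => //; apply/measurable_EFinP.
- by move=> x; rewrite patchE; case: ifPn => // /set_mem Dx; rewrite lee_fin f0.
- move=> A mA; rewrite nuE// [LHS]integral_mkcond [RHS]integral_mkcond.
  apply: eq_integral => x _; rewrite !patchE in_setI.
  by case: (x \in A); case: (x \in D).
Qed.

End densities.

Section lebesgue_densities.
Variables (R : realType) (nu : {measure set R -> \bar R}) (D : set R) (f : R -> R).
Hypotheses (mD : measurable D) (nuf : has_density lebesgue_measure D f nu).

Lemma lebesgue_density_integral (g : R -> \bar R) :
  measurable_fun [set: R] g -> (forall x, 0 <= g x)%E ->
  (\int[nu]_x g x = \int[lebesgue_measure]_(x in D) (g x * (f x)%:E))%E.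
Proof.
move=> mg g0.
(* [lebesgue_measure] lives on [measurableTypeR R], not on [R]. *)
pose id' : R -> measurableTypeR R := id.
have mid' : measurable_fun [set: R] id' by move=> _ Y mY; rewrite setTI; exact: mY.
pose nu'_ := (pushforward nu id' : {measure set (measurableTypeR R) -> \bar R}).
pose nu' := nu'_ mid'.
rewrite -(@has_density_integral _ (measurableTypeR R) R lebesgue_measure nu' D f)//.
by rewrite /nu' (@ge0_integral_pushforward _ _ _ _ _ id' mid' nu setT g measurableT mg (fun y _ => g0 y)).
Qed.

End lebesgue_densities.

(** * Gamma laws and their Laplace transform *)

Section gamma.
Variables (R : realType) (a : R) (G : probability R R).
Hypothesis Ga : gamma_law a G.
Local Notation mu := (@lebesgue_measure R).

Lemma gamma_law_integral : exists2 k : R, 0 < k & forall g : R -> \bar R,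
  measurable_fun [set: R] g -> (forall x, 0 <= g x)%E ->
  (\int[G]_x g x =
   k%:E * \int[mu]_(x in `]0%R, +oo[) (g x * (x `^ (a - 1) * expR (- x))%:E))%E.
Proof.
have [k k0 h] := Ga; exists k => // g mg g0.
rewrite (lebesgue_density_integral _ h)//.
rewrite -ge0_integralZl//; last 3 first.
- by apply: emeasurable_funM; apply: measurable_funTS => //; meas.
- by move=> x _; rewrite mule_ge0// lee_fin !mulr_ge0 ?powR_ge0 ?expR_ge0.
- by rewrite lee_fin ltW.
by apply: eq_integral => x _; rewrite EFinM muleCA.
Qed.

Lemma gamma_law_full : G `]0, +oo[%classic = 1%E.
Proof. have [k k0 [mf f0 GE]] := Ga.
have /= GC := probability_setC G (measurable_itv `]0, +oo[).
have := GE (~` `]0, +oo[%classic) (measurableC (measurable_itv _)).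
rewrite setICl integral_set0 GC => /eqP; rewrite sube_eq ?fin_num_measure//.
by rewrite add0e => /eqP <-. Qed.

Lemma gamma_laplace (lam : R) : 0 <= lam ->
  (\int[G]_x (expR (- (lam * x)))%:E = ((1 + lam) `^ (- a))%:E)%E.
Proof.
move=> lam0; have [k k0 GE] := gamma_law_integral.
have c0 : 0 < (1 + lam)^-1 by rewrite invr_gt0 ltr_wpDr.
rewrite GE//; [|by meas].
under eq_integral do rewrite -EFinM.
rewrite (@ge0_integral_scale _ _ (1 + lam)^-1)//; last 2 first.
- by meas.
- by move=> x _; rewrite lee_fin !mulr_ge0 ?powR_ge0 ?expR_ge0.
have E : (\int[mu]_(x in `]0%R, +oo[)
      (expR (- (lam * ((1 + lam)^-1 * x))) *
       (((1 + lam)^-1 * x) `^ (a - 1) * expR (- ((1 + lam)^-1 * x))))%:E =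
    \int[mu]_(x in `]0%R, +oo[) (((1 + lam)^-1 `^ (a - 1))%:E *
      (1 * (x `^ (a - 1) * expR (- x)))%:E))%E.
  apply: eq_integral => x /set_mem/=; rewrite in_itv/= andbT => x0.
  rewrite powRM ?ltW// -EFinM; congr EFin.
  rewrite mulrCA -!mulrA -expRD mul1r; congr (_ * (_ * expR _)).
  by field; rewrite gt_eqF// ltr_wpDr.
rewrite E ge0_integralZl//; last 3 first.
- by apply: measurable_funTS; meas.
- by move=> x _; rewrite lee_fin !mulr_ge0 ?powR_ge0 ?expR_ge0.
- by rewrite lee_fin powR_ge0.
have G1 : (1 = k%:E * \int[mu]_(x in `]0%R, +oo[) (1 * (x `^ (a - 1) * expR (- x)))%:E)%E.
  transitivity (\int[G]_x (cst 1 x))%E; last by rewrite GE.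
  by rewrite integral_cst// mul1e; exact/esym/probability_setT.
rewrite muleCA (muleCA k%:E) -G1.
rewrite mule1 -EFinM; congr EFin.
have y0 : 0 < 1 + lam by rewrite ltr_wpDr.
rewrite -powR_inv1 ?ltW// -powRrM -powRD; last by rewrite (gt_eqF y0) implybT.
by congr (_ `^ _); ring.
Qed.

End gamma.

(** * Uniqueness for the Stieltjes transform of order [tau] *)

Section stieltjes.
Variable R : realType.
Local Notation mu := (@lebesgue_measure R).
Local Notation D := (`[0%R, +oo[%classic : set R).

Lemma integral_expR_y (c s : R) : 0 < c ->
  (\int[mu]_(x in `[s, +oo[) (expR (- (c * x)))%:E = (expR (- (c * s)) / c)%:E)%E.
Proof.
move=> c0.
have dF (x : R) : is_derive x 1 (fun y => - c^-1 * expR (- (c * y))) (expR (- (c * x))).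
  have H1 : is_derive x 1 (fun y : R => - (c * y)) (- c).
    by apply: is_deriveN; apply: is_derive_eq; rewrite /GRing.scale/= mulr1.
  have H := @is_derive1_comp R (@expR R) (fun y => - (c * y)) x _ _ (is_derive_expR _) H1.
  apply: (is_derive_eq (@is_deriveZ _ _ _ (fun y : R => expR (- (c * y))) (- c^-1) x 1 _ H)).
  by rewrite /GRing.scale/=; field; rewrite gt_eqF.
have cf (x : R) : {for x, continuous (fun y => expR (- (c * y)))}.
  apply: (@continuous_comp R R R (fun y => - (c * y)) expR); last exact: continuous_expR.
  by apply: continuousN; apply: continuousM; [exact: cvg_cst|exact: cvg_id].
have -> : (expR (- (c * s)) / c)%:E = ((0 : R)%:E - (- c^-1 * expR (- (c * s)))%:E)%E.
  by rewrite -EFinB; congr EFin; ring.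
apply: (@ge0_continuous_FTC2y _ (fun x => expR (- (c * x)))
  (fun y => - c^-1 * expR (- (c * y)))).
- by move=> x _; exact: expR_ge0.
- by apply: continuous_in_subspaceT => x _; exact: cf.
- rewrite -[X in _ --> X](mulr0 (- c^-1)); apply: cvgM; first exact: cvg_cst.
  apply: (@cvg_comp _ _ _ (fun x => c * x) (fun y => expR (- y)) _ (pinfty_nbhs R)); last exact: cvgr_expR.
  by apply: gt0_cvgMry.
- by move=> x _; have := dF x => ?; exact: ex_derive.
- apply: cvg_at_right_filter; apply: cvgM; [exact: cvg_cst|exact: cf].
- by move=> x _; have := dF x => ?; rewrite derive1E derive_val.
Qed.

Lemma stieltjes_gamma (tau : R) (G M : probability R R) (s : R) :
  gamma_law tau G -> 0 <= s ->
  (\int[M]_(m in D) ((1 + (s + m)) `^ (- tau))%:E =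
   \int[G]_u \int[M]_(m in D) (expR (- ((s + m) * u)))%:E)%E.
Proof.
move=> Gt s0.
rewrite -(@tonelli_on _ _ _ _ R M G D setT _ _ (fun m u => expR (- ((s + m) * u))))//.
- apply: eq_integral => m /set_mem/=; rewrite in_itv/= andbT => m0.
  by rewrite (gamma_laplace Gt)// addr_ge0.
- by meas.
Qed.

(** As a function of the shift [s], the transform is the Laplace transform of [phi M (u) G(du)],
    with [phi M] the Laplace transform of [M]. Laplace uniqueness identifies these measures, and a
    second use of it, on a weighted version of [M], recovers [M]. *)
Lemma stieltjes_unique (tau : R) (G M1 M2 : probability R R) :
  gamma_law tau G -> M1 D = 1%E -> M2 D = 1%E ->
  (forall lam : R, 0 <= lam ->
    (\int[M1]_(m in D) ((1 + lam * m) `^ (- tau))%:E =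
     \int[M2]_(m in D) ((1 + lam * m) `^ (- tau))%:E)%E) ->
  same_law M1 M2.
Proof.
move=> Gt M1D M2D H.
have mD : measurable D by exact: measurable_itv.
(* Factoring out [1 + s] reduces the shifted kernel to the hypothesis at [lam = 1 / (1 + s)]. *)
have H' (s : R) : 0 <= s ->
    (\int[M1]_(m in D) ((1 + (s + m)) `^ (- tau))%:E =
     \int[M2]_(m in D) ((1 + (s + m)) `^ (- tau))%:E)%E.
  move=> s0; have s1 : 0 < 1 + s by rewrite ltr_wpDr.
  have E (M : probability R R) : (\int[M]_(m in D) ((1 + (s + m)) `^ (- tau))%:E =
      ((1 + s) `^ (- tau))%:E * \int[M]_(m in D) ((1 + (1 + s)^-1 * m) `^ (- tau))%:E)%E.
    rewrite -ge0_integralZl//; last 3 first.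
    - by apply: measurable_funTS; meas.
    - by move=> x _; rewrite lee_fin powR_ge0.
    - by rewrite lee_fin powR_ge0.
    apply: eq_integral => m /set_mem/=; rewrite in_itv/= andbT => m0.
    rewrite -EFinM -powRM ?ltW//; last first.
      by rewrite ltr_wpDr// mulr_ge0// invr_ge0 ltW.
    by congr (_ `^ _)%:E; field; rewrite gt_eqF.
  by rewrite !E H// invr_ge0 ltW.
pose phi (M : probability R R) (u : R) : \bar R := (\int[M]_(m in D) (expR (- (m * u)))%:E)%E.
have mphi M : measurable_fun [set: R] (phi M).
  apply: (@measurable_integral_param _ _ _ _ R M setT D _ _ (fun u m => expR (- (m * u)))) => //.
  by meas.
have phi0 M u : (0 <= phi M u)%E by apply: integral_ge0 => x _; rewrite lee_fin expR_ge0.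
have [N1 N1E] := density_measure_ex G (mphi M1) (phi0 M1).
have [N2 N2E] := density_measure_ex G (mphi M2) (phi0 M2).
have GD : G (~` D) = 0%E.
  apply: probability_null => //; apply/eqP; rewrite eq_le probability_le1//=.
  apply: (@le_trans _ _ (G `]0, +oo[%classic)); first by rewrite (gamma_law_full Gt).
  apply: le_measure; rewrite ?inE//.
  by move=> x /=; rewrite !in_itv/= !andbT => /ltW.
have Nlap (M : probability R R) (N : {measure set R -> \bar R}) (s : R) :
    (forall A, measurable A -> N A = \int[G]_(x in A) phi M x)%E -> 0 <= s ->
    (\int[N]_(u in D) (expR (- (s * u)))%:E =
     \int[M]_(m in D) ((1 + (s + m)) `^ (- tau))%:E)%E.
  move=> NE s0; rewrite integral_full//; last 2 first.
  - exact: (density_null mD GD (mphi M) NE).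
  - by meas.
  rewrite (integral_density (mphi M) (phi0 M) NE)//; last by meas.
  rewrite (stieltjes_gamma M Gt)//; apply: eq_integral => u _.
  rewrite /phi -ge0_integralZl//; last by apply: measurable_funTS; meas.
  by apply: eq_integral => m _; rewrite -EFinM -expRD; congr (expR _)%:E; ring.
have phi1 (M : probability R R) u : D u -> (phi M u <= 1)%E.
  rewrite /= in_itv/= andbT => u0.
  apply: (@le_trans _ _ (\int[M]_(m in D) 1)%E).
    apply: ge0_le_integral => //.
    - by apply: measurable_funTS; meas.
    - move=> m /=; rewrite in_itv/= andbT => m0.
      by rewrite lee_fin expR_le1 oppr_le0 mulr_ge0.
  by rewrite integral_cst// mul1e probability_le1.
have N0 (M : probability R R) (N : {measure set R -> \bar R}) :
    (forall A, measurable A -> N A = \int[G]_(x in A) phi M x)%E ->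
    N (~` D) = 0%E /\ (N setT < +oo)%E.
  move=> NE; split; first exact: (density_null mD GD (mphi M) NE).
  rewrite NE// -(integral_full mD GD (mphi M)).
  apply: (@le_lt_trans _ _ (\int[G]_(m in D) 1)%E).
    by apply: ge0_le_integral => //; [exact: measurable_funTS|exact: phi1].
  by rewrite integral_cst// mul1e (le_lt_trans (probability_le1 _ _))// ltry.
have [N10 N1oo] := N0 M1 N1 N1E.
have [N20 N2oo] := N0 M2 N2 N2E.
have NN A : measurable A -> N1 A = N2 A.
  by apply: laplace_unique => // s s0; rewrite !(Nlap _ _ _ N1E, Nlap _ _ _ N2E)// H'.
have [k k0 GE] := gamma_law_integral Gt.
(* Equality of [N1] and [N2] controls [phi M] only almost everywhere. Integrating over [[s, +oo[]
   against [u^(1 - tau)], which cancels the power in the gamma density, gives an identity at every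
   [s > 0]. *)
have key (M : probability R R) (N : {measure set R -> \bar R}) (s : R) :
    (forall A, measurable A -> N A = \int[G]_(x in A) phi M x)%E -> 0 < s ->
    (\int[M]_(m in D) (expR (- ((1 + m) * s)) / (1 + m))%:E =
     k^-1%:E * \int[N]_u (\1_(`[s, +oo[) u * u `^ (1 - tau))%:E)%E.
  move=> NE s0.
  have mh : measurable_fun [set: R] (fun u : R => (\1_(`[s, +oo[) u * u `^ (1 - tau))%:E).
    apply/measurable_EFinP; apply: measurable_funM; last by meas.
    by apply: measurable_indic; exact: measurable_itv.
  rewrite (integral_density (mphi M) (phi0 M) NE)//; last first.
    by move=> u; rewrite lee_fin mulr_ge0 ?powR_ge0.
  rewrite GE//; last 2 first.
  - exact: emeasurable_funM.
  - by move=> x; rewrite mule_ge0// lee_fin mulr_ge0 ?powR_ge0.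
  rewrite muleA -EFinM mulVf ?gt_eqF// mul1e.
  transitivity (\int[mu]_(u in `[s, +oo[) \int[M]_(m in D) (expR (- ((1 + m) * u)))%:E)%E.
    rewrite -(@tonelli_on _ _ _ _ R M mu D `[s, +oo[%classic _ _ (fun m u => expR (- ((1 + m) * u))))//.
    - apply: eq_integral => m /set_mem/=; rewrite in_itv/= andbT => m0.
      by rewrite integral_expR_y// ltr_wpDr.
    - by meas.
  rewrite [LHS]integral_mkcond [RHS]integral_mkcond; apply: eq_integral => u _.
  rewrite !patchE mem_setE in_itv/= andbT mem_setE in_itv/= andbT indicE mem_setE in_itv/= andbT.
  case: ifPn => su; last by rewrite mul0r !mul0e; case: ifPn.
  have u0 : 0 < u by exact: lt_le_trans su.
  rewrite u0 mul1r muleAC -EFinM mulrA -powRD; last by rewrite (gt_eqF u0) implybT.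
  rewrite addrC addrA subrK subrr powRr0 mul1r /phi -ge0_integralZl//; last first.
    by apply: measurable_funTS; meas.
  by apply: eq_integral => m _; rewrite -EFinM -expRD; congr (expR _)%:E; ring.
have key2 (s : R) : 0 < s ->
    (\int[M1]_(m in D) (expR (- ((1 + m) * s)) / (1 + m))%:E =
     \int[M2]_(m in D) (expR (- ((1 + m) * s)) / (1 + m))%:E)%E.
  move=> s0; rewrite (key _ _ _ N1E s0) (key _ _ _ N2E s0); congr (_ * _)%E.
  exact: same_law_integral.
(* The weight [e^(-m)] moves the argument to [1 + s > 0], so that [key2] also serves at [s = 0]. The
   power [-1], unlike an inverse, is nonnegative at every real [m]. *)
pose F (m : R) : \bar R := (expR (- m) * (1 + m) `^ (-1))%:E.
have mF : measurable_fun [set: R] F by rewrite /F; meas.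
have F0 m : (0 <= F m)%E by rewrite lee_fin mulr_ge0 ?expR_ge0 ?powR_ge0.
have [W1 W1E] := density_measure_ex M1 mF F0.
have [W2 W2E] := density_measure_ex M2 mF F0.
have M1n := probability_null mD M1D.
have M2n := probability_null mD M2D.
have W0 (M : probability R R) (W : {measure set R -> \bar R}) : M (~` D) = 0%E ->
    (forall A, measurable A -> W A = \int[M]_(x in A) F x)%E ->
    W (~` D) = 0%E /\ (W setT < +oo)%E.
  move=> MD WE; split; first exact: (density_null mD MD mF WE).
  rewrite WE// -(integral_full mD MD mF).
  apply: (@le_lt_trans _ _ (\int[M]_(m in D) 1)%E).
    apply: ge0_le_integral => //; first exact: measurable_funTS.
    move=> m /=; rewrite in_itv/= andbT => m0; rewrite lee_fin mulr_ile1 ?expR_ge0 ?powR_ge0//.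
      by rewrite expR_le1 oppr_le0.
    by rewrite powR_inv1 ?addr_ge0// invf_le1 ?ltr_wpDr// lerDl.
  by rewrite integral_cst// mul1e (le_lt_trans (probability_le1 _ _))// ltry.
have [W10 W1oo] := W0 M1 W1 M1n W1E.
have [W20 W2oo] := W0 M2 W2 M2n W2E.
have Wlap (M : probability R R) (W : {measure set R -> \bar R}) (s : R) : 0 <= s ->
    W (~` D) = 0%E -> M (~` D) = 0%E ->
    (forall A, measurable A -> W A = \int[M]_(x in A) F x)%E ->
    (\int[W]_(u in D) (expR (- (s * u)))%:E =
     (expR (1 + s))%:E * \int[M]_(m in D) (expR (- ((1 + m) * (1 + s))) / (1 + m))%:E)%E.
  move=> s0 WD MD WE; rewrite integral_full//; last by meas.
  rewrite (integral_density mF F0 WE)//; last by meas.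
  rewrite -(integral_full mD MD); last by apply: emeasurable_funM => //; meas.
  have E x : D x -> (expR (- ((1 + x) * (1 + s))) / (1 + x))%:E =
      (expR (- ((1 + x) * (1 + s))) * (1 + x) `^ (-1))%:E.
    by rewrite /= in_itv/= andbT => x0; rewrite powR_inv1// addr_ge0.
  under [in RHS]eq_integral => x /set_mem xD do rewrite (E x xD).
  rewrite -[RHS]ge0_integralZl; last 4 first.
  - exact: mD.
  - by apply: measurable_funTS; meas.
  - by move=> x _; rewrite lee_fin mulr_ge0 ?expR_ge0 ?powR_ge0.
  - by rewrite lee_fin expR_ge0.
  apply: eq_integral => m _; rewrite /F -!EFinM !mulrA -!expRD.
  by congr (expR _ * _)%:E; ring.
have WW A : measurable A -> W1 A = W2 A.
  apply: laplace_unique => // s s0.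
  by rewrite (Wlap _ _ _ s0 W10 M1n W1E) (Wlap _ _ _ s0 W20 M2n W2E) key2// ltr_wpDr.
move=> A mA.
(* [F] is positive on [D], so it can be divided out and [M] is recovered from [W]. *)
have rec (M : probability R R) (W : {measure set R -> \bar R}) :
    M (~` D) = 0%E ->
    (forall A, measurable A -> W A = \int[M]_(x in A) F x)%E ->
    M A = (\int[W]_m (\1_A m * (expR m * (1 + m) `^ 1))%:E)%E.
  move=> MD WE.
  have m1 : measurable_fun [set: R] (fun m : R => (\1_A m * (expR m * (1 + m) `^ 1))%:E).
    by apply/measurable_EFinP; apply: measurable_funM; [exact: measurable_indic|meas].
  have m1' : measurable_fun [set: R] (fun m : R => (\1_A m : R)%:E).
    by apply/measurable_EFinP; exact: measurable_indic.
  rewrite (integral_density mF F0 WE)//; last first.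
    by move=> x; rewrite lee_fin !mulr_ge0 ?expR_ge0 ?powR_ge0.
  rewrite -(integral_full mD MD); last exact: emeasurable_funM.
  transitivity (\int[M]_m (\1_A m : R)%:E)%E; first by rewrite integral_indic// setIT.
  rewrite -(integral_full mD MD m1'); apply: eq_integral => m /set_mem/=.
  rewrite in_itv/= andbT => m0; rewrite /F -EFinM; congr EFin.
  rewrite -mulrA mulrACA -expRD subrr expR0 mul1r -powRD; last first.
    by have m10 : 0 < 1 + m by [rewrite ltr_wpDr]; rewrite (gt_eqF m10) implybT.
  by rewrite subrr powRr0 mulr1.
by rewrite (rec _ _ M1n W1E) (rec _ _ M2n W2E); exact: same_law_integral.
Qed.

End stieltjes.

(** * Stable laws and Dirichlet means *)

Lemma probability_null_full d (T : measurableType d) (R : realType)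
    (P : probability T R) (D : set T) :
  measurable D -> P (~` D) = 0%E -> P D = 1%E.
Proof.
move=> mD P0; have := probability_setC P mD; rewrite [LHS]P0.
move=> /esym/eqP; rewrite sube_eq ?fin_num_measure//.
by rewrite add0e => /eqP <-.
Qed.

Lemma integral_gt0 d (T : measurableType d) (R : realType)
    (m : {measure set T -> \bar R}) (D : set T) (f : T -> \bar R) :
  measurable D -> measurable_fun D f -> (forall x, D x -> 0 < f x)%E ->
  (0 < m D)%E -> (0 < \int[m]_(x in D) f x)%E.
Proof.
move=> mD mf f0 mD0; have f0' x : D x -> (0 <= f x)%E by move=> /f0/ltW.
rewrite lt_def integral_ge0// andbT; apply/eqP => If0.
have /(ae_eq_integral_abs _ mD mf) : (\int[m]_(x in D) `|f x| = 0)%E.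
  rewrite -[RHS]If0; apply: eq_integral => x /set_mem Dx.
  by rewrite gee0_abs// f0'.
move=> [N [mN N0 DN]].
have DN' : D `<=` N.
  by move=> x Dx; apply: DN => /(_ Dx) fx0; have := f0 _ Dx; rewrite fx0 ltxx.
by move: mD0; rewrite (subset_measure0 mD mN DN' N0) ltxx.
Qed.

Lemma probability_gt0_ge0 (R : realType) (P : probability R R) :
  P `]0, +oo[%classic = 1%E -> P `[0, +oo[%classic = 1%E.
Proof.
move=> P1; apply/eqP; rewrite eq_le probability_le1//= -P1.
apply: le_measure; rewrite ?inE//.
by move=> x /=; rewrite !in_itv/= !andbT => /ltW.
Qed.

(** * Products of independent variables and gamma mixtures *)

Section product_laws.
Variable R : realType.
Local Notation mu := (@lebesgue_measure R).
Local Notation D := (`[0%R, +oo[%classic : set R).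

Lemma integral_prod_law (G M : probability R R) (f : R -> R) :
  measurable_fun [set: R] f -> (forall x, 0 <= f x) ->
  (\int[prod_law G M]_x (f x)%:E = \int[M]_y \int[G]_x (f (x * y))%:E)%E.
Proof.
move=> mf f0; have mEf : measurable_fun [set: R] (fun y => (f y)%:E) by exact/measurable_EFinP.
rewrite ge0_integral_distribution//.
rewrite (fubini_tonelli2 (fun z => (f (mul2 z))%:E))//=.
- apply/measurable_EFinP; exact: (measurableT_comp mf (@measurable_mul2 R)).
- by move=> x; rewrite lee_fin.
Qed.

Lemma prod_law_ge0 (G M : probability R R) : G D = 1%E -> M D = 1%E ->
  prod_law G M D = 1%E.
Proof.
move=> GD MD; have mD : measurable D by exact: measurable_itv.
have mI : measurable_fun [set: R] (fun x : R => \1_D x : R) by exact: measurable_indic.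
transitivity (\int[prod_law G M]_x (\1_D x : R)%:E)%E.
  by rewrite integral_indic// setIT.
rewrite integral_prod_law//.
have MC := probability_null mD MD.
have m2 : measurable_fun [set: R] (fun y => \int[G]_x (\1_D (x * y) : R)%:E)%E.
  apply: (@measurable_integral_param _ _ _ _ R G setT setT _ _ (fun y x => \1_D (x * y))) => //.
  apply: (measurableT_comp mI); meas.
rewrite -(integral_full mD MC)//.
transitivity (\int[M]_(y in D) 1)%E; last by rewrite integral_cst// mul1e.
apply: eq_integral => y /set_mem/=; rewrite in_itv/= andbT => y0.
have m3 : measurable_fun [set: R] (fun x => (\1_D (x * y) : R)%:E).
  apply/measurable_EFinP; apply: (measurableT_comp mI); meas.
rewrite -(integral_full mD (probability_null mD GD))//.
transitivity (\int[G]_(y in D) 1)%E; last by rewrite integral_cst// mul1e.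
apply: eq_integral => x /set_mem/=; rewrite in_itv/= andbT => x0.
by rewrite indicE mem_set//= in_itv/= andbT mulr_ge0.
Qed.

Lemma gamma_law_ge0 (a : R) (G : probability R R) : gamma_law a G -> G D = 1%E.
Proof.
by move=> Ga; apply: probability_gt0_ge0; exact: gamma_law_full Ga.
Qed.

Lemma laplace_gamma_mix (tau : R) (G M : probability R R) (lam : R) :
  gamma_law tau G -> M D = 1%E -> 0 <= lam ->
  (\int[prod_law G M]_(x in D) (expR (- (lam * x)))%:E =
   \int[M]_(m in D) ((1 + lam * m) `^ (- tau))%:E)%E.
Proof.
move=> Gt MD lam0; have mD : measurable D by exact: measurable_itv.
rewrite integral_fullP//; last 2 first.
- by apply: prod_law_ge0 => //; exact: gamma_law_ge0 Gt.
- by meas.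
rewrite integral_prod_law//; last by meas.
rewrite -(integral_full mD (probability_null mD MD)); last first.
  apply: (@measurable_integral_param _ _ _ _ R G setT setT _ _ (fun y x => expR (- (lam * (x * y))))) => //.
  by meas.
apply: eq_integral => m /set_mem/=; rewrite in_itv/= andbT => m0.
rewrite -(gamma_laplace Gt) ?mulr_ge0//.
by apply: eq_integral => x _; congr (expR _)%:E; ring.
Qed.

Lemma GGC_laplace (tau : R) (H L : probability R R) : GGC_law tau H L ->
  L D = 1%E /\ forall lam : R, 0 <= lam ->
   (\int[L]_(x in D) (expR (- (lam * x)))%:E =
    (expR (- (tau * \int[H]_(x in D) ln (1 + lam * x))))%:E)%E.
Proof.
move=> [G [M [Gt [_ _ MD ME] LE]]]; split.
  by rewrite LE// prod_law_ge0//; exact: gamma_law_ge0 Gt.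
by move=> lam lam0; rewrite (same_law_integral _ _ LE) (laplace_gamma_mix Gt)// ME.
Qed.

Lemma probability_laplace_unique (L1 L2 : probability R R) :
  L1 D = 1%E -> L2 D = 1%E ->
  (forall lam : R, 0 <= lam ->
   (\int[L1]_(x in D) (expR (- (lam * x)))%:E =
    \int[L2]_(x in D) (expR (- (lam * x)))%:E)%E) -> same_law L1 L2.
Proof.
move=> L1D L2D h A mA; have mD : measurable D by exact: measurable_itv.
apply: (@laplace_unique R L1 L2) => //.
- by rewrite [ltLHS]probability_setT ltry.
- by rewrite [ltLHS]probability_setT ltry.
- exact: probability_null mD L1D.
- exact: probability_null mD L2D.
Qed.

End product_laws.

(** * Pairs of independent positive stable variables *)

Section stable.
Variables (R : realType) (al : R).
Hypothesis al0 : 0 < al.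
Local Notation mu := (@lebesgue_measure R).
Local Notation D := (`[0%R, +oo[%classic : set R).
Local Notation D1 := (`]0%R, +oo[%classic : set R).
Variable S : probability R R.
Hypothesis Sst : positive_stable_law al S.

Let SD : S D1 = 1%E. Proof. by case: Sst. Qed.
Let mD1 : measurable D1. Proof. exact: measurable_itv. Qed.

Lemma stable_laplace (lam : R) : 0 <= lam ->
  (\int[S]_(x in D1) (expR (- (lam * x)))%:E = (expR (- (lam `^ al)))%:E)%E.
Proof. by case: Sst => _; exact. Qed.

Let Q : probability (R * R)%type R := (S \x S)%E.
Let DD : set (R * R) := D1 `*` D1.

Let mDD : measurable DD. Proof. exact: measurableX. Qed.

Let QDD : Q DD = 1%E.
Proof.
transitivity (S D1 * S D1)%E; first exact: product_measure1E.
by rewrite SD mule1.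
Qed.

Lemma stable_pair_null : Q (~` DD) = 0%E.
Proof. exact: (probability_null mDD QDD). Qed.

Lemma stable_laplace2 (d e t : R) : 0 <= d -> 0 <= e -> 0 <= t ->
  (\int[Q]_(z in DD) (expR (- ((d * z.1 + e * z.2) * t)))%:E =
   (expR (- ((d `^ al + e `^ al) * t `^ al)))%:E)%E.
Proof.
move=> d0 e0 t0; rewrite integral_fullP//; last by meas.
rewrite (fubini_tonelli1 (fun z => (expR (- ((d * z.1 + e * z.2) * t)))%:E))//; last by meas.
have SC := probability_null mD1 SD.
transitivity (\int[S]_x ((expR (- ((e * t) `^ al)))%:E * (expR (- (d * t * x)))%:E))%E.
  apply: eq_integral => x _.
  rewrite -stable_laplace ?mulr_ge0// muleC -ge0_integralZl//; last first.
    by apply: measurable_funTS; meas.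
  rewrite integral_full// /fubini_F; last by meas.
  by apply: eq_integral => y _; rewrite -EFinM -expRD; congr (expR _)%:E => /=; ring.
rewrite ge0_integralZl//; last by meas.
rewrite -(integral_full mD1 SC); last by meas.
rewrite stable_laplace ?mulr_ge0// -EFinM -expRD !powRM//.
by congr (expR _)%:E; ring.
Qed.

(** Frullani of order 1 expresses the difference of logarithms for each fixed pair; averaging
    replaces [t] by [t^al] in the exponents, and Frullani of order [al] evaluates the result.
    Working with a nonnegative difference keeps Tonelli applicable. *)
Lemma stable_log (d e : R) : 0 <= d -> d <= e ->
  (\int[Q]_(z in DD) (ln (e * z.1 + z.2) - ln (d * z.1 + z.2))%:E =
   (al^-1 * (ln (1 + e `^ al) - ln (1 + d `^ al)))%:E)%E.
Proof.
move=> d0 de; have e0 := le_trans d0 de.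
transitivity (\int[Q]_(z in DD) \int[mu]_(t in `]0%R, +oo[)
   ((expR (- ((d * z.1 + z.2) * t)) - expR (- ((e * z.1 + z.2) * t))) / t)%:E)%E.
  apply: eq_integral => -[x y] /set_mem[]/=; rewrite !in_itv/= !andbT => x0 y0.
  have H := @frullani R (d * x + y) (e * x + y) 1.
  rewrite invr1 mul1r in H; rewrite -H; last 3 first.
  - by rewrite ltr_wpDl// mulr_ge0// ltW.
  - by rewrite lerD2r ler_wpM2r// ltW.
  - exact: ltr01.
  by apply: eq_integral => t /set_mem/=; rewrite in_itv/= andbT => t0; rewrite powRr1// ltW.
rewrite (@tonelli_on _ _ _ _ R Q mu DD D1 mDD mD1
  (fun z t => (expR (- ((d * z.1 + z.2) * t)) - expR (- ((e * z.1 + z.2) * t))) / t)); last 2 first.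
- by meas.
- move=> [x y] t []/=; rewrite !in_itv/= !andbT => x0 y0 t0.
  rewrite mulr_ge0 ?invr_ge0 ?(ltW t0)// subr_ge0 ler_expR lerN2.
  by rewrite ler_wpM2r ?(ltW t0)// lerD2r ler_wpM2r// ltW.
rewrite -(@frullani R (1 + d `^ al) (1 + e `^ al) al)//; last 2 first.
- by rewrite ltr_wpDr// powR_ge0.
- by rewrite lerD2l ge0_ler_powR ?nnegrE// ltW.
apply: eq_integral => t /set_mem/=; rewrite in_itv/= andbT => t0.
have t0' := ltW t0.
pose E (u : R) (z : R * R) := (expR (- ((u * z.1 + 1 * z.2) * t)))%:E.
have mE u : measurable_fun DD (E u) by apply: measurable_funTS; rewrite /E; meas.
have EE u : 0 <= u -> (\int[Q]_(z in DD) E u z = (expR (- ((1 + u `^ al) * t `^ al)))%:E)%E.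
  by move=> u0; rewrite /E (stable_laplace2 u0 ler01 t0') powR1 addrC.
under eq_integral do rewrite mulrC EFinM.
have dE z : DD z -> (0 <= (expR (- ((d * z.1 + z.2) * t)) - expR (- ((e * z.1 + z.2) * t)))%:E)%E.
  move=> []/=; rewrite !in_itv/= !andbT => x0 y0; rewrite lee_fin subr_ge0 ler_expR lerN2.
  by rewrite ler_wpM2r// lerD2r ler_wpM2r// ltW.
rewrite ge0_integralZl//; last 2 first.
- by apply: measurable_funTS; meas.
- by rewrite lee_fin invr_ge0.
rewrite [RHS]EFinM muleC; congr (_ * _)%E.
have mdiff : measurable_fun DD (fun z : R * R =>
    (expR (- ((d * z.1 + z.2) * t)) - expR (- ((e * z.1 + z.2) * t)))%:E).
  by apply: measurable_funTS; meas.
(* Additivity is applied to nonnegative functions, so the integral of the difference is read off a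
   sum. *)
have H : (\int[Q]_(z in DD) E d z =
    \int[Q]_(z in DD) (expR (- ((d * z.1 + z.2) * t)) - expR (- ((e * z.1 + z.2) * t)))%:E
    + \int[Q]_(z in DD) E e z)%E.
  rewrite -(ge0_integralD _ mDD dE mdiff)//; last by move=> x _; rewrite lee_fin expR_ge0.
  by apply: eq_integral => z _; rewrite /E -EFinD !mul1r subrK.
rewrite !EE// in H; rewrite EFinB H addeK//.
Qed.

(* Weighting [(S, S')] by [(d S + S')^-tau] turns [e S / (d S + S')] into
   [M_tau]: the powers of the weight and of [1 + lam m] combine. *)
Section dirichlet_mean.
Variables (theta : R) (G : probability R R).
Hypotheses (th0 : 0 < theta) (Gt : gamma_law (al * theta) G).
Let tau := al * theta.
Let tau0 : 0 < tau. Proof. exact: mulr_gt0. Qed.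

(** The constant is the reciprocal of the one in the gamma density, so [k] stands for the gamma
    function at [tau]. *)
Lemma gamma_inv_power : exists2 k : R, 0 < k & forall a : R, 0 < a ->
  ((k * a `^ (- tau))%:E =
   \int[mu]_(t in `]0%R, +oo[) (t `^ (tau - 1) * expR (- (a * t)))%:E)%E.
Proof.
have [k k0 GE] := gamma_law_integral Gt; exists k^-1; first by rewrite invr_gt0.
move=> a a0.
have G1 : (1 = k%:E * \int[mu]_(x in `]0%R, +oo[) (x `^ (tau - 1) * expR (- x))%:E)%E.
  transitivity (\int[G]_x (cst 1 x))%E.
    by rewrite integral_cst// mul1e; exact/esym/probability_setT.
  by rewrite GE//; under eq_integral do rewrite mul1e.
have E : (\int[mu]_(x in `]0%R, +oo[) (x `^ (tau - 1) * expR (- x))%:E = k^-1%:E)%E.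
  by rewrite -[RHS]mule1 G1 muleA -EFinM mulVf ?gt_eqF// mul1e.
have a0' : 0 < a^-1 by rewrite invr_gt0.
rewrite (@ge0_integral_scale _ _ a^-1)//; last 2 first.
- by meas.
- by move=> x _; rewrite lee_fin !mulr_ge0 ?powR_ge0 ?expR_ge0.
transitivity (a^-1%:E * \int[mu]_(x in `]0%R, +oo[) (((a^-1) `^ (tau - 1))%:E *
   (x `^ (tau - 1) * expR (- x))%:E))%E; last first.
  congr (_ * _)%E; apply: eq_integral => x /set_mem/=; rewrite in_itv/= andbT => x0.
  rewrite -EFinM; congr EFin; rewrite (powRM _ (ltW a0') (ltW x0)) mulrA.
  by rewrite !mulrA divff ?gt_eqF// mul1r.
rewrite ge0_integralZl//; last 3 first.
- by apply: measurable_funTS; meas.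
- by move=> x _; rewrite lee_fin !mulr_ge0 ?powR_ge0 ?expR_ge0.
- by rewrite lee_fin powR_ge0.
rewrite E -!EFinM; congr EFin; rewrite mulrA (mulrC k^-1); congr (_ * _).
by rewrite mulr_powRB1 ?ltW// -powR_inv1 ?ltW// -powRrM mulN1r.
Qed.

(** Scaling by [u^(-1/al)] leaves only the value at [u = 1]; the work is to show that this value is
    finite. *)
Lemma integral_powR_expR_powR : exists2 C : R, 0 < C & forall u : R, 0 < u ->
  (\int[mu]_(t in `]0%R, +oo[) (t `^ (tau - 1) * expR (- (u * t `^ al)))%:E =
   (C * u `^ (- theta))%:E)%E.
Proof.
pose I (u : R) : \bar R := (\int[mu]_(t in `]0%R, +oo[) (t `^ (tau - 1) * expR (- (u * t `^ al)))%:E)%E.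
have Ipos (u : R) : 0 < u -> (0 < I u)%E.
  move=> u0; apply: integral_gt0 => //.
  - by apply: measurable_funTS; meas.
  - by move=> x /=; rewrite in_itv/= andbT => x0; rewrite lte_fin mulr_gt0 ?powR_gt0 ?expR_gt0.
  - by rewrite [ltRHS]lebesgue_measure_itv/= ltry ltry.
have [k k0 GE] := gamma_inv_power.
have Ifin : (I 1%R < +oo)%E.
  (* For [t > 1] and [y = t^al], [t^(tau-1) = t^(al-1) y^(theta-1)] with [y^(theta-1) <= y^N]. The
     term of order [N] of the exponential series gives [y^N <= 2^N N! e^(y/2)], whence the constant
     [B]. For [t <= 1] the gamma integrand is a bound up to the factor [e]. *)
  pose N := (Num.truncn theta).+1.
  pose B : R := 2 ^+ N * N`!%:R.
  have B0 : 0 <= B by rewrite mulr_ge0// exprn_ge0.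
  have bnd (t : R) : 0 < t -> t `^ (tau - 1) * expR (- (1 * t `^ al)) <=
      expR 1 * (t `^ (tau - 1) * expR (- (1 * t))) +
      B * (t `^ (al - 1) * expR (- (2^-1 * t `^ al))).
    move=> t0; rewrite !mul1r; have [t1|t1] := leP t 1.
      apply: ler_wpDr; first by rewrite !mulr_ge0 ?powR_ge0 ?expR_ge0.
      rewrite mulrCA ler_wpM2l ?powR_ge0// -expRD.
      apply: (@le_trans _ _ 1).
        by rewrite expR_le1 oppr_le0 powR_ge0.
      by rewrite -[leLHS]expR0 ler_expR subr_ge0.
    apply: ler_wpDl; first by rewrite !mulr_ge0 ?powR_ge0 ?expR_ge0.
    set y := t `^ al.
    have y1 : 1 <= y by rewrite -(powRr0 t) ler_powR ?ltW.
    have y0 : 0 < y by exact: lt_le_trans y1.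
    have -> : t `^ (tau - 1) = t `^ (al - 1) * y `^ (theta - 1).
      rewrite -powRrM -powRD; last by rewrite (gt_eqF t0) implybT.
      by congr (_ `^ _); rewrite /tau; ring.
    rewrite -mulrA [leRHS]mulrCA ler_wpM2l ?powR_ge0//.
    have -> : expR (- y) = expR (- (2^-1 * y)) * expR (- (2^-1 * y)).
      by rewrite -expRD; congr expR; field.
    rewrite mulrA ler_wpM2r ?expR_ge0// expRN ler_pdivrMr ?expR_gt0//.
    apply: (@le_trans _ _ (y ^+ N)).
      rewrite -(powR_mulrn _ (ltW y0)); apply: ler_powR => //.
      rewrite lerBlDr (le_trans (ltW (Num.Theory.truncnS_gt _)))//.
      by rewrite lerDl.
    have y20 : 0 <= 2^-1 * y by apply: mulr_ge0; [rewrite invr_ge0|exact: ltW].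
    have := @expR_ge1Dxn _ (2^-1 * y) (Num.truncn theta) y20; rewrite -/N => h.
    rewrite /B; apply: (@le_trans _ _ (2 ^+ N * N`!%:R * ((2^-1 * y) ^+ N / N`!%:R))); last first.
      by rewrite ler_wpM2l// (le_trans _ h)// lerDr.
    rewrite exprMn exprVn -subr_ge0 le_eqVlt; apply/orP; left; apply/eqP.
    by field; rewrite expf_neq0//= pnatr_eq0 -lt0n fact_gt0.
  apply: (@le_lt_trans _ _ (\int[mu]_(t in `]0%R, +oo[)
     ((expR 1 * (t `^ (tau - 1) * expR (- (1 * t))))%:E +
      (B * (t `^ (al - 1) * expR (- (2^-1 * t `^ al))))%:E))%E).
    apply: ge0_le_integral => //.
    - by move=> t _; rewrite lee_fin mulr_ge0 ?powR_ge0 ?expR_ge0.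
    - by apply: measurable_funTS; meas.
    - by apply: measurable_funTS; apply: emeasurable_funD; meas.
    - by move=> t /=; rewrite in_itv/= andbT => t0; rewrite -EFinD lee_fin; exact: bnd.
  rewrite ge0_integralD//; last 4 first.
  - by move=> t _; rewrite lee_fin !mulr_ge0 ?powR_ge0 ?expR_ge0.
  - by apply: measurable_funTS; meas.
  - by move=> t _; rewrite lee_fin !mulr_ge0 ?powR_ge0 ?expR_ge0.
  - by apply: measurable_funTS; meas.
  under eq_integral do rewrite EFinM.
  under [X in (_ + X)%E]eq_integral do rewrite EFinM.
  rewrite ge0_integralZl//; last 2 first.
  - by apply: measurable_funTS; meas.
  - by move=> t _; rewrite lee_fin !mulr_ge0 ?powR_ge0 ?expR_ge0.
  rewrite ge0_integralZl//; last 2 first.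
  - by apply: measurable_funTS; meas.
  - by move=> t _; rewrite lee_fin !mulr_ge0 ?powR_ge0 ?expR_ge0.
  by rewrite -GE// integral_powR_expR ?invr_gt0// -!EFinM -EFinD ltry.
have Iscale (u : R) : 0 < u -> (I u = (u `^ (- theta))%:E * I 1%R)%E.
  move=> u0; pose a := u `^ (- al^-1).
  have a0 : 0 < a by rewrite powR_gt0.
  pose f (t : R) : \bar R := (t `^ (tau - 1) * expR (- (u * t `^ al)))%:E.
  have mf : measurable_fun [set: R] f by rewrite /f; meas.
  have f0 (x : R) : 0 < x -> (0 <= f x)%E.
    by move=> _; rewrite lee_fin mulr_ge0 ?powR_ge0 ?expR_ge0.
  transitivity (a%:E * \int[mu]_(t in `]0%R, +oo[) f (a * t)%R)%E.
    exact: ge0_integral_scale.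
  have mfa : measurable_fun [set: R] (fun t => f (a * t)%R) by rewrite /f; meas.
  rewrite /I -[LHS]ge0_integralZl; last 4 first.
  - exact: mD1.
  - exact: (measurable_funTS mfa).
  - by move=> x _; rewrite lee_fin !mulr_ge0 ?powR_ge0 ?expR_ge0.
  - by rewrite lee_fin ltW.
  rewrite -[RHS]ge0_integralZl; last 4 first.
  - exact: mD1.
  - by apply: measurable_funTS; meas.
  - by move=> x _; rewrite lee_fin !mulr_ge0 ?powR_ge0 ?expR_ge0.
  - by rewrite lee_fin powR_ge0.
  apply: eq_integral => x /set_mem/=; rewrite in_itv/= andbT => x0.
  rewrite /f !powRM ?(ltW a0) ?(ltW x0)// -!EFinM; congr EFin.
  have -> : a `^ al = u^-1.
    by rewrite /a -powRrM mulNr mulVf ?gt_eqF// powR_inv1 ?ltW.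
  rewrite !mulrA mulr_powRB1 ?(ltW a0)//.
  have -> : a `^ tau = u `^ (- theta).
    by rewrite /a -powRrM /tau mulNr mulrA mulVf ?gt_eqF// mul1r.
  by rewrite divff ?gt_eqF.
have I1 : (I 1%R = (fine (I 1%R))%:E) by rewrite fineK// ge0_fin_numE// ltW// Ipos.
exists (fine (I 1%R)); first by rewrite fine_gt0// Ipos.
by move=> u u0; rewrite -/(I u) Iscale// I1 -EFinM mulrC.
Qed.

(** A gamma integral exchanges the inverse power for the joint Laplace transform of the pair. The
    constant does not depend on [d], so it cancels in the ratios below. *)
Lemma stable_inv_power : exists2 c : R, 0 < c & forall d : R, 0 <= d ->
  (\int[Q]_(z in DD) ((d * z.1 + z.2) `^ (- tau))%:E =
   (c * (1 + d `^ al) `^ (- theta))%:E)%E.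
Proof.
have [k k0 GE] := gamma_inv_power; have [C C0 CE] := integral_powR_expR_powR.
exists (k^-1 * C); first by rewrite mulr_gt0// invr_gt0.
move=> d d0.
transitivity (k^-1%:E * \int[Q]_(z in DD)
    \int[mu]_(t in D1) (t `^ (tau - 1) * expR (- ((d * z.1 + z.2) * t)))%:E)%E.
  rewrite -ge0_integralZl//; last 3 first.
  - apply: (@measurable_integral_param _ _ _ _ R mu DD D1 mDD mD1
      (fun z t => t `^ (tau - 1) * expR (- ((d * z.1 + z.2) * t)))).
      by meas.
    by move=> z t _ _; rewrite mulr_ge0 ?powR_ge0 ?expR_ge0.
  - by move=> z _; apply: integral_ge0 => t _; rewrite lee_fin mulr_ge0 ?powR_ge0 ?expR_ge0.
  - by rewrite lee_fin invr_ge0 ltW.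
  apply: eq_integral => -[x y] /set_mem[]/=; rewrite !in_itv/= !andbT => x0 y0.
  rewrite -GE ?ltr_wpDl ?mulr_ge0 ?(ltW x0)// -EFinM mulrA mulVf ?mul1r//.
  by rewrite gt_eqF.
rewrite (@tonelli_on _ _ _ _ R Q mu DD D1 mDD mD1
  (fun z t => t `^ (tau - 1) * expR (- ((d * z.1 + z.2) * t)))); last 2 first.
- by meas.
- by move=> z t _ _; rewrite mulr_ge0 ?powR_ge0 ?expR_ge0.
rewrite -mulrA EFinM -CE; last by rewrite ltr_wpDr// powR_ge0.
congr (_ * _)%E; apply: eq_integral => t /set_mem/=; rewrite in_itv/= andbT => t0.
have E (z : R * R) : (t `^ (tau - 1) * expR (- ((d * z.1 + z.2) * t)))%:E =
   ((t `^ (tau - 1))%:E * (expR (- ((d * z.1 + 1 * z.2) * t)))%:E)%E.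
  by rewrite mul1r EFinM.
under eq_integral do rewrite E.
rewrite ge0_integralZl//; last 2 first.
- by apply: measurable_funTS; meas.
- by rewrite lee_fin powR_ge0.
by rewrite (stable_laplace2 d0 ler01 (ltW t0)) powR1 -EFinM [1 + _]addrC.
Qed.

(** [1 + lam m] with [m = e S / (d S + S')] is the ratio of [(d + lam e) S + S'] to [d S + S'], and
    the denominator cancels the weight. The case [d = e = c] gives the mean of [Lam], the case
    [d = 0], [e = 1] that of [rho]. *)
Lemma dirichlet_mean_ex (d e : R) : 0 <= d -> 0 < e ->
  exists2 M : probability R R, M D1 = 1%E & forall lam : R, 0 <= lam ->
  (\int[M]_(m in D) ((1 + lam * m) `^ (- tau))%:E =
   (((1 + (d + lam * e) `^ al) / (1 + d `^ al)) `^ (- theta))%:E)%E.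
Proof.
move=> d0 e0; have [c c0 cE] := stable_inv_power.
have d1 : 0 < 1 + d `^ al by rewrite ltr_wpDr ?powR_ge0.
pose K := c * (1 + d `^ al) `^ (- theta).
have K0 : 0 < K by rewrite mulr_gt0// powR_gt0.
pose W (z : R * R) := (d * z.1 + z.2) `^ (- tau).
pose F (z : R * R) : \bar R := (K^-1 * W z)%:E.
have mF : measurable_fun [set: R * R] F by rewrite /F /W; meas.
have F0 z : (0 <= F z)%E by rewrite lee_fin mulr_ge0 ?powR_ge0 ?invr_ge0 ?(ltW K0).
have [nu' nu'E] := density_measure_ex Q mF F0.
have nu'1 : nu' setT = 1%E.
  rewrite nu'E// -(integral_full mDD stable_pair_null mF).
  under eq_integral do rewrite /F EFinM.
  rewrite ge0_integralZl//; last 3 first.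
  - by apply: measurable_funTS; rewrite /W; meas.
  - by move=> z _; rewrite lee_fin powR_ge0.
  - by rewrite lee_fin invr_ge0 ltW.
  by rewrite cE// -EFinM mulVf// gt_eqF.
have [nu nuE'] := probability_ex nu'1.
have nuE A : measurable A -> nu A = (\int[Q]_(z in A) F z)%E.
  by move=> mA; rewrite nuE' nu'E.
have nuDD : nu DD = 1%E.
  apply: probability_null_full => //; exact: (density_null mDD stable_pair_null mF nuE).
pose phi (z : R * R) : R := e * z.1 / (d * z.1 + z.2).
have mphi : measurable_fun [set: R * R] phi by rewrite /phi; meas.
pose X : {mfun (R * R)%type >-> R} := HB.pack phi (isMeasurableFun.Build _ _ _ _ phi mphi).
have MD1 : distribution nu X D1 = 1%E.
  apply/eqP; rewrite eq_le; apply/andP; split; first exact: probability_le1.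
  rewrite -nuDD; apply: le_measure; rewrite ?inE//.
    by rewrite -[_ @^-1` _]setTI; exact: (mphi measurableT _ mD1).
  move=> [x y] []/=; rewrite !in_itv/= !andbT => x0 y0.
  rewrite /phi/=; apply: divr_gt0; first exact: mulr_gt0.
  by apply: ltr_wpDl => //; apply: mulr_ge0 => //; exact: ltW.
have MD := probability_gt0_ge0 MD1.
exists (distribution nu X) => // lam lam0.
have mf : measurable_fun [set: R] (fun m : R => ((1 + lam * m) `^ (- tau))%:E) by meas.
have mfX : measurable_fun [set: R * R] (fun z => ((1 + lam * phi z) `^ (- tau))%:E).
  by rewrite /phi; meas.
rewrite integral_fullP// ge0_integral_distribution//; last by move=> y; rewrite lee_fin powR_ge0.
rewrite (integral_density mF F0 nuE)//; last by move=> y; rewrite lee_fin powR_ge0.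
rewrite -(integral_full mDD stable_pair_null); last exact: emeasurable_funM.
transitivity (K^-1%:E * \int[Q]_(z in DD) (((d + lam * e) * z.1 + z.2) `^ (- tau))%:E)%E.
  rewrite -ge0_integralZl//; last 3 first.
  - by apply: measurable_funTS; meas.
  - by move=> z _; rewrite lee_fin powR_ge0.
  - by rewrite lee_fin invr_ge0 ltW.
  apply: eq_integral => -[x y] /set_mem[]/=; rewrite !in_itv/= !andbT => x0 y0.
  have xy0 : 0 < d * x + y by rewrite ltr_wpDl// mulr_ge0// ltW.
  rewrite /F /W /phi/= -!EFinM mulrCA -powRM ?(ltW xy0)//; last first.
    by rewrite addr_ge0// mulr_ge0// divr_ge0 ?(ltW xy0)// mulr_ge0 ?ltW.
  by congr (_ * _ `^ _)%:E; field; rewrite gt_eqF.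
have de0 : 0 <= d + lam * e by rewrite addr_ge0// mulr_ge0// ltW.
have d2 : 0 < 1 + (d + lam * e) `^ al by rewrite ltr_wpDr ?powR_ge0.
rewrite cE// -EFinM; congr EFin; rewrite /K invfM mulrACA mulVf ?gt_eqF// mul1r.
rewrite powRM ?invr_ge0 ?ltW// mulrC; congr (_ * _).
by rewrite -[in RHS]powR_inv1 ?ltW// -powRrM mulN1r opprK powRN invrK.
Qed.

End dirichlet_mean.

End stable.

(** * Integration against image measures *)

Section image_laws.
Context d (T : measurableType d) (R : realType).
Variables (P : probability T R) (H : probability R R) (phi : T -> R).
Hypothesis mphi : measurable_fun [set: T] phi.
Hypothesis HE : forall A : set R, measurable A -> H A = P (phi @^-1` A).
Variables (D : set T) (E : set R).
Hypotheses (mD : measurable D) (mE : measurable E) (PD : P D = 1%E).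
Hypothesis DE : forall x, D x -> E (phi x).

Lemma image_law_full : H E = 1%E.
Proof.
apply/eqP; rewrite eq_le probability_le1//= HE// -PD.
apply: le_measure; rewrite ?inE//.
by rewrite -[_ @^-1` _]setTI; exact: mphi.
Qed.

Lemma image_law_integral (g : R -> \bar R) :
  measurable_fun E g -> (forall x, E x -> (0 <= g x)%E) ->
  (\int[H]_(x in E) g x = \int[P]_(z in D) g (phi z))%E.
Proof.
move=> mg g0.
pose X : {mfun T >-> R} := HB.pack phi (isMeasurableFun.Build _ _ _ _ phi mphi).
have HX : same_law H (distribution P X) by move=> A mA; rewrite HE.
have mg' : measurable_fun [set: R] (g \_ E) by apply/(measurable_restrictT _ _).1.
rewrite (same_law_integral _ _ HX) integral_mkcond ge0_integral_distribution//; last first.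
  by move=> y; rewrite patchE; case: ifPn => // /set_mem/g0.
rewrite -(integral_full mD (probability_null mD PD)); last first.
  exact: (measurableT_comp mg' mphi).
by apply: eq_integral => z /set_mem/DE Ez; rewrite /= patchE mem_set.
Qed.

End image_laws.

(** * Lamperti variables and skew occupation laws *)

Section lamperti.
Variables (R : realType) (al : R).
Hypothesis al0 : 0 < al.
Local Notation mu := (@lebesgue_measure R).
Local Notation D := (`[0%R, +oo[%classic : set R).
Local Notation D1 := (`]0%R, +oo[%classic : set R).
Let mD1 : measurable D1. Proof. exact: measurable_itv. Qed.
Let mD : measurable D. Proof. exact: measurable_itv. Qed.

Lemma lamperti_full (rho : probability R R) : lamperti_law al rho -> rho D1 = 1%E.
Proof.
move=> [S [SD SE] rhoE].
apply: (@image_law_full _ _ R (S \x S)%E rho (fun z => z.1 / z.2) _ _ (D1 `*` D1)) => //.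
- by meas.
- exact: measurableX.
- transitivity (S D1 * S D1)%E; first exact: product_measure1E.
  by rewrite SD mule1.
- move=> [x y] []/=; rewrite !in_itv/= !andbT; exact: divr_gt0.
Qed.

(** At [x = S / S'], [1 + lam b x / (1 + c x)] is the quotient of the linear forms
    [(c + lam b) S + S'] and [c S + S'], so [stable_log] applies. *)
Lemma lamperti_log (rho : probability R R) (b c lam : R) : lamperti_law al rho ->
  0 <= b -> 0 <= c -> 0 <= lam ->
  (\int[rho]_(x in D1) (ln (1 + lam * (b * x / (1 + c * x))))%:E =
   (al^-1 * (ln (1 + (c + lam * b) `^ al) - ln (1 + c `^ al)))%:E)%E.
Proof.
move=> [S Sst rhoE] b0 c0 lam0; have SD := Sst.1.
have H0 (x : R) : 0 < x -> 0 <= lam * (b * x / (1 + c * x)).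
  move=> x0; rewrite mulr_ge0// divr_ge0 ?mulr_ge0 ?(ltW x0)//.
  by rewrite addr_ge0// mulr_ge0// ltW.
rewrite (@image_law_integral _ _ R (S \x S)%E rho (fun z => z.1 / z.2) _ _ (D1 `*` D1))//.
- rewrite -(stable_log al0 Sst) ?lerDl ?mulr_ge0//.
  apply: eq_integral => -[x y] /set_mem[]/=; rewrite !in_itv/= !andbT => x0 y0.
  have cx : 0 < c * x + y by rewrite ltr_wpDl// mulr_ge0// ltW.
  rewrite -ln_div ?posrE//; last by rewrite ltr_wpDl// mulr_ge0 ?(ltW x0)// addr_ge0// mulr_ge0.
  by congr (ln _)%:E; field; rewrite !gt_eqF// addrC.
- by meas.
- exact: measurableX.
- transitivity (S D1 * S D1)%E; first exact: product_measure1E.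
  by rewrite SD mule1.
- move=> [x y] []/=; rewrite !in_itv/= !andbT; exact: divr_gt0.
- by apply: measurable_funTS; meas.
- move=> x /=; rewrite in_itv/= andbT => x0; rewrite lee_fin ln_ge0// lerDl; exact: H0.
Qed.

Lemma expR_log_ratio (theta x y : R) : 0 < x -> 0 < y ->
  expR (- (al * theta * (al^-1 * (ln x - ln y)))) = (x / y) `^ (- theta).
Proof.
move=> x0 y0; rewrite /powR gt_eqF ?divr_gt0// ln_div ?posrE//.
by congr expR; field; rewrite gt_eqF.
Qed.

Lemma full_log_integral (H : probability R R) (lam : R) : H D1 = 1%E -> 0 <= lam ->
  (\int[H]_(x in D) ln (1 + lam * x))%R =
  fine (\int[H]_(x in D1) (ln (1 + lam * x))%:E)%E.
Proof.
move=> HD lam0; have HD' := probability_gt0_ge0 HD.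
rewrite /Rintegral; congr fine.
by rewrite (integral_fullP mD HD') ?(integral_fullP mD1 HD)//; meas.
Qed.

Lemma lamperti_GGC_laplace (theta : R) (rho L : probability R R) :
  lamperti_law al rho -> GGC_law (al * theta) rho L ->
  L D = 1%E /\ forall lam : R, 0 <= lam ->
   (\int[L]_(x in D) (expR (- (lam * x)))%:E = ((1 + lam `^ al) `^ (- theta))%:E)%E.
Proof.
move=> rhoE LE; have [LD h] := GGC_laplace LE; split => // lam lam0; rewrite h//.
rewrite full_log_integral//; last exact: lamperti_full.
have := lamperti_log rhoE ler01 (lexx 0) lam0.
under eq_integral do rewrite mul1r mul0r addr0 divr1.
move=> ->/=; rewrite add0r mulr1 powR0 ?gt_eqF// addr0.
by rewrite expR_log_ratio ?divr1// ltr_wpDr ?powR_ge0.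
Qed.

(* The law of [b X / (1 + c X)], [X] of law [rho], has the logarithmic
   transform of the exponentially tilted GGC law. *)
Lemma lamperti_image_ex (rho : probability R R) (b c : R) : lamperti_law al rho ->
  0 < b -> 0 <= c ->
  exists2 H : probability R R, H D1 = 1%E &
   forall g : R -> \bar R, measurable_fun [set: R] g -> (forall x, (0 <= g x)%E) ->
   (\int[H]_(x in D1) g x = \int[rho]_(x in D1) g (b * x / (1 + c * x))%R)%E.
Proof.
move=> rhoE b0 c0.
pose phi (x : R) : R := b * x / (1 + c * x).
have mphi : measurable_fun [set: R] phi by rewrite /phi; meas.
pose X : {mfun R >-> R} := HB.pack phi (isMeasurableFun.Build _ _ _ _ phi mphi).
have phi0 x : D1 x -> D1 (phi x).
  rewrite /= !in_itv/= !andbT => x0.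
  by rewrite divr_gt0 ?mulr_gt0// ltr_wpDr// mulr_ge0// ltW.
have rhoD := lamperti_full rhoE.
exists (distribution rho X).
  by apply: (@image_law_full _ _ R rho _ phi _ _ D1).
move=> g mg g0; apply: (@image_law_integral _ _ R rho _ phi) => //.
exact: measurable_funTS.
Qed.

(** [p / (1 - p) = c^al], so the scale factor in the definition of [Lam] is the given [c]. *)
Lemma skew_occupation_image (p c : R) (Lam : probability R R) : 0 < c ->
  p = c `^ al / (1 + c `^ al) -> skew_occupation_law al p Lam ->
  exists2 rho : probability R R, lamperti_law al rho &
    forall A, measurable A -> Lam A = rho ((fun x => c * x / (1 + c * x)) @^-1` A).
Proof.
move=> c0 pE [rho rhoE LamE]; exists rho => // A mA; rewrite LamE//.
have ca : 0 < c `^ al by rewrite powR_gt0.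
suff -> : (p / (1 - p)) `^ al^-1 = c by [].
have -> : p / (1 - p) = c `^ al.
  rewrite pE; field.
  have e : 1 + c `^ al - c `^ al != 0 by rewrite addrK oner_neq0.
  by apply/andP; split; rewrite ?e// gt_eqF// ltr_wpDr// ltW.
by rewrite -powRrM mulfV ?gt_eqF// powRr1// ltW.
Qed.

Section skew.
Variables (p c : R) (Lam : probability R R).
Hypotheses (c0 : 0 < c) (pE : p = c `^ al / (1 + c `^ al)).
Hypothesis LamE : skew_occupation_law al p Lam.

Let phi (x : R) : R := c * x / (1 + c * x).
Let mphi : measurable_fun [set: R] phi. Proof. by rewrite /phi; meas. Qed.

Lemma skew_occupation_full : Lam `]0, 1[%classic = 1%E.
Proof.
have [rho rhoE LamH] := skew_occupation_image c0 pE LamE.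
apply: (@image_law_full _ _ R rho _ phi mphi _ D1) => //; first exact: lamperti_full.
move=> x /=; rewrite !in_itv/= andbT => x0; rewrite /phi.
have cx : 0 < c * x by rewrite mulr_gt0.
have h : 0 < 1 + c * x by rewrite addr_gt0.
by rewrite divr_gt0//= ltr_pdivrMr// mul1r ltrDr.
Qed.

Lemma skew_occupation_gt0 : Lam D1 = 1%E.
Proof.
apply/eqP; rewrite eq_le probability_le1//= -skew_occupation_full.
by apply: le_measure; rewrite ?inE// => x /=; rewrite !in_itv/= andbT => /andP[].
Qed.

Lemma skew_occupation_integral : exists2 rho : probability R R, lamperti_law al rho &
   forall g : R -> \bar R, measurable_fun D1 g -> (forall x : R, 0 < x -> (0 <= g x)%E) ->
   (\int[Lam]_(x in D1) g x = \int[rho]_(x in D1) g (phi x))%E.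
Proof.
have [rho rhoE LamH] := skew_occupation_image c0 pE LamE; exists rho => // g mg g0.
apply: (@image_law_integral _ _ R rho _ phi) => //; first exact: lamperti_full.
  move=> x /=; rewrite !in_itv/= !andbT => x0.
  by rewrite divr_gt0 ?mulr_gt0// ltr_wpDr// mulr_ge0// ltW.
by move=> x /=; rewrite in_itv/= andbT; exact: g0.
Qed.

Lemma skew_occupation_log (lam : R) : 0 <= lam ->
  (\int[Lam]_(x in D1) (ln (1 + lam * x))%:E =
   (al^-1 * (ln (1 + (c + lam * c) `^ al) - ln (1 + c `^ al)))%:E)%E.
Proof.
move=> lam0; have [rho rhoE ->] := skew_occupation_integral.
- by rewrite lamperti_log// ltW.
- by apply: measurable_funTS; meas.
- by move=> x x0; rewrite lee_fin ln_ge0// lerDl mulr_ge0// ltW.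
Qed.

Lemma skew_occupation_ln_integrable :
  Lam.-integrable D (fun x : R => (ln (1 + x))%:E).
Proof.
apply/integrableP; split; first by apply: measurable_funTS; meas.
rewrite (_ : (\int[Lam]_(x in D) _)%E = (\int[Lam]_(x in D1) (ln (1 + 1 * x))%:E)%E).
  by rewrite skew_occupation_log// ltry.
rewrite integral_fullP//; last 2 first.
- by apply: probability_gt0_ge0; exact: skew_occupation_gt0.
- by apply: measurableT_comp => //; meas.
rewrite -(integral_fullP mD1 skew_occupation_gt0); last first.
  by apply: measurableT_comp => //; meas.
apply: eq_integral => x /set_mem/=; rewrite in_itv/= andbT => x0.
by rewrite mul1r ger0_norm// ln_ge0// lerDl ltW.
Qed.

Let q1 (lam : R) : 0 <= lam -> 0 < 1 + (c + lam * c) `^ al.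
Proof. by move=> _; rewrite ltr_wpDr ?powR_ge0. Qed.

Lemma skew_occupation_expR_log (theta lam : R) : 0 <= lam ->
  expR (- (al * theta * \int[Lam]_(x in D) ln (1 + lam * x))) =
  ((1 + (c + lam * c) `^ al) / (1 + c `^ al)) `^ (- theta).
Proof.
move=> lam0; rewrite full_log_integral//; last exact: skew_occupation_gt0.
rewrite skew_occupation_log//= expR_log_ratio//; first exact: q1.
by rewrite ltr_wpDr ?powR_ge0.
Qed.

(** Translates the ratio produced by the stable pair into the expression in [p] that the marked
    jumps produce. *)
Lemma skew_ratio (lam : R) : 0 <= lam ->
  (1 + (c + lam * c) `^ al) / (1 + c `^ al) = (1 - p) + p * (1 + lam) `^ al.
Proof.
move=> lam0; rewrite pE.
have -> : c + lam * c = (1 + lam) * c by ring.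
rewrite powRM ?(ltW c0)//; last by rewrite addr_ge0.
by field; rewrite gt_eqF// ltr_wpDr// powR_ge0.
Qed.

Lemma skew_GGC_laplace (theta : R) (L : probability R R) :
  GGC_law (al * theta) Lam L ->
  L D = 1%E /\ forall lam : R, 0 <= lam ->
   (\int[L]_(x in D) (expR (- (lam * x)))%:E =
   (((1 + (c + lam * c) `^ al) / (1 + c `^ al)) `^ (- theta))%:E)%E.
Proof.
move=> LE; have [LD h] := GGC_laplace LE; split => // lam lam0; rewrite h//.
by rewrite skew_occupation_expR_log.
Qed.

End skew.

End lamperti.

(** * Levy densities and exponential tilting *)

Section levy.
Variables (R : realType) (tau : R).
Hypothesis tau0 : 0 < tau.
Local Notation mu := (@lebesgue_measure R).
Local Notation D := (`[0%R, +oo[%classic : set R).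
Local Notation D1 := (`]0%R, +oo[%classic : set R).
Let mD1 : measurable D1. Proof. exact: measurable_itv. Qed.
Let mD : measurable D. Proof. exact: measurable_itv. Qed.
Variables (H nu : probability R R) (g : R -> R).
Hypotheses (HD : H D1 = 1%E) (nuD : nu D = 1%E).
Hypothesis Hg : forall lam : R, 0 <= lam ->
  (\int[H]_(x in D1) (ln (1 + lam * x))%:E = (g lam)%:E)%E.
Hypothesis nug : forall lam : R, 0 <= lam ->
  (\int[nu]_(x in D) (expR (- (lam * x)))%:E = (expR (- (tau * g lam)))%:E)%E.

Let h (s : R) : \bar R := (\int[H]_(x in D1) (expR (- (s / x)))%:E)%E.

Let h0 s : (0 <= h s)%E.
Proof. by apply: integral_ge0 => x _; rewrite lee_fin expR_ge0. Qed.

Let h1 (s : R) : 0 < s -> (h s <= 1)%E.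
Proof.
move=> s0; rewrite -HD -[leRHS]mul1e -integral_cst//.
apply: ge0_le_integral => //.
- by apply: measurable_funTS; meas.
- move=> x /=; rewrite in_itv/= andbT => x0.
  by rewrite lee_fin expR_le1 oppr_le0 divr_ge0 ?ltW.
Qed.

Let hE (s : R) : 0 < s -> h s = (fine (h s))%:E.
Proof.
by move=> s0; rewrite fineK// ge0_fin_numE// (le_lt_trans (h1 s0))// ltry.
Qed.

Let l (s : R) : R := tau * s^-1 * \int[H]_(x in D1) expR (- (s / x)).

Let ml : measurable_fun D1 l.
Proof.
apply: measurable_funM; first by apply: measurable_funTS; meas.
apply: measurableT_comp => //.
by apply: (@measurable_integral_param _ _ _ _ R H D1 D1 mD1 mD1 (fun s x => expR (- (s / x)))) => //; meas.
Qed.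

Let l0 (s : R) : 0 < s -> 0 <= l s.
Proof.
move=> s0; rewrite /l mulr_ge0//; first by rewrite mulr_ge0 ?invr_ge0 ?ltW.
by apply: fine_ge0; exact: h0.
Qed.

(** For fixed [x], Frullani between [1/x] and [lam + 1/x] gives [ln (1 + lam x)]; averaging over [H]
    gives [g]. *)
Let lint (lam : R) : 0 <= lam ->
  (\int[mu]_(s in D1) ((1 - expR (- (lam * s))) * l s)%:E = (tau * g lam)%:E)%E.
Proof.
move=> lam0; pose f (x s : R) : R := (expR (- (x^-1 * s)) - expR (- ((lam + x^-1) * s))) / s.
have f0 x s : D1 x -> D1 s -> 0 <= f x s.
  rewrite /= !in_itv/= !andbT => x0 s0.
  rewrite /f mulr_ge0 ?invr_ge0 ?(ltW s0)// subr_ge0 ler_expR.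
  by rewrite lerN2 mulrDl lerDr mulr_ge0// ltW.
transitivity (\int[mu]_(s in D1) (tau%:E * \int[H]_(x in D1) (f x s)%:E))%E.
  apply: eq_integral => s /set_mem/=; rewrite in_itv/= andbT => s0.
  rewrite /l -/(h s) mulrA EFinM -(hE s0) mulrCA EFinM -muleA; congr (_ * _)%E.
  rewrite -ge0_integralZl//; last 2 first.
  - by apply: measurable_funTS; meas.
  - by rewrite lee_fin mulr_ge0 ?invr_ge0 ?(ltW s0)// subr_ge0 expR_le1 oppr_le0 mulr_ge0// ltW.
  apply: eq_integral => x _; rewrite -EFinM /f; congr EFin.
  by rewrite (mulrDl lam) opprD expRD (mulrC s x^-1); ring.
rewrite ge0_integralZl//; last 3 first.
- by apply: (@measurable_integral_param _ _ _ _ R H D1 D1 mD1 mD1 (fun s x => f x s)) => //; rewrite ?/f; [meas|move=> s x ? ?; exact: f0].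
- by move=> s ?; apply: integral_ge0 => x ?; rewrite lee_fin f0.
- by rewrite lee_fin ltW.
rewrite EFinM -Hg//; congr (_ * _)%E.
rewrite -(@tonelli_on _ _ _ _ R H mu D1 D1 mD1 mD1 f)//; last by rewrite /f; meas.
apply: eq_integral => x /set_mem/=; rewrite in_itv/= andbT => x0.
have x0' : 0 < x^-1 by rewrite invr_gt0.
have xl : x^-1 <= lam + x^-1 by rewrite lerDr.
have F := frullani x0' xl ltr01; rewrite invr1 mul1r in F.
rewrite -ln_div ?posrE ?ltr_wpDl// in F.
have -> : 1 + lam * x = (lam + x^-1) / x^-1 by field; rewrite gt_eqF.
apply: (etrans _ F); by apply: eq_integral => s /set_mem/=; rewrite in_itv/= andbT => s0; rewrite powRr1 ?ltW.
Qed.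

Lemma has_levy_density_of_log : has_levy_density nu l.
Proof.
split => //; last first.
  by move=> lam lam0; rewrite lint// nug.
(* [min (1, s) <= 2 s / (1 + s) <= 2 (1 - e^(-s))], so the integrability condition follows from the
   finite exponent at [lam = 1]. *)
apply: (@le_lt_trans _ _ (\int[mu]_(s in D1) (2%:E * ((1 - expR (- (1 * s))) * l s)%:E))%E).
  apply: ge0_le_integral => //.
  - move=> s /=; rewrite in_itv/= andbT => s0; rewrite lee_fin mulr_ge0 ?l0//.
    by rewrite le_min ler01 ltW.
  - apply/measurable_EFinP; apply: measurable_funM => //.
    by apply: measurable_minr => //; exact: measurable_id.
  - apply: emeasurable_funM => //; apply/measurable_EFinP; apply: measurable_funM => //.
    by apply: measurable_funTS; meas.
  - move=> s /=; rewrite in_itv/= andbT => s0; rewrite -EFinM lee_fin [leRHS]mulrA ler_wpM2r ?l0//.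
    have e : expR (- (1 * s)) <= (1 + s)^-1.
      by rewrite mul1r expRN lef_pV2 ?posrE ?expR_gt0 ?addr_gt0// expR_ge1Dx.
    apply: (@le_trans _ _ (2 * (1 - (1 + s)^-1))); last by rewrite ler_pM2l// lerB.
    have -> : 2 * (1 - (1 + s)^-1) = 2 * s / (1 + s) by field; rewrite gt_eqF// addr_gt0.
    rewrite ge_min !ler_pdivlMr ?addr_gt0//; apply/orP.
    by have [s1|s1] := leP s 1; [right|left]; nra.
rewrite ge0_integralZl//.
- by rewrite lint// -EFinM ltry.
- apply/measurable_EFinP; apply: measurable_funM => //.
  by apply: measurable_funTS; meas.
- move=> s /=; rewrite in_itv/= andbT => s0; rewrite lee_fin mulr_ge0 ?l0//.
  by rewrite subr_ge0 expR_le1 mul1r oppr_le0 ltW.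
Qed.

End levy.

(** * Laplace transforms of exponentially tilted laws *)

Section tilting.
Variables (R : realType) (al theta : R).
Hypotheses (al0 : 0 < al) (th0 : 0 < theta).
Local Notation mu := (@lebesgue_measure R).
Local Notation D := (`[0%R, +oo[%classic : set R).
Local Notation D1 := (`]0%R, +oo[%classic : set R).
Let mD1 : measurable D1. Proof. exact: measurable_itv. Qed.
Let mD : measurable D. Proof. exact: measurable_itv. Qed.

(** After [w = b v] the tilt is [e^(-c v)], so the transform at [lam] is that of [L] at [c + lam b],
    divided by its value at [c]. *)
Lemma tilted_laplace (b c : R) (rho nu : probability R R) :
  0 < b -> 0 < c -> lamperti_law al rho -> GGC_tilted_law b c (al * theta) rho nu ->
  nu D = 1%E /\ forall lam : R, 0 <= lam ->
   (\int[nu]_(x in D) (expR (- (lam * x)))%:E =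
    (((1 + (c + lam * b) `^ al) / (1 + c `^ al)) `^ (- theta))%:E)%E.
Proof.
move=> b0 c0 rhoE [L [fL [LE fLE [k k0 nuE]]]].
have [LD LL] := lamperti_GGC_laplace al0 rhoE LE.
have nuD1 : nu D1 = 1%E.
  have [_ _ nuE'] := nuE; apply: probability_null_full => //.
  by rewrite nuE'; [rewrite setICl integral_set0|exact: measurableC].
have nuD := probability_gt0_ge0 nuD1.
have [mfL fL0 _] := fLE.
have mfL' : measurable_fun [set: R] ((fun v => (fL v)%:E) \_ D1).
  by apply/(measurable_restrictT _ _).1 => //; apply/measurable_EFinP.
have E (lam : R) : 0 <= lam ->
   (\int[nu]_(x in D) (expR (- (lam * x)))%:E = (k * (1 + (c + lam * b) `^ al) `^ (- theta))%:E)%E.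
  move=> lam0.
  have lb : 0 <= c + lam * b by rewrite addr_ge0 ?(ltW c0)// mulr_ge0// ltW.
  rewrite EFinM -(LL _ lb).
  have mexp (u : R) : measurable_fun [set: R] (fun x : R => (expR (- (u * x)))%:E) by meas.
  rewrite (integral_fullP mD nuD (mexp _)) (integral_fullP mD LD (mexp _)).
  rewrite (lebesgue_density_integral mD1 nuE (mexp _))//.
  rewrite (lebesgue_density_integral mD1 fLE (mexp _))//.
  rewrite -ge0_integralZl//; last 3 first.
  - apply: emeasurable_funM; first by apply: measurable_funTS; meas.
    exact/measurable_EFinP.
  - by move=> x Dx; rewrite -EFinM lee_fin mulr_ge0 ?expR_ge0 ?fL0.
  - by rewrite lee_fin ltW.
  (* [fL] is controlled only on the positive half line; its extension by 0 is measurable everywhere,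
     as the scaling step requires. *)
  pose F (w : R) : \bar R := ((k * b^-1 * expR (- ((lam + c / b) * w)))%:E *
     ((fun v : R => (fL v)%:E) \_ D1) (w / b)%R)%E.
  transitivity (\int[mu]_(w in D1) F w)%E.
    apply: eq_integral => w /set_mem/=; rewrite in_itv/= andbT => w0.
    have wb : D1 (w / b) by rewrite /= in_itv/= andbT divr_gt0.
    rewrite /F patchE mem_set// -!EFinM; congr EFin.
    by rewrite mulrDl opprD expRD; ring.
  rewrite (@ge0_integral_scale _ F b)//; last 2 first.
  - rewrite /F; apply: emeasurable_funM; first by meas.
    apply: (measurableT_comp mfL'); meas.
  - move=> w w0; rewrite /F mule_ge0//.
      by rewrite lee_fin !mulr_ge0 ?invr_ge0 ?expR_ge0// ltW.
    by rewrite patchE; case: ifPn => // /set_mem Dw; rewrite lee_fin fL0.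
  rewrite -ge0_integralZl//; last 3 first.
  - apply: measurable_funTS; rewrite /F; apply: emeasurable_funM; first by meas.
    apply: (measurableT_comp mfL'); meas.
  - move=> w w0; rewrite /F mule_ge0//.
      by rewrite lee_fin !mulr_ge0 ?invr_ge0 ?expR_ge0// ltW.
    by rewrite patchE; case: ifPn => // /set_mem Dw; rewrite lee_fin fL0.
  - by rewrite lee_fin ltW.
  apply: eq_integral => w Dw; rewrite /F.
  have -> : b * w / b = w by field; rewrite gt_eqF.
  rewrite patchE Dw -!EFinM; congr EFin.
  have -> : (lam + c / b) * (b * w) = (c + lam * b) * w by field; rewrite gt_eqF.
  by field; rewrite gt_eqF.
split => // lam lam0; rewrite E//.
have kE : 1 = k * (1 + c `^ al) `^ (- theta).
  have := E 0 (lexx 0); rewrite mul0r addr0.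
  under eq_integral do rewrite mul0r oppr0 expR0.
  by rewrite integral_cst// mul1e [X in X = _]nuD => -[].
have c1 : 0 < 1 + c `^ al by rewrite ltr_wpDr ?powR_ge0.
have c2 : 0 < 1 + (c + lam * b) `^ al by rewrite ltr_wpDr ?powR_ge0.
rewrite powRM ?invr_ge0 ?ltW//; congr EFin.
have -> : ((1 + c `^ al)^-1) `^ (- theta) = k.
  rewrite -powR_inv1 ?ltW// -powRrM mulN1r opprK.
  by move: kE; rewrite powRN => /(congr1 ( *%R^~ ((1 + c `^ al) `^ theta))); rewrite mul1r mulfVK// gt_eqF// powR_gt0.
by rewrite mulrC.
Qed.

End tilting.

(** [x <= e^x] at [x = t / tau], raised to the power [tau]. *)
Lemma powR_expR_le (R : realType) (tau t : R) : 0 < tau -> 0 < t ->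
  t `^ tau * expR (- t) <= tau `^ tau.
Proof.
move=> tau0 t0; rewrite expRN ler_pdivrMr ?expR_gt0//.
have -> : expR t = expR (t / tau) `^ tau.
  by rewrite /powR gt_eqF ?expR_gt0// expRK mulrC divfK ?gt_eqF.
have -> : t `^ tau = (tau * (t / tau)) `^ tau by congr (_ `^ _); field; rewrite gt_eqF.
rewrite powRM ?divr_ge0 ?(ltW tau0) ?(ltW t0)// ler_wpM2l ?powR_ge0//.
apply: ge0_ler_powR; rewrite ?nnegrE ?expR_ge0 ?divr_ge0 ?(ltW tau0) ?(ltW t0)//.
by apply: le_trans (expR_ge1Dx _); rewrite lerDr.
Qed.

Section prod_density.
Variables (R : realType) (tau : R) (G M : probability R R).
Local Notation mu := (@lebesgue_measure R).
Local Notation D1 := (`]0%R, +oo[%classic : set R).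
Let mD1 : measurable D1. Proof. exact: measurable_itv. Qed.
Hypotheses (tau0 : 0 < tau) (Gt : gamma_law tau G) (MD : M D1 = 1%E).

(** [g w y] is the density at [w] of [y] times a gamma variable. With [t = w / y] it equals
    [k w^-1 t^tau e^(-t)], which is bounded in [y]; hence the mixed density is finite and can be
    taken real-valued. *)
Lemma gamma_mix_density : exists fL : R -> R,
  has_density lebesgue_measure `]0, +oo[ fL (prod_law G M).
Proof.
have [k k0 GE] := gamma_law_integral Gt.
pose g (w y : R) : R := k * (y^-1 * ((w / y) `^ (tau - 1) * expR (- (w / y)))).
have g0 w y : D1 y -> 0 <= g w y.
  rewrite /= in_itv/= andbT => y0.
  by rewrite /g mulr_ge0 ?(ltW k0)// mulr_ge0 ?invr_ge0 ?(ltW y0)// mulr_ge0 ?powR_ge0 ?expR_ge0.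
pose F (w : R) : \bar R := (\int[M]_(y in D1) (g w y)%:E)%E.
have F0 w : (0 <= F w)%E by apply: integral_ge0 => y Dy; rewrite lee_fin g0.
have FE (w : R) : 0 < w -> F w = (fine (F w))%:E.
  move=> w0; rewrite fineK// ge0_fin_numE//.
  apply: (@le_lt_trans _ _ (\int[M]_(y in D1) (cst (k * (w^-1 * tau `^ tau))%:E) y)%E).
    apply: ge0_le_integral => //.
    - by move=> y Dy; rewrite lee_fin g0.
    - by apply: measurable_funTS; rewrite /g; meas.
    - move=> y /=; rewrite in_itv/= andbT => y0; rewrite lee_fin ler_wpM2l ?(ltW k0)//.
      have wy : 0 < w / y by rewrite divr_gt0.
      set t := w / y in wy *.
      have -> : y^-1 = w^-1 * t by rewrite /t mulrA mulVf ?mul1r ?gt_eqF.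
      rewrite -mulrA ler_wpM2l ?invr_ge0 ?(ltW w0)// mulrA mulr_powRB1 ?(ltW wy)//.
      exact: powR_expR_le.
  by rewrite integral_cst// [X in (_ * X)%E]MD mule1 ltry.
have mg : measurable_fun setT (fun wy : R * R => g wy.1 wy.2) by rewrite /g; meas.
have mF : measurable_fun D1 F.
  by apply: (@measurable_integral_param _ _ _ _ R M D1 D1 mD1 mD1 g) => // w y _; exact: g0.
exists (fun w => fine (F w)); split.
- exact: (measurableT_comp _ mF).
- by move=> w _; rewrite fine_ge0.
move=> A mA.
have mI : measurable_fun [set: R] (fun x : R => \1_A x : R) by exact: measurable_indic.
have mI' (y : R) : measurable_fun [set: R] (fun x : R => \1_A (x * y) : R).
  by apply: (measurableT_comp mI); meas.
transitivity (\int[prod_law G M]_x (\1_A x : R)%:E)%E.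
  by rewrite integral_indic// setIT.
rewrite integral_prod_law//.
rewrite -(integral_fullP mD1 MD); last first.
  apply: (@measurable_integral_param _ _ _ _ R G setT setT _ _ (fun y x => \1_A (x * y))) => //.
  by apply: (measurableT_comp mI); meas.
transitivity (\int[M]_(y in D1) \int[mu]_(w in D1) ((\1_A w : R) * g w y)%:E)%E.
  apply: eq_integral => y /set_mem/=; rewrite in_itv/= andbT => y0.
  have mIy : measurable_fun [set: R] (fun x : R => (\1_A (x * y) : R)%:E).
    by apply/measurable_EFinP; exact: mI'.
  rewrite (GE _ mIy)// [RHS](@ge0_integral_scale _ _ y)//; last 2 first.
  - by apply/measurable_EFinP; apply: measurable_funM => //; rewrite /g; meas.
  - by move=> w w0; rewrite lee_fin mulr_ge0// g0//= in_itv/= andbT.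
  rewrite -!ge0_integralZl; last 8 first.
  - exact: mD1.
  - apply/measurable_EFinP; apply: measurable_funTS; apply: measurable_funM.
      by apply: (measurableT_comp mI); meas.
    by rewrite /g; meas.
  - by move=> w _; rewrite lee_fin mulr_ge0// g0//= in_itv/= andbT.
  - by rewrite lee_fin ltW.
  - exact: mD1.
  - by apply: emeasurable_funM; apply: measurable_funTS => //; meas.
  - by move=> w _; rewrite -EFinM lee_fin !mulr_ge0 ?powR_ge0 ?expR_ge0.
  - by rewrite lee_fin ltW.
  apply: eq_integral => w _; rewrite -!EFinM; congr EFin.
  have -> : g (y * w) y = k * y^-1 * (w `^ (tau - 1) * expR (- w)).
    by rewrite /g (_ : y * w / y = w) ?mulrA//; field; rewrite gt_eqF.
  by rewrite (mulrC w y); field; rewrite gt_eqF.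
rewrite (@tonelli_on _ _ _ _ R M mu D1 D1 mD1 mD1 (fun y w => \1_A w * g w y)); last 2 first.
- apply: measurable_funM; first by apply: (measurableT_comp mI); meas.
  by rewrite /g; meas.
- by move=> y w Dy _; rewrite mulr_ge0// g0.
rewrite [RHS]integral_mkcondl.
apply: eq_integral => w /set_mem/=; rewrite in_itv/= andbT => w0.
under eq_integral do rewrite EFinM.
rewrite ge0_integralZl//; last 2 first.
- by apply: measurable_funTS; rewrite /g; meas.
- by move=> y Dy; rewrite lee_fin g0.
by rewrite -/(F w) FE//= patchE indicE; case: ifPn => _; rewrite ?mul1e ?mul0e.
Qed.

End prod_density.

Lemma fineZl (R : realType) (e : R) (x : \bar R) : 0 < e ->
  fine (e%:E * x)%E = e * fine x.
Proof.
by move=> e0; case: x => [x| |]; rewrite ?gt0_muley ?gt0_muleNy ?lte_fin//= mulr0.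
Qed.

(** * Levy densities, and the equivalence of the two descriptions of the GGC law *)

Section levy_densities.
Variables (R : realType) (al theta : R).
Hypotheses (al0 : 0 < al) (th0 : 0 < theta).
Local Notation mu := (@lebesgue_measure R).
Local Notation D := (`[0%R, +oo[%classic : set R).
Local Notation D1 := (`]0%R, +oo[%classic : set R).
Let mD1 : measurable D1. Proof. exact: measurable_itv. Qed.
Let mD : measurable D. Proof. exact: measurable_itv. Qed.
Let tau0 : 0 < al * theta. Proof. exact: mulr_gt0. Qed.

(** The general formula is applied to the image [H] of [rho] under [x |-> b x / (1 + c x)]. The
    inverse of that image is [1/(b x) + c/b], and the second term yields the factor
    [e^(-(c/b) s)]. *)
Lemma tilted_levy_density (b c : R) (rho nu : probability R R) :
  0 < b -> 0 < c -> lamperti_law al rho ->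
  GGC_tilted_law b c (al * theta) rho nu ->
  has_levy_density nu (fun s => al * theta * s^-1 * expR (- (c / b * s)) *
    \int[rho]_(x in `]0, +oo[) expR (- (s / (b * x)))).
Proof.
move=> b0 c0 rhoE nuE; have [nuD nuL] := tilted_laplace al0 b0 c0 rhoE nuE.
have [H HD HE] := lamperti_image_ex rhoE b0 (ltW c0).
pose g (lam : R) : R := al^-1 * (ln (1 + (c + lam * b) `^ al) - ln (1 + c `^ al)).
have HL (lam : R) : 0 <= lam -> (\int[H]_(x in D1) (ln (1 + lam * x))%:E = (g lam)%:E)%E.
  (* [HE] asks for nonnegativity on the whole line; [Num.max 0 x] provides it without changing the
     integrand on [D1]. *)
  move=> lam0; pose f (x : R) : \bar R := (ln (1 + lam * Num.max 0 x))%:E.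
  have fE x : D1 x -> f x = (ln (1 + lam * x))%:E.
    by rewrite /= in_itv/= andbT /f => x0; rewrite max_r// ltW.
  transitivity (\int[H]_(x in D1) f x)%E.
    by apply: eq_integral => x /set_mem/fE ->.
  rewrite HE.
  - rewrite -(lamperti_log al0 rhoE)// ?(ltW b0) ?(ltW c0)//.
    apply: eq_integral => x /set_mem/=; rewrite in_itv/= andbT => x0; apply: fE.
    rewrite /= in_itv/= andbT divr_gt0 ?mulr_gt0//.
    by rewrite ltr_wpDr// mulr_ge0// ltW.
  - apply/measurable_EFinP; apply: measurableT_comp => //; apply: measurable_funD => //.
    apply: measurable_funM => //; apply: measurable_maxr => //; exact: measurable_id.
  - by move=> x; rewrite lee_fin ln_ge0// lerDl mulr_ge0// le_max lexx.
have lp : has_levy_density nu (fun s => (al * theta) * s^-1 * \int[H]_(x in D1) expR (- (s / x))).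
  apply: (has_levy_density_of_log tau0 HD nuD HL) => lam lam0.
  by rewrite nuL// /g expR_log_ratio// ltr_wpDr// powR_ge0.
suff -> : (fun s => al * theta * s^-1 * expR (- (c / b * s)) *
    \int[rho]_(x in `]0, +oo[) expR (- (s / (b * x)))) =
  (fun s => (al * theta) * s^-1 * \int[H]_(x in D1) expR (- (s / x))) by [].
apply/funext => s; rewrite -[LHS]mulrA; congr (_ * _).
rewrite /Rintegral HE; last 2 first.
- by meas.
- by move=> x; rewrite lee_fin expR_ge0.
transitivity (fine ((expR (- (c / b * s)))%:E * \int[rho]_(x in D1) (expR (- (s / (b * x))))%:E)).
  by rewrite fineZl// expR_gt0.
congr fine; rewrite -ge0_integralZl//; last first.
  by apply: measurable_funTS; meas.
apply: eq_integral => x /set_mem/=; rewrite in_itv/= andbT => x0.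
rewrite -EFinM -expRD; congr (expR _)%:E.
have cx : 0 < 1 + c * x by rewrite addr_gt0 ?mulr_gt0.
by field; rewrite !gt_eqF// mulr_gt0.
Qed.

Lemma skew_levy_density (p c : R) (Lam nu : probability R R) :
  0 < c -> p = c `^ al / (1 + c `^ al) -> skew_occupation_law al p Lam ->
  GGC_law (al * theta) Lam nu ->
  has_levy_density nu (fun s => al * theta * s^-1 *
    \int[Lam]_(a in `]0, 1[) expR (- (s / a))).
Proof.
move=> c0 pE LamE nuE; have [nuD nuL] := skew_GGC_laplace al0 c0 pE LamE nuE.
have LamD := skew_occupation_gt0 al0 c0 pE LamE.
pose g (lam : R) : R := al^-1 * (ln (1 + (c + lam * c) `^ al) - ln (1 + c `^ al)).
have HL (lam : R) : 0 <= lam -> (\int[Lam]_(x in D1) (ln (1 + lam * x))%:E = (g lam)%:E)%E.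
  by move=> lam0; rewrite (skew_occupation_log al0 c0 pE LamE lam0).
have : has_levy_density nu (fun s => (al * theta) * s^-1 * \int[Lam]_(x in D1) expR (- (s / x))).
  apply: (has_levy_density_of_log tau0 LamD nuD HL) => lam lam0.
  by rewrite nuL// /g expR_log_ratio// ltr_wpDr// powR_ge0.
congr has_levy_density; apply/funext => s; congr (_ * _); congr fine.
have ms : measurable_fun [set: R] (fun x : R => (expR (- (s / x)))%:E) by meas.
rewrite (integral_fullP mD1 LamD ms) [RHS](integral_fullP _ _ ms)//.
exact: (skew_occupation_full al0 c0 pE LamE).
Qed.

Lemma dirichlet_mean_skew_ex (p c : R) (Lam : probability R R) (G : probability R R) :
  0 < c -> p = c `^ al / (1 + c `^ al) -> skew_occupation_law al p Lam ->
  gamma_law (al * theta) G ->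
  exists M : probability R R, dirichlet_mean_law (al * theta) Lam M.
Proof.
move=> c0 pE LamE Gt; have [rho [S Sst _] _] := skew_occupation_image al0 c0 pE LamE.
have [M MD ME] := dirichlet_mean_ex al0 Sst th0 Gt (ltW c0) c0.
exists M; split => //.
- split; last exact: (skew_occupation_ln_integrable al0 c0 pE LamE).
  exact/probability_gt0_ge0/(skew_occupation_gt0 al0 c0 pE LamE).
- exact: probability_gt0_ge0.
- by move=> lam lam0; rewrite ME// (skew_occupation_expR_log al0 c0 pE LamE theta lam0).
Qed.

Lemma lamperti_ln_integrable (rho : probability R R) : lamperti_law al rho ->
  rho.-integrable D (fun x : R => (ln (1 + x))%:E).
Proof.
move=> rhoE; have rhoD := lamperti_full rhoE; have rhoD' := probability_gt0_ge0 rhoD.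
apply/integrableP; split; first by apply: measurable_funTS; meas.
have me : measurable_fun [set: R] (fun x : R => `|(ln (1 + x))%:E|)%E.
  by apply: measurableT_comp => //; meas.
rewrite (integral_fullP mD rhoD' me) -(integral_fullP mD1 rhoD me).
have := lamperti_log al0 rhoE ler01 (lexx 0) ler01.
under eq_integral do rewrite !mul1r mul0r addr0 divr1.
rewrite (_ : (\int[rho]_(x in D1) `|_|)%E = \int[rho]_(x in D1) (ln (1 + x))%:E)%E.
  by move=> ->; rewrite ltry.
apply: eq_integral => x /set_mem/=; rewrite in_itv/= andbT => x0.
by rewrite ger0_norm// ln_ge0// lerDl ltW.
Qed.

Lemma dirichlet_mean_lamperti_ex (rho : probability R R) (G : probability R R) :
  lamperti_law al rho -> gamma_law (al * theta) G ->
  exists2 M : probability R R, dirichlet_mean_law (al * theta) rho M & M D1 = 1%E.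
Proof.
move=> rhoE Gt; have [S Sst _] := rhoE.
have [M MD ME] := dirichlet_mean_ex al0 Sst th0 Gt (lexx 0) ltr01.
exists M => //; split => //.
- split; last exact: lamperti_ln_integrable.
  exact/probability_gt0_ge0/(lamperti_full rhoE).
- exact: probability_gt0_ge0.
- move=> lam lam0; rewrite ME// full_log_integral//; last exact: lamperti_full rhoE.
  have := lamperti_log al0 rhoE ler01 (lexx 0) lam0.
  under eq_integral do rewrite mul1r mul0r addr0 divr1.
  move=> -> /=; rewrite expR_log_ratio// ltr_wpDr ?powR_ge0//.
Qed.

(** Equal transforms do not suffice: [GGC_law] asks for a gamma law and a Dirichlet mean. The former
    is the one inside the hypothesis on [nu], the latter comes from [dirichlet_mean_skew_ex]. *)
Lemma GGC_tilted_skew (p c : R) (rho Lam nu : probability R R) :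
  0 < c -> p = c `^ al / (1 + c `^ al) -> lamperti_law al rho ->
  skew_occupation_law al p Lam ->
  GGC_tilted_law c c (al * theta) rho nu -> GGC_law (al * theta) Lam nu.
Proof.
move=> c0 pE rhoE LamE nuE; have [nuD nuL] := tilted_laplace al0 c0 c0 rhoE nuE.
have [L [fL [[G [M0 [Gt _ _]]] _ _]]] := nuE.
have [M ME] := dirichlet_mean_skew_ex c0 pE LamE Gt.
have GLam : GGC_law (al * theta) Lam (prod_law G M) by exists G, M; split.
have [gD gL] := skew_GGC_laplace al0 c0 pE LamE GLam.
exists G, M; split => //; apply: probability_laplace_unique => // lam lam0.
by rewrite nuL// gL.
Qed.

(** A GGC law [L] over [rho] with a density is built, tilted by [e^(-c v)] and scaled by [c]. The
    result has the Laplace transform of [nu], so [nu] inherits its density. *)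
Lemma skew_GGC_tilted (p c : R) (rho Lam nu : probability R R) :
  0 < c -> p = c `^ al / (1 + c `^ al) -> lamperti_law al rho ->
  skew_occupation_law al p Lam ->
  GGC_law (al * theta) Lam nu -> GGC_tilted_law c c (al * theta) rho nu.
Proof.
move=> c0 pE rhoE LamE nuE; have [nuD nuL] := skew_GGC_laplace al0 c0 pE LamE nuE.
have [G [_ [Gt _ _]]] := nuE.
have [M ME MD] := dirichlet_mean_lamperti_ex rhoE Gt.
pose L := prod_law G M.
have GL : GGC_law (al * theta) rho L by exists G, M; split.
have [LD LL] := lamperti_GGC_laplace al0 rhoE GL.
have [fL fLE] := gamma_mix_density tau0 Gt MD.
have [mfL fL0 _] := fLE.
(* The reciprocal of the Laplace transform of [L] at [c], which normalizes the tilt. *)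
pose K : R := (1 + c `^ al) `^ theta.
have c1 : 0 < 1 + c `^ al by rewrite ltr_wpDr ?powR_ge0.
have K0 : 0 < K by rewrite powR_gt0.
pose F (v : R) : \bar R := (K * expR (- (c * v)))%:E.
have mF : measurable_fun [set: R] F by rewrite /F; meas.
have F0 v : (0 <= F v)%E by rewrite lee_fin mulr_ge0 ?expR_ge0// ltW.
have mexp (u : R) : measurable_fun [set: R] (fun x : R => (expR (- (u * x)))%:E) by meas.
have LT (u : R) : 0 <= u -> (\int[L]_x (expR (- (u * x)))%:E = ((1 + u `^ al) `^ (- theta))%:E)%E.
  by move=> u0; rewrite -(integral_fullP mD LD (mexp _)) LL.
have [m1 m1E] := density_measure_ex L mF F0.
have m11 : m1 setT = 1%E.
  rewrite m1E//; under eq_integral do rewrite /F EFinM.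
  rewrite ge0_integralZl//; last by rewrite lee_fin ltW.
  rewrite LT ?(ltW c0)// -EFinM; congr EFin.
  by rewrite /K -powRD ?(gt_eqF c1) ?implybT// subrr powRr0.
have [P PE'] := probability_ex m11.
have PE A : measurable A -> P A = (\int[L]_(v in A) F v)%E by move=> mA; rewrite PE' m1E.
pose phi (v : R) : R := c * v.
have mphi : measurable_fun [set: R] phi by rewrite /phi; meas.
pose X : {mfun R >-> R} := HB.pack phi (isMeasurableFun.Build _ _ _ _ phi mphi).
pose nu' := distribution P X.
have nu'E (g : R -> \bar R) : measurable_fun [set: R] g -> (forall x, 0 <= g x)%E ->
   (\int[nu']_x g x = \int[L]_v (g (c * v)%R * F v))%E.
  move=> mg g0; rewrite ge0_integral_distribution//.
  rewrite (integral_density mF F0 PE)//; last by move=> x; exact: g0.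
  exact: (measurableT_comp mg mphi).
have LD1 : L D1 = 1%E.
  have [_ _ LE] := fLE; apply: probability_null_full => //.
  by rewrite LE; [rewrite setICl integral_set0|exact: measurableC].
have PD1 : P D1 = 1%E.
  apply: probability_null_full => //.
  exact: (density_null mD1 (probability_null mD1 LD1) mF PE).
have nu'D : nu' D = 1%E.
  apply: probability_gt0_ge0; apply: (@image_law_full _ _ R P nu' phi mphi _ D1) => //.
  by move=> x; rewrite /= !in_itv/= !andbT => x0; exact: mulr_gt0.
have nu'nu : same_law nu nu'.
  apply: probability_laplace_unique => // lam lam0; rewrite nuL//.
  rewrite (integral_fullP mD nu'D (mexp _)) nu'E//.
  rewrite (_ : integral _ _ _ = \int[L]_v (K%:E * (expR (- ((c + lam * c) * v)))%:E))%E; last first.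
    apply: eq_integral => v _; rewrite /F -!EFinM mulrCA -expRD.
    by congr (_ * expR _)%:E; ring.
  have lc : 0 <= c + lam * c by rewrite addr_ge0 ?mulr_ge0// ltW.
  rewrite ge0_integralZl//; last by rewrite lee_fin ltW.
  rewrite LT// -EFinM; congr EFin; rewrite powRM ?invr_ge0 ?(ltW c1)//; last first.
    by rewrite addr_ge0 ?powR_ge0.
  have -> : (1 + c `^ al)^-1 `^ (- theta) = K.
    by rewrite -powR_inv1 ?(ltW c1)// -powRrM mulN1r opprK.
  exact: mulrC.
exists L, fL; split => //; exists K => //.
have mfL' : measurable_fun [set: R] ((fun v : R => (fL v)%:E) \_ D1).
  by apply/(measurable_restrictT _ _).1 => //; apply/measurable_EFinP.
have fL'0 v : (0 <= ((fun v : R => (fL v)%:E) \_ D1) v)%E.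
  by rewrite patchE; case: ifPn => // /set_mem Dw; rewrite lee_fin fL0.
split.
- apply: measurable_funM => //; apply: measurable_funM; first by apply: measurable_funTS; meas.
  apply: measurable_funM => //.
  apply: (@measurable_comp _ _ _ _ _ _ D1 fL D1 (fun w : R => w / c)) => //.
  + by move=> _ [w/= + <-]; rewrite !in_itv/= !andbT => w0; rewrite divr_gt0.
  + by apply: measurable_funTS; meas.
- move=> w /=; rewrite in_itv/= andbT => w0.
  rewrite mulr_ge0 ?(ltW K0)// mulr_ge0 ?expR_ge0// mulr_ge0 ?invr_ge0 ?(ltW c0)//.
  by rewrite fL0//= in_itv/= andbT divr_gt0.
- move=> A mA; rewrite nu'nu//.
  transitivity (\int[nu']_x (\1_A x : R)%:E)%E.
    by rewrite integral_indic// setIT.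
  have mI : measurable_fun [set: R] (fun x : R => (\1_A x : R)%:E).
    by apply/measurable_EFinP; exact: measurable_indic.
  have mIc : measurable_fun [set: R] (fun x : R => (\1_A (c * x) : R)%:E).
    by apply: (measurableT_comp mI); meas.
  rewrite nu'E//.
  rewrite (lebesgue_density_integral mD1 fLE); last 2 first.
  + exact: emeasurable_funM.
  + by move=> x; rewrite mule_ge0.
  rewrite [RHS]integral_mkcondl.
  pose f (w : R) : \bar R := ((\1_A w : R)%:E * (K * (expR (- (c / c * w)) * c^-1))%:E *
      ((fun v : R => (fL v)%:E) \_ D1) (w / c)%R)%E.
  transitivity (\int[mu]_(w in D1) f w)%E; last first.
    apply: eq_integral => w /set_mem/=; rewrite in_itv/= andbT => w0.
    have wc : D1 (w / c) by rewrite /= in_itv/= andbT divr_gt0.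
    rewrite /f patchE mem_set// patchE indicE; case: ifPn => _; rewrite ?mul0e// mul1e -EFinM.
    by congr EFin; ring.
  have mf : measurable_fun [set: R] f.
    rewrite /f; apply: emeasurable_funM.
      by apply: emeasurable_funM => //; meas.
    by apply: (measurableT_comp mfL'); meas.
  have f0 w : (0 <= f w)%E.
    by rewrite /f !mule_ge0// ?lee_fin// mulr_ge0 ?(ltW K0)// mulr_ge0 ?expR_ge0// invr_ge0 ltW.
  rewrite (ge0_integral_scale c0 mf)// -ge0_integralZl; last 4 first.
  + exact: mD1.
  + apply: measurable_funTS; apply: (measurableT_comp mf); meas.
  + by move=> x _; exact: f0.
  + by rewrite lee_fin ltW.
  apply: eq_integral => v Dv; rewrite /f /F.
  have -> : c * v / c = v by field; rewrite gt_eqF.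
  have -> : c / c * (c * v) = c * v by field; rewrite gt_eqF.
  rewrite patchE Dv -!EFinM; congr EFin.
  by field; rewrite gt_eqF.
Qed.

End levy_densities.

(** * Jumps of stable subordinators *)

Section grid.
Variable R : realType.

Definition grid (n i : nat) : R := i%:R / n.+1%:R.

Lemma grid0 n : grid n 0 = 0. Proof. by rewrite /grid mul0r. Qed.

Lemma gridn n : grid n n.+1 = 1.
Proof. by rewrite /grid divff// pnatr_eq0. Qed.

Lemma grid_ge0 n i : 0 <= grid n i.
Proof. by rewrite /grid divr_ge0. Qed.

Lemma grid_le n i j : (i <= j)%N -> grid n i <= grid n j.
Proof. by move=> ij; rewrite /grid ler_wpM2r ?invr_ge0// ler_nat. Qed.

Lemma grid_le1 n i : (i <= n.+1)%N -> grid n i <= 1.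
Proof. by move=> /(grid_le n); rewrite gridn. Qed.

Lemma gridS n i : grid n i.+1 - grid n i = n.+1%:R^-1.
Proof. by rewrite /grid -mulrBl -natrB// subSnn mul1r. Qed.

(** Cells are open on the left and closed on the right: a jump at [t] is then part of the increment
    over the cell of [t], even when [t] is a grid point. The default [ord0] is met only outside []0,
    1]]. *)
Definition cell (n : nat) (t : R) : 'I_n.+1 :=
  odflt ord0 [pick i : 'I_n.+1 | grid n i < t <= grid n i.+1].

Lemma cellP n (t : R) : 0 < t <= 1 ->
  grid n (cell n t) < t <= grid n (cell n t).+1.
Proof.
move=> /andP[t0 t1]; rewrite /cell; case: pickP => //= none.
suff : grid n n.+1 < t by rewrite gridn ltNge t1.
have : (n.+1 <= n.+1)%N by [].
elim: {1 3}n.+1 => [_|i IH iS]; first by rewrite grid0.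
have := none (Ordinal iS); rewrite /= (IH (ltnW iS))/= => /negbT.
by rewrite -ltNge.
Qed.

Lemma cell_eq n (t : R) (i : 'I_n.+1) :
  grid n i < t <= grid n i.+1 -> cell n t = i.
Proof.
move=> /andP[it ti].
have t01 : 0 < t <= 1.
  by rewrite (le_lt_trans (grid_ge0 n i) it) (le_trans ti)// grid_le1.
have /andP[ct tc] := cellP n t01; apply/val_inj/eqP; rewrite eqn_leq; apply/andP; split.
  rewrite leqNgt; apply/negP => /(grid_le n) h.
  by have := lt_le_trans ct (le_trans ti h); rewrite ltxx.
rewrite leqNgt; apply/negP => /(grid_le n) h.
by have := lt_le_trans it (le_trans tc h); rewrite ltxx.
Qed.

(** Two times in one cell differ by at most the mesh, and only finitely many pairs have to be told
    apart. *)
Lemma cell_separated (t : nat -> R) (K : nat) : injective t ->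
  (forall k, 0 < t k <= 1) ->
  \forall n \near \oo, injective (fun k : 'I_K => cell n (t k)).
Proof.
move=> tinj t01.
have H (k l : nat) : \forall n \near \oo, cell n (t k) = cell n (t l) -> k = l.
  have [->|kl] := eqVneq k l; first by near=> n.
  have tkl : 0 < `|t k - t l| by rewrite normr_gt0 subr_eq0; apply/negP => /eqP/tinj/eqP; apply/negP.
  have := near_infty_natSinv_lt (PosNum tkl); apply: filterS => n /= nlt e.
  have /andP[a1 b1] := cellP n (t01 k); have /andP[a2 b2] := cellP n (t01 l).
  exfalso; move: nlt; rewrite ltNge => /negP; apply.
  rewrite -(gridS n (cell n (t k))) ler_norml.
  by rewrite -e in a2 b2; apply/andP; split; lra.
have : \forall n \near \oo, forall kl : 'I_K * 'I_K,
    cell n (t kl.1) = cell n (t kl.2) -> kl.1 = kl.2 :> nat.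
  by apply: filter_forall => -[k l]; exact: H.
by apply: filterS => n h k l e; apply: val_inj; exact: (h (k, l)).
Unshelve. all: by end_near. Qed.

End grid.

(** * Left limits and jumps of monotone paths *)

Section paths.
Variables (R : realType) (x : R -> R).
Hypothesis xmono : forall s t, 0 <= s -> s <= t -> t <= 1 -> x s <= x t.

Lemma cvg_at_left_jump (t : R) : 0 < t <= 1 ->
  x s @[s --> t^'-] --> x t - jump x t.
Proof.
move=> /andP[t0 t1]; rewrite /jump opprB addrC subrK.
apply: nondecreasing_at_left_is_cvgr.
- near=> s => u v; rewrite !in_itv/= => /andP[su ut] /andP[sv vt] uv.
  have s0 : 0 <= s by near: s; exact: nbhs_left_ge.
  apply: xmono => //; first by rewrite (le_trans s0)// ltW.
  by rewrite (le_trans (ltW vt)).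
- near=> s; exists (x t) => _ [u + <-]; rewrite /= in_itv/= => /andP[su ut].
  have s0 : 0 <= s by near: s; exact: nbhs_left_ge.
  apply: xmono => //; first by rewrite (le_trans s0)// ltW.
  by rewrite ltW.
Unshelve. all: by end_near. Qed.

Lemma jump_le (s t : R) : 0 <= s -> s < t -> t <= 1 -> jump x t <= x t - x s.
Proof.
move=> s0 st t1; rewrite lerBrDr -lerBrDl.
have c : x u @[u --> t^'-] --> x t - jump x t.
  by apply: cvg_at_left_jump; rewrite t1 (le_lt_trans s0 st).
rewrite -(cvg_lim _ c)//; apply: limr_ge; first by apply/cvg_ex; eexists; exact: c.
near=> u; apply: xmono => //.
- by near: u; exact: nbhs_left_ge.
- by rewrite (le_trans _ t1)// ltW//; near: u; exact: nbhs_left_lt.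
Unshelve. all: by end_near. Qed.

Lemma jump_ge0 (t : R) : 0 < t <= 1 -> 0 <= jump x t.
Proof.
move=> /andP[t0 t1].
have c : x u @[u --> t^'-] --> x t - jump x t by apply: cvg_at_left_jump; rewrite t0.
suff : x t - jump x t <= x t by lra.
rewrite -(cvg_lim _ c)//; apply: limr_le; first by apply/cvg_ex; eexists; exact: c.
near=> u; apply: xmono => //.
by rewrite ltW//; near: u; exact: nbhs_left_lt.
Unshelve. all: by end_near. Qed.

End paths.

(** * Comparison of grid increments with the ranked jumps of a path *)

Section jumps.
Variables (R : realType) (x : R -> R) (J : nat -> R) (tau : nat -> R).
Hypothesis x0 : x 0 = 0.
Hypothesis xmono : forall s t, 0 <= s -> s <= t -> t <= 1 -> x s <= x t.
Hypothesis xrc : forall t, 0 <= t < 1 -> x s @[s --> t^'+] --> x t.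
Hypothesis tinj : injective tau.
Hypothesis trange : range tau = [set t | 0 < t <= 1 /\ jump x t != 0].
Hypothesis JE : forall k, J k = jump x (tau k).

Definition increment (n i : nat) : R := x (grid R n i.+1) - x (grid R n i).

Lemma increment_ge0 n (i : 'I_n.+1) : 0 <= increment n i.
Proof.
rewrite subr_ge0; apply: xmono; rewrite ?grid_ge0 ?grid_le//.
by rewrite grid_le1.
Qed.

Lemma sum_increment n : \sum_(i < n.+1) increment n i = x 1.
Proof.
rewrite -(big_mkord xpredT (increment n)) /increment telescope_sumr//.
by rewrite gridn grid0 x0 subr0.
Qed.

Lemma jump_time k : 0 < tau k <= 1 /\ jump x (tau k) != 0.
Proof.
suff : [set t | 0 < t <= 1 /\ jump x t != 0] (tau k) by [].
by rewrite -trange; exists k.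
Qed.

Let t01 k : 0 < tau k <= 1. Proof. by have [] := jump_time k. Qed.

Lemma ranked_gt0 k : 0 < J k.
Proof.
by have [h n0] := jump_time k; rewrite JE lt_def n0 jump_ge0.
Qed.

Lemma ranked_le_increment n k : J k <= increment n (cell n (tau k)).
Proof.
have /andP[h1 h2] := cellP n (t01 k); rewrite JE.
have g0 := grid_ge0 R n (cell n (tau k)).
apply: (le_trans (jump_le xmono g0 h1 _)); first by case/andP: (t01 k).
rewrite /increment lerD2r; apply: xmono => //.
- by apply: le_trans (ltW h1).
- by rewrite grid_le1.
Qed.

(** The part of increment [i] explained by the first [K] jumps; on a fine grid it has at most one
    term. *)
Definition slot n K (i : 'I_n.+1) : R := \sum_(k < K | cell n (tau k) == i) J k.

Lemma sum_slot n K : \sum_(i < n.+1) slot K i = \sum_(k < K) J k.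
Proof. by rewrite (partition_big (fun k : 'I_K => cell n (tau k)) xpredT). Qed.

(** Once the first [K] jump times are in distinct cells, a slot is empty or a single jump. An empty
    product equals [f 0], hence the condition [f 0 = 1]. *)
Lemma slot_near K : \forall n \near \oo, forall i : 'I_n.+1,
  slot K i <= increment n i /\
  forall f : R -> R, f 0 = 1 -> \prod_(k < K | cell n (tau k) == i) f (J k) = f (slot K i).
Proof.
have := cell_separated K tinj t01; apply: filterS => n ninj i; rewrite /slot.
have [k /eqP ki|none] := pickP (fun k : 'I_K => cell n (tau k) == i); last first.
  by rewrite !big_pred0//; split; [exact: increment_ge0|move=> f f1; rewrite big_pred0].
have E (k' : 'I_K) : (cell n (tau k') == i) = (k' == k).
  by rewrite -ki; apply/eqP/eqP => [/ninj|->].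
by rewrite (eq_bigl _ _ E) big_pred1_eq -ki; split; [exact: ranked_le_increment|
  move=> f f1; rewrite ki (eq_bigl _ _ E) big_pred1_eq].
Qed.

Lemma sum_ranked_le K : \sum_(k < K) J k <= x 1.
Proof.
have : \forall n \near \oo, \sum_(k < K) J k <= x 1; last by case=> n _ /(_ n); apply => /=.
have := slot_near K; apply: filterS => n h.
by rewrite -(sum_slot n) -(sum_increment n); apply: ler_sum => i _; case: (h i).
Qed.

(** Each increment exceeds its slot, so monotonicity of [f] gives the upper bound. The excesses add
    up to [x 1] minus the first [K] jumps, and each costs at most a factor [e^(-a * excess)]. *)
Lemma prod_increment_near (f : R -> R) (a : R) K : f 0 = 1 ->
  (forall u v, 0 <= u -> u <= v -> 0 <= f v <= f u) ->
  (forall u v, 0 <= u -> 0 <= v -> f u * expR (- (a * v)) <= f (u + v)) ->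
  \forall n \near \oo,
    (\prod_(k < K) f (J k)) * expR (- (a * (x 1 - \sum_(k < K) J k))) <=
    \prod_(i < n.+1) f (increment n i) <= \prod_(k < K) f (J k).
Proof.
move=> f1 fd fe; have := slot_near K; apply: filterS => n h.
have s0 (i : 'I_n.+1) : 0 <= slot K i by apply: sumr_ge0 => k _; rewrite ltW// ranked_gt0.
have -> : \prod_(k < K) f (J k) = \prod_(i < n.+1) f (slot K i).
  rewrite (partition_big (fun k : 'I_K => cell n (tau k)) xpredT)//=.
  by apply: eq_bigr => i _; case: (h i) => _; exact.
apply/andP; split; last first.
  by apply: ler_prod => i _; apply: fd => //; case: (h i).
rewrite -(sum_increment n) -(sum_slot n) -sumrB mulr_sumr -sumrN expR_sum -big_split/=.
apply: ler_prod => i _; case: (h i) => hi _; apply/andP; split.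
  have /andP[f0 _] := fd 0 (slot K i) (lexx 0) (s0 i).
  by rewrite mulr_ge0// expR_ge0.
have -> : increment n i = slot K i + (increment n i - slot K i) by rewrite addrC subrK.
rewrite [X in expR (- (a * X))](_ : _ = increment n i - slot K i); last by rewrite addrC addKr.
by apply: fe => //; rewrite subr_ge0.
Qed.

(** Near any [t] the path stays within [delta / 2] of [x t] on the right and of its left limit on
    the left. A short interval therefore varies by at most [delta], plus the jump at [t] if it
    straddles [t]. *)
Lemma increment_near (delta : R) : 0 < delta ->
  \forall n \near \oo, forall i : 'I_n.+1, increment n i <= delta \/
   exists k, cell n (tau k) = i /\ increment n i <= delta + J k.
Proof.
move=> d0.
pose good (a b : R) := x b - x a <= delta \/
  exists2 t, a < t <= b & x b - x a <= delta + jump x t.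
have loc (t : R) : 0 <= t <= 1 -> \forall e \near 0^'+, forall a b,
    0 <= a -> a <= b -> b <= 1 -> t - e < a -> b < t + e -> good a b.
  move=> /andP[t0 t1].
  have d20 : 0 < delta / 2 by rewrite divr_gt0.
  have rgt : \forall e \near 0^'+, forall b, t <= b -> b <= 1 -> b < t + e -> x b <= x t + delta / 2.
    have [tlt1|t1'] := ltP t 1; last first.
      near=> e => b tb b1 _; have -> : b = t by apply/le_anti; rewrite tb (le_trans b1).
      by rewrite lerDl ltW.
    have /cvgrPdist_le/(_ _ d20) : x s @[s --> t^'+] --> x t by apply: xrc; rewrite t0.
    move=> [e /= e0 he]; near=> e' => b tb b1 be.
    move: tb; rewrite le_eqVlt => /predU1P[<-|tb]; first by rewrite lerDl ltW.
    have : `|x t - x b| <= delta / 2.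
      apply: he => //=; rewrite ltr0_norm ?subr_lt0// opprB ltrBlDl (lt_le_trans be)//.
      by rewrite lerD2l; near: e'; exact: nbhs_right_le.
    by rewrite ler_norml => /andP[h1 h2]; lra.
  have lft : \forall e \near 0^'+, 0 < t -> forall a, 0 <= a -> t - e < a -> a < t ->
      x t - jump x t - delta / 2 <= x a.
    have [tgt0|t0'] := ltP 0 t; last by near=> e.
    have t01' : 0 < t <= 1 by rewrite tgt0.
    have /cvgrPdist_le/(_ _ d20)[e /= e0 he] := cvg_at_left_jump xmono t01'.
    near=> e' => _ a a0 ta at'.
    have : `|x t - jump x t - x a| <= delta / 2.
      apply: he => //=; rewrite gtr0_norm ?subr_gt0//.
      rewrite ltrBlDr addrC -ltrBlDr (le_lt_trans _ ta)//.
      by rewrite lerD2l lerN2; near: e'; exact: nbhs_right_le.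
    by rewrite ler_norml => /andP[h1 h2]; lra.
  apply: filterS2 rgt lft => e hr hl a b a0 ab b1 ta bt.
  have [ta'|at'] := leP t a.
    left; have := hr b (le_trans ta' ab) b1 bt.
    have : x t <= x a by apply: xmono => //; rewrite (le_trans ab).
    by lra.
  have tp : 0 < t by exact: le_lt_trans at'.
  have la := hl tp a a0 ta at'.
  have [tb|bt'] := leP t b.
    right; exists t; first by rewrite at' tb.
    by have := hr b tb b1 bt; lra.
  left.
  have jle : x b <= x t - jump x t.
    by have := jump_le xmono (le_trans a0 ab) bt' t1; lra.
  by lra.
(* Compactness of [[0, 1]] makes the mesh uniform. The local radius [e] is split in halves, one for
   the distance from [t] to [a], the other for the length of the interval. *)
have nc : \forall n \near \oo, `[0, 1] `<=` [set a : R | 0 <= a -> forall b, a <= b -> b <= 1 ->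
    b <= a + n.+1%:R^-1 -> good a b].
  have /compact_near_coveringP := @segment_compact R 0 1.
  apply => t /=; rewrite in_itv/= => t01'.
  have [e [e0 he]] : exists e : R, 0 < e /\ forall a b,
    0 <= a -> a <= b -> b <= 1 -> t - e < a -> b < t + e -> good a b.
    apply: (@filter_ex _ (0 : R)^'+); apply: filterS2 (nbhs_right_gt 0) (loc t t01').
    by move=> e; split.
  have e20 : 0 < e / 2 by rewrite divr_gt0.
  near=> a n => /= a0 b ab b1 bn.
  have an : `|t - a| < e / 2.
    by near: a; apply: nbhsx_ballx.
  have nn : n.+1%:R^-1 < e / 2.
    by near: n; exact: (near_infty_natSinv_lt (PosNum e20)).
  move: an; rewrite ltr_norml => /andP[h1 h2].
  have aux (u v w z y : R) : - (v / 2) < u - w -> u - w < v / 2 -> y < v / 2 -> z <= w + y ->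
      u - v < w /\ z < u + v by move=> ? ? ? ?; split; lra.
  by have [] := aux _ _ _ _ _ h1 h2 nn bn; exact: he.
apply: filterS nc => n hn i.
have gi : `[0, 1]%classic (grid R n i).
  by rewrite /= in_itv/= grid_ge0 grid_le1// ltnW.
have := hn _ gi (grid_ge0 R n i) (grid R n i.+1).
rewrite grid_le// grid_le1//= => /(_ isT isT).
case.
- by rewrite -(gridS R n i) addrC subrK.
- by left.
move=> [t /andP[h1 h2] h3].
have [tj|tj] := eqVneq (jump x t) 0; first by left; rewrite tj addr0 in h3.
have : range tau t.
  rewrite trange; split => //; apply/andP; split.
    by rewrite (le_lt_trans (grid_ge0 R n i) h1).
  by rewrite (le_trans h2)// grid_le1.
move=> [k _ tk]; right; exists k; split; first by apply: cell_eq; rewrite tk h1 h2.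
by rewrite JE tk.
Unshelve. all: by end_near. Qed.

(** [K] depends on [n] and on the path: it exceeds the index of a jump chosen in each cell where
    [increment_near] needs one. Then an increment minus its slot is at most [delta], and at most the
    increment. *)
Lemma sum_min_increment_near (delta : R) : 0 < delta ->
  \forall n \near \oo, exists K,
    x 1 - \sum_(k < K) J k <= \sum_(i < n.+1) Num.min (increment n i) delta.
Proof.
move=> d0; have := increment_near d0; apply: filterS => n h.
pose kk (i : 'I_n.+1) : nat := if pselect (exists k, cell n (tau k) = i /\ increment n i <= delta + J k)
   is left e then projT1 (cid e) else 0%N.
pose K := (\max_(i < n.+1) kk i).+1; exists K.
rewrite -(sum_increment n) -(sum_slot n) -sumrB; apply: ler_sum => i _.
have s0 : 0 <= slot K i by apply: sumr_ge0 => k _; rewrite ltW// ranked_gt0.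
rewrite le_min lerBlDr lerDl s0/= lerBlDr.
have [ind|[k ek]] := h i; first by rewrite (le_trans ind)// lerDl.
have kiK : (kk i < K)%N by rewrite ltnS; exact: leq_bigmax.
have [cki ji] : cell n (tau (kk i)) = i /\ increment n i <= delta + J (kk i).
  rewrite /kk; case: pselect => [e|]; last by case; exists k.
  by case: (cid e).
apply: (le_trans ji); rewrite lerD2l /slot (bigD1 (Ordinal kiK))/=; last by rewrite cki.
by rewrite lerDl; apply: sumr_ge0 => l _; rewrite ltW// ranked_gt0.
Qed.

End jumps.

(** * Independence and products of functions *)

Section layers.
Variable R : realType.
Local Notation mu := (@lebesgue_measure R).
Local Notation U := (`[0%R, 1%R[%classic : set R).
Let mU : measurable U. Proof. exact: measurable_itv. Qed.

Definition unit_fun (f : R -> R) :=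
  measurable_fun [set: R] f /\ forall x, 0 <= f x <= 1.

Definition level (f : R -> R) (u : R) : R -> R := \1_[set x | u < f x].

Definition replace (g : nat -> R -> R) (j : nat) (f : R -> R) : nat -> R -> R :=
  fun i => if i == j then f else g i.

Lemma levelE f u x : level f u x = (u < f x)%R%:R.
Proof. by rewrite /level indicE; congr (nat_of_bool _)%:R; apply/idP/idP; rewrite inE. Qed.

Lemma measurable_level_set f u : unit_fun f -> measurable [set x | u < f x].
Proof.
move=> [mf _]; rewrite -[X in measurable X]setTI.
rewrite (_ : [set x | u < f x] = f @^-1` `]u, +oo[%classic).
  exact: (mf measurableT _ (measurable_itv _)).
by apply/seteqP; split => x /=; rewrite in_itv/= andbT.
Qed.

Lemma unit_fun_indic (A : set R) : measurable A -> unit_fun \1_A.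
Proof.
move=> mA; split; first exact: measurable_indic.
by move=> x; rewrite indicE; case: (x \in A); rewrite ?lexx ?ler01.
Qed.

Lemma integral_level (a : R) : 0 <= a <= 1 ->
  (\int[mu]_(u in U) ((u < a)%R%:R : R)%:E = a%:E)%E.
Proof.
move=> /andP[a0 a1].
transitivity (\int[mu]_(u in U) (\1_(`[0, a[%classic : set R) u : R)%:E)%E.
  apply: eq_integral => u /set_mem/=; rewrite in_itv/= => /andP[u0 u1].
  rewrite indicE; congr (nat_of_bool _)%:R%:E.
  by apply/idP/idP => [ua|]; [rewrite mem_set//= in_itv/= u0|
    rewrite inE/= in_itv/= => /andP[]].
rewrite integral_indic// setIidl; last first.
  by move=> u /=; rewrite !in_itv/= => /andP[-> ua]; rewrite (lt_le_trans ua).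
by rewrite [LHS]lebesgue_measure_itv/= lte_fin; case: ltgtP a0 => // [_ _|<- _]; rewrite ?oppr0 ?adde0// sube0.
Qed.

Lemma measurable_lt_nat d (T : measurableType d) (f g : T -> R) :
  measurable_fun [set: T] f -> measurable_fun [set: T] g ->
  measurable_fun [set: T] (fun x => (f x < g x)%R%:R : R).
Proof.
move=> mf mg; rewrite (_ : (fun x => _) = fun x => if (f x < g x)%R then 1 else 0).
  by apply: measurable_fun_ifT => //; exact: measurable_fun_ltr.
by apply/funext => x; case: (_ < _)%R.
Qed.

(* Commuting with the layer cake [f = \int_0^1 1_{f > u} du] in each argument
   reduces functions to indicators. *)
Lemma layer_ext (n : nat) (Phi1 Phi2 : (nat -> R -> R) -> \bar R) :
  (forall g j, (j < n)%N -> (forall i, unit_fun (g i)) ->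
     Phi1 g = \int[mu]_(u in U) Phi1 (replace g j (level (g j) u)))%E ->
  (forall g j, (j < n)%N -> (forall i, unit_fun (g i)) ->
     Phi2 g = \int[mu]_(u in U) Phi2 (replace g j (level (g j) u)))%E ->
  (forall A : nat -> set R, (forall i, measurable (A i)) ->
     Phi1 (fun i => \1_(A i)) = Phi2 (fun i => \1_(A i))) ->
  forall g, (forall i, unit_fun (g i)) -> (forall i, (n <= i)%N -> g i = cst 1) ->
  Phi1 g = Phi2 g.
Proof.
move=> L1 L2 E g ug gn.
have : forall i, (n <= i)%N -> exists2 A : set R, measurable A & g i = \1_A.
  by move=> i /gn ->; exists setT => //; apply/funext => x; rewrite indicT.
have : (n <= n)%N by [].
move: {1 3}n => m; elim: m g ug {gn} => [|m IH] g ug mn gi.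
  have /choice[A AP] : forall i, exists A : set R, measurable A /\ g i = \1_A.
    by move=> i; have [A mA gA] := gi i (leq0n i); exists A.
  have -> : g = fun i => \1_(A i) by apply/funext => i; case: (AP i).
  by apply: E => i; case: (AP i).
rewrite (L1 _ m)// (L2 _ m)//; apply: eq_integral => u _; apply: IH.
- move=> i; rewrite /replace; case: ifPn => // _.
  exact: (unit_fun_indic (measurable_level_set u (ug m))).
- exact: ltnW.
- move=> i mi; rewrite /replace; have [_|im] := eqVneq i m.
    by exists [set x | u < g m x]; [exact: (measurable_level_set u (ug m))|].
  by apply: gi; rewrite ltn_neqAle eq_sym im.
Qed.

Lemma unit_prod n (a : nat -> R) (P : pred nat) : (forall i, 0 <= a i <= 1) ->
  0 <= \prod_(i < n | P i) a i <= 1.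
Proof.
move=> a01; apply/andP; split; first by apply: prodr_ge0 => i _; case/andP: (a01 i).
by rewrite -[leRHS](@big1_eq _ _ *%R 'I_n (index_enum 'I_n) P); apply: ler_prod => i _.
Qed.

Section weighted.
Context d (Om : measurableType d) (P : probability Om R).
Variables (n : nat) (X : nat -> Om -> R) (V : Om -> R).
Hypothesis mX : forall i, measurable_fun [set: Om] (X i).
Hypothesis mV : measurable_fun [set: Om] V.
Hypothesis V0 : forall w, 0 <= V w.

(** The weight [V] is the constant 1, the change-of-measure density or a product of mark indicators,
    according to use. *)
Definition weighted_prod (g : nat -> R -> R) : \bar R :=
  (\int[P]_w (V w * \prod_(i < n) g i (X i w))%:E)%E.

Lemma measurable_prod_comp (g : nat -> R -> R) (Q : pred nat) : (forall i, unit_fun (g i)) ->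
  measurable_fun [set: Om] (fun w => \prod_(i < n | Q i) g i (X i w)).
Proof.
move=> ug; under eq_fun do rewrite big_mkcond.
apply: measurable_prod => i _; case: (Q i) => //.
by apply: measurableT_comp => //; case: (ug i).
Qed.

Lemma weighted_prod_layer g j : (j < n)%N -> (forall i, unit_fun (g i)) ->
  (weighted_prod g = \int[mu]_(u in U) weighted_prod (replace g j (level (g j) u)))%E.
Proof.
move=> jn ug; rewrite /weighted_prod.
pose W w : R := V w * \prod_(i < n | i != j :> nat) g i (X i w).
have mW : measurable_fun [set: Om] W.
  apply: measurable_funM => //; exact: (measurable_prod_comp (fun i => i != j) ug).
have W0 w : 0 <= W w.
  by rewrite mulr_ge0//; have /andP[] := unit_prod n (fun i => i != j) (fun i => (ug i).2 (X i w)).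
transitivity (\int[P]_(w in setT) \int[mu]_(u in U) ((u < g j (X j w))%R%:R * W w)%:E)%E.
  apply: eq_integral => w _; under eq_integral do rewrite EFinM muleC.
  rewrite ge0_integralZl//; last 2 first.
  - apply: measurable_funTS; apply/measurable_EFinP; exact: measurable_lt_nat.
  - by rewrite lee_fin.
  rewrite integral_level; last exact: (ug j).2.
  rewrite -EFinM (bigD1 (Ordinal jn))//=; congr EFin.
  by rewrite /W mulrCA mulrC; congr (_ * _).
rewrite (@tonelli_on _ _ _ _ R P mu setT U measurableT mU (fun w u => (u < g j (X j w))%R%:R * W w)); last 2 first.
- apply: measurable_funM; last by apply: (measurableT_comp mW); exact: measurable_fst.
  apply: measurable_lt_nat; first exact: measurable_snd.
  apply: measurableT_comp; first by case: (ug j).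
  by apply: measurableT_comp => //; exact: measurable_fst.
- by move=> w u _ _; rewrite mulr_ge0.
apply: eq_integral => u _; apply: eq_integral => w _; congr EFin.
rewrite (bigD1 (Ordinal jn))//= /replace eqxx levelE mulrCA; congr (_ * _).
by rewrite /W; congr (_ * _); apply: eq_bigr => i ij; case: eqP ij => //= ij; rewrite -(inj_eq val_inj)/= ij eqxx.
Qed.

Lemma measurable_rectangle (A : nat -> set R) : (forall i, measurable (A i)) ->
  measurable (\bigcap_(i < n) [set w | A i (X i w)]).
Proof.
move=> mA; apply: bigcap_measurableType => i _.
by rewrite -[X in measurable X]setTI; exact: mX.
Qed.

Lemma weighted_prod_indic (A : nat -> set R) : (forall i, measurable (A i)) ->
  weighted_prod (fun i => \1_(A i)) =
  (\int[P]_(w in \bigcap_(i < n) [set w | A i (X i w)]) (V w)%:E)%E.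
Proof.
move=> mA; rewrite [RHS]integral_mkcond; apply: eq_integral => w _.
rewrite patchE; case: ifPn => [/set_mem Aw|Aw].
  rewrite big1 ?mulr1// => i _; rewrite indicE mem_set//; exact: (Aw _ (ltn_ord i)).
have [i nA] : exists i : 'I_n, ~ A i (X i w).
  apply: contrapT => h; move: Aw; rewrite notin_setE; apply => i /= ilt.
  by apply: contrapT => nA; apply: h; exists (Ordinal ilt).
by rewrite (bigD1 i)//= indicE memNset// mul0r mulr0.
Qed.

End weighted.

Lemma weighted_prod_ext d1 (Om1 : measurableType d1) (P1 : probability Om1 R)
    d2 (Om2 : measurableType d2) (P2 : probability Om2 R) n
    (X1 : nat -> Om1 -> R) (X2 : nat -> Om2 -> R) (V1 : Om1 -> R) (V2 : Om2 -> R) :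
  (forall i, measurable_fun setT (X1 i)) -> (forall i, measurable_fun setT (X2 i)) ->
  measurable_fun setT V1 -> measurable_fun setT V2 ->
  (forall w, 0 <= V1 w) -> (forall w, 0 <= V2 w) ->
  (forall A : nat -> set R, (forall i, measurable (A i)) ->
    \int[P1]_(w in \bigcap_(i < n) [set w | A i (X1 i w)]) (V1 w)%:E =
    \int[P2]_(w in \bigcap_(i < n) [set w | A i (X2 i w)]) (V2 w)%:E)%E ->
  forall g, (forall i, unit_fun (g i)) ->
  weighted_prod P1 n X1 V1 g = weighted_prod P2 n X2 V2 g.
Proof.
move=> mX1 mX2 mV1 mV2 V10 V20 h g ug.
(* Arguments of index at least [n] are reset to 1, the form [layer_ext] requires; they do not enter
   the product. *)
pose g' i : R -> R := if (i < n)%N then g i else cst 1.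
have W d (Om : measurableType d) (P : probability Om R) X V :
    weighted_prod P n X V g = weighted_prod P n X V g'.
  apply: eq_integral => w _; congr (_ * _)%:E; apply: eq_bigr => i _.
  by rewrite /g' ltn_ord.
rewrite !W; apply: (@layer_ext n).
- by move=> *; exact: weighted_prod_layer.
- by move=> *; exact: weighted_prod_layer.
- by move=> A mA; rewrite !weighted_prod_indic// h.
- move=> i; rewrite /g'; case: ifPn => // _; split; first exact: measurable_cst.
  by move=> x; rewrite /cst lexx ler01.
- by move=> i ni; rewrite /g' ltnNge ni.
Qed.

(** Both sides commute with the layer cake in each argument, the right one because it is linear in
    each expectation; on indicators the claim is the hypothesis. *)
Lemma independent_prod d (Om : measurableType d) (P : probability Om R) n
    (X : nat -> Om -> R) : (forall i, measurable_fun setT (X i)) ->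
  (forall A : nat -> set R, (forall i, measurable (A i)) ->
    P (\bigcap_(i < n) [set w | A i (X i w)]) = \prod_(i < n) P [set w | A i (X i w)])%E ->
  forall g : nat -> R -> R, (forall i, unit_fun (g i)) ->
  (\int[P]_w (\prod_(i < n) g i (X i w))%:E =
   (\prod_(i < n) fine (\int[P]_w (g i (X i w))%:E))%:E)%E.
Proof.
move=> mX h g ug.
pose Phi1 := weighted_prod P n X (cst 1).
pose E (f : R -> R) i : \bar R := (\int[P]_w (f (X i w))%:E)%E.
have mE f i : unit_fun f -> measurable_fun setT (fun w => (f (X i w))%:E).
  by move=> [mf _]; apply/measurable_EFinP; apply: measurableT_comp.
have E0 f i : unit_fun f -> (0 <= E f i)%E.
  by move=> [_ f01]; apply: integral_ge0 => w _; rewrite lee_fin; case/andP: (f01 (X i w)).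
have EE f i : unit_fun f -> E f i = (fine (E f i))%:E.
  move=> uf; rewrite fineK// ge0_fin_numE ?E0//.
  apply: (@le_lt_trans _ _ (\int[P]_w (cst 1 w))%E).
    apply: ge0_le_integral => //; first by move=> w _; rewrite lee_fin; case/andP: (uf.2 (X i w)).
      exact: mE.
    by move=> w _; rewrite lee_fin; case/andP: (uf.2 (X i w)).
  by rewrite integral_cst// mul1e (le_lt_trans (probability_le1 _ _))// ltry.
pose Phi2 (g : nat -> R -> R) : \bar R := (\prod_(i < n) fine (E (g i) i))%:E.
pose g' i : R -> R := if (i < n)%N then g i else cst 1.
suff : Phi1 g' = Phi2 g'.
  rewrite /Phi1 /Phi2 /weighted_prod => e; transitivity (Phi2 g'); last first.
    by congr EFin; apply: eq_bigr => i _; rewrite /g' ltn_ord.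
  rewrite /Phi2 -e; apply: eq_integral => w _; rewrite mul1r; congr EFin.
  by apply: eq_bigr => i _; rewrite /g' ltn_ord.
apply: (@layer_ext n).
- by move=> *; apply: weighted_prod_layer.
- move=> g1 j jn ug1; rewrite /Phi2 (bigD1 (Ordinal jn))//=.
  set c := \prod_(i < n | _) _.
  have c0 : 0 <= c by apply: prodr_ge0 => i _; exact/fine_ge0/E0.
  have uL u : unit_fun (level (g1 j) u) by exact: (unit_fun_indic (measurable_level_set u (ug1 j))).
  transitivity (\int[mu]_(u in U) (c%:E * E (level (g1 j) u) j))%E; last first.
    apply: eq_integral => u _; rewrite (bigD1 (Ordinal jn))//= /replace eqxx EE// -EFinM mulrC.
    congr (_ * _)%:E; apply: eq_bigr => i ij.
    by rewrite (_ : (i == j :> nat) = false)//; exact: (negbTE ij).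
  have tE : E (g1 j) j = (\int[mu]_(u in U) E (level (g1 j) u) j)%E.
    rewrite /E.
    transitivity (weighted_prod P 1%N (fun=> X j) (cst 1) (fun=> g1 j)).
      by apply: eq_integral => w _; rewrite big_ord1 mul1r.
    rewrite (@weighted_prod_layer _ _ P 1%N (fun=> X j) (cst 1) (fun=> mX j) (measurable_cst _) (fun=> ler01) (fun=> g1 j) 0%N isT (fun=> ug1 j)).
    apply: eq_integral => u _; apply: eq_integral => w _.
    by rewrite big_ord1 mul1r.
  rewrite ge0_integralZl//.
  + by rewrite -tE EE// -EFinM mulrC.
  + apply: (@measurable_integral_param _ _ _ _ R P U setT mU measurableT (fun u w => level (g1 j) u (X j w))).
      under eq_fun do rewrite levelE; apply: measurable_lt_nat; first exact: measurable_fst.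
      apply: measurableT_comp; first by case: (ug1 j).
      by apply: measurableT_comp => //; exact: measurable_snd.
    by move=> u w _ _; rewrite levelE.
  + by move=> u _; exact: E0.
- move=> A mA; rewrite /Phi1 weighted_prod_indic//.
  transitivity (\int[P]_(w in \bigcap_(i < n) [set w | A i (X i w)]) (cst 1 w))%E; first by [].
  rewrite integral_cst; last exact: measurable_rectangle.
  rewrite mul1e [LHS]h// /Phi2 -prodEFin; apply: eq_bigr => i _.
  rewrite -EE; last exact: unit_fun_indic.
  rewrite -[X in P X]setIT -integral_indic//.
  by rewrite -[X in measurable X]setTI; exact: mX.
- move=> i; rewrite /g'; case: ifPn => // _; split; first exact: measurable_cst.
  by move=> x; rewrite /cst lexx ler01.
- by move=> i ni; rewrite /g' ltnNge ni.
Qed.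

End layers.

(** * Lower and upper limits, bounded convergence and measurability of limits *)

Section limits.
Context d (T : measurableType d) (R : realType).

Lemma limn_einf_esup_cvg (u : (\bar R)^nat) (l : \bar R) :
  limn_einf u = l -> limn_esup u = l -> u @ \oo --> l.
Proof.
move=> ul vl; apply: (@squeeze_cvge _ _ _ _ (einfs u) _ (esups u)).
- apply: nearW => n; apply/andP; split.
  + by apply: ereal_inf_lbound; exists n => //=.
  + by apply: ereal_sup_ubound; exists n => //=.
- by rewrite -ul limn_einf_lim; exact: is_cvg_einfs.
- by rewrite -vl limn_esup_lim; exact: is_cvg_esups.
Qed.

Lemma limn_einf_ge (u : (\bar R)^nat) (l : \bar R) :
  (\forall n \near \oo, (l <= u n)%E) -> (l <= limn_einf u)%E.
Proof.
move=> [N _ h]; rewrite limn_einf_lim (cvg_lim _ (@cvg_einfs_sup _ u))//.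
apply: (@le_trans _ _ (einfs u N)); last by apply: ereal_sup_ubound; exists N.
by apply: le_ereal_inf_tmp => _ [n /= Nn <-]; exact: h.
Qed.

Lemma limn_einf_le (u : (\bar R)^nat) (l : \bar R) :
  (forall n, u n <= l)%E -> (limn_einf u <= l)%E.
Proof.
move=> h; rewrite limn_einf_lim; apply: lime_le; first exact: is_cvg_einfs.
apply: nearW => n; apply: le_trans (h n).
by apply: ereal_inf_lbound; exists n => /=.
Qed.

(** The bounds of rank [K] hold only from a rank [n] depending on [K], so [K] is fixed before [n]
    grows. *)
Lemma cvg_double_squeeze (L U X : nat -> R) (l : R) :
  (forall K, \forall n \near \oo, L K <= X n <= U K) ->
  L @ \oo --> l -> U @ \oo --> l -> X @ \oo --> l.
Proof.
move=> h Ll Ul; apply/cvgrPdist_le => e e0.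
have [K [KL KU]] : exists K, `|l - L K| <= e /\ `|l - U K| <= e.
  apply: (@filter_ex _ \oo); move/cvgrPdist_le : Ll => /(_ _ e0).
  by move/cvgrPdist_le : Ul => /(_ _ e0); apply: filterS2.
apply: filterS (h K) => n /andP[LX XU].
by move: KL KU; rewrite !ler_norml => /andP[? ?] /andP[? ?]; apply/andP; split; lra.
Qed.

Lemma bounded_convergence (P : probability T R) (f_ : nat -> T -> R) (f : T -> R) (M : R) :
  (forall n, measurable_fun setT (f_ n)) -> measurable_fun setT f ->
  {ae P, forall x, f_ ^~ x @ \oo --> f x} -> (forall n x, `|f_ n x| <= M) ->
  (\int[P]_x (f_ n x)%:E @[n --> \oo] --> \int[P]_x (f x)%:E)%E.
Proof.
move=> mf_ mf ff fM.
have m1 n : measurable_fun setT (fun x => (f_ n x)%:E) by exact/measurable_EFinP.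
have m2 : measurable_fun setT (fun x => (f x)%:E) by exact/measurable_EFinP.
have h1 : {ae P, forall x, setT x -> (f_ n x)%:E @[n --> \oo] --> (f x)%:E}.
  by apply: filterS ff => x h _; apply: cvg_EFin => //; exact: nearW.
have h2 : P.-integrable setT (cst M%:E) by exact: finite_measure_integrable_cst.
have h3 : {ae P, forall x n, setT x -> (`|(f_ n x)%:E| <= (cst M%:E) x)%E}.
  by apply: aeW => x n _; rewrite /= lee_fin.
by have [_ _] := dominated_convergence measurableT m1 m2 h1 h2 h3.
Qed.

(** [limn] takes the default value [point] where the sequence diverges. The convergence set is
    measurable, being the set where lower and upper limits agree and are finite. *)
Lemma measurable_limn (h : nat -> T -> R) : (forall n, measurable_fun setT (h n)) ->
  measurable_fun setT (fun x => limn (h ^~ x)).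
Proof.
move=> mh.
pose U x : \bar R := limn_esup (fun n => (h n x)%:E).
pose V x : \bar R := limn_einf (fun n => (h n x)%:E).
have mU : measurable_fun setT U.
  by apply: measurable_fun_limn_esup => n; exact/measurable_EFinP.
have mV : measurable_fun setT V.
  rewrite (_ : V = fun x => (- limn_esup (fun n => (- h n x)%:E))%E).
    apply: measurableT_comp => //; apply: measurable_fun_limn_esup => n.
    by apply/measurable_EFinP; exact: measurableT_comp.
  apply/funext => x; rewrite /V -[LHS]oppeK; congr (- _)%E.
  exact/esym/(limn_esupN (fun n => (h n x)%:E)).
have cE x : cvgn (h ^~ x) -> V x = (limn (h ^~ x))%:E /\ U x = (limn (h ^~ x))%:E.
  move=> c; have := @cvg_limn_einf_sup R (fun n => (h n x)%:E) (limn (h ^~ x))%:E.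
  by case; first by apply: cvg_EFin => //; exact: nearW.
have cE' x : V x = U x -> U x \is a fin_num -> cvgn (h ^~ x).
  move=> VU Uf; apply/cvg_ex; exists (fine (U x)).
  have UE := esym (fineK Uf).
  have := @limn_einf_esup_cvg (fun n => (h n x)%:E) (fine (U x))%:E (etrans VU UE) UE.
  exact: (@fine_cvg _ _ \oo _ (fun n => (h n x)%:E)).
pose C := [set x | V x = U x] `&` [set x | U x \is a fin_num].
have mC : measurable C.
  apply: measurableI.
  - by rewrite -[X in measurable X]setTI; exact: measurable_eqe.
  - by rewrite -[X in measurable X]setTI; exact: emeasurable_fin_num.
rewrite (_ : (fun x => _) = fun x => if x \in C then fine (U x) else point).
  apply: measurable_fun_ifT => //.
  - apply: (measurable_fun_bool true); rewrite setTI (_ : _ @^-1` _ = C)//.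
    by apply/seteqP; split => x /=; [move/set_mem|move/mem_set].
  - exact: measurableT_comp.
apply/funext => x; case: ifPn => [/set_mem[VU Uf]|].
  by have [_ ->] := cE _ (cE' _ VU Uf).
rewrite notin_setE => nC; apply: dvgP => c; apply: nC.
by have [v u] := cE _ c; split => /=; rewrite ?u ?v.
Qed.

Lemma measurable_total (J : nat -> T -> R) : (forall n, measurable_fun setT (J n)) ->
  measurable_fun setT (fun x => Defs.total (J ^~ x)).
Proof.
move=> mJ; apply: measurable_limn => n; rewrite /series/=.
by apply: measurable_sum.
Qed.

End limits.

(** * The contribution of one randomly marked jump *)

Section exponential_mixture.
Variables (R : realType) (a b p q : R).
Hypotheses (a0 : 0 <= a) (ab : a <= b) (p0 : 0 <= p) (q0 : 0 <= q) (pq : q + p = 1).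

(** The mean discount of a jump of size [x], which is marked with probability [p] and then has rate
    [b], and otherwise rate [a]. *)
Definition expmix (x : R) : R := q * expR (- (a * x)) + p * expR (- (b * x)).

Lemma expmix0 : expmix 0 = 1.
Proof. by rewrite /expmix !mulr0 oppr0 expR0 !mulr1. Qed.

Lemma expmix_ge0 x : 0 <= expmix x.
Proof. by rewrite addr_ge0// mulr_ge0// expR_ge0. Qed.

Lemma expmix_anti x y : x <= y -> expmix y <= expmix x.
Proof.
move=> xy; apply: lerD; apply: ler_wpM2l => //; rewrite ler_expR lerN2 ler_wpM2l//.
exact: le_trans ab.
Qed.

Lemma expmix_superM x y : 0 <= y -> expmix x * expR (- (b * y)) <= expmix (x + y).
Proof.
move=> y0; rewrite /expmix mulrDl; apply: lerD; rewrite -mulrA ler_wpM2l// -expRD ler_expR.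
  by rewrite mulrDr opprD lerD2l lerN2 ler_wpM2r.
by rewrite mulrDr opprD.
Qed.

Lemma unit_fun_expmix : unit_fun (fun x => expmix (Num.max 0 x)).
Proof.
split.
  have mm : measurable_fun [set: R] (fun x => Num.max 0 x : R).
    by apply: measurable_maxr => //; exact: measurable_id.
  by rewrite /expmix; apply: measurable_funD; apply: measurable_funM => //;
    apply: measurableT_comp => //; apply: measurableT_comp => //; apply: measurable_funM.
move=> x; rewrite expmix_ge0/= -expmix0; apply: expmix_anti.
by rewrite le_max lexx.
Qed.

(** The power lies between [e^(-m)] and [e^(-m + C/(n+1))]: below by convexity of the exponential,
    above by [e^(-x) <= 1 - x + x^2] for [x >= 0]. *)
Lemma cvg_mix_expR_pow (A B : R) : 0 <= A -> 0 <= B ->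
  (q * expR (- (n.+1%:R^-1 * A)) + p * expR (- (n.+1%:R^-1 * B))) ^+ n.+1 @[n --> \oo]
   --> expR (- (q * A + p * B)).
Proof.
move=> A0 B0; set m := q * A + p * B.
pose C := q * A ^+ 2 + p * B ^+ 2.
have le1 (x : R) : 0 <= x -> expR (- x) <= 1 - x + x ^+ 2.
  move=> x0; have x1 : 0 < 1 + x by rewrite ltr_wpDr.
  rewrite expRN; apply: (@le_trans _ _ (1 + x)^-1).
    by rewrite lef_pV2 ?posrE ?expR_gt0// expR_ge1Dx.
  rewrite -[leLHS]mul1r ler_pdivrMr// -subr_ge0.
  have -> : (1 - x + x ^+ 2) * (1 + x) - 1 = x ^+ 3 by ring.
  exact: exprn_ge0.
apply: (@squeeze_cvgr _ _ _ _ (cst (expR (- m))) (fun n => expR (- m + n.+1%:R^-1 * C))).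
- apply: nearW => n; have n0 : 0 <= (n.+1%:R^-1 : R) by rewrite invr_ge0.
  set e : R := n.+1%:R^-1 in n0 *.
  have ne : n.+1%:R * e = 1 by rewrite divff// pnatr_eq0.
  apply/andP; split.
    rewrite /cst; have -> : - m = n.+1%:R * (- (e * m)) by rewrite mulrN mulrA ne mul1r.
    rewrite expRM_natl; apply: lerXn2r; rewrite ?nnegrE ?expR_ge0//.
      by rewrite addr_ge0// mulr_ge0// expR_ge0.
    have h (x : R) : expR (- (e * m)) * (1 + (- (e * x) + e * m)) <= expR (- (e * x)).
      have -> : expR (- (e * x)) = expR (- (e * m)) * expR (- (e * x) + e * m).
        by rewrite -expRD; congr expR; ring.
      by rewrite ler_wpM2l ?expR_ge0// expR_ge1Dx.
    apply: le_trans (lerD (ler_wpM2l q0 (h A)) (ler_wpM2l p0 (h B))).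
    rewrite le_eqVlt; apply/orP; left; apply/eqP; rewrite /m.
    have -> : q = 1 - p by rewrite -pq addrK.
    by ring.
  have -> : - m + e * C = n.+1%:R * (e * (- m + e * C)) by rewrite mulrA ne mul1r.
  rewrite expRM_natl; apply: lerXn2r; rewrite ?nnegrE ?expR_ge0//.
    by rewrite addr_ge0// mulr_ge0// expR_ge0.
  apply: le_trans (expR_ge1Dx _).
  apply: le_trans (lerD (ler_wpM2l q0 (le1 _ (mulr_ge0 n0 A0))) (ler_wpM2l p0 (le1 _ (mulr_ge0 n0 B0)))) _.
  rewrite le_eqVlt; apply/orP; left; apply/eqP; rewrite /m /C.
  have -> : q = 1 - p by rewrite -pq addrK.
  by ring.
- exact: cvg_cst.
- rewrite -[in X in _ --> X](addr0 (- m)) -[in X in _ --> X](mul0r C).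
  apply: (@cvg_comp _ _ _ (fun n => - m + n.+1%:R^-1 * C) expR); last exact: continuous_expR.
  apply: cvgD; first exact: cvg_cst.
  by apply: cvgM; [exact: (@cvg_harmonic R)|exact: cvg_cst].
Qed.

End exponential_mixture.

(** * Functionals of the jumps of a stable subordinator *)

Section subordinator.
Variables (R : realType) (al : R) (d : measure_display) (Om : measurableType d)
  (P : probability Om R) (xi : R -> {RV P >-> R}) (J : nat -> {RV P >-> R}).
Hypotheses (al0 : 0 < al) (al1 : al < 1).
Hypothesis xiS : stable_subordinator al xi.
Hypothesis JR : {ae P, forall w, ranked_jumps (xi ^~ w) (J ^~ w)}.
Local Notation mu := (@lebesgue_measure R).

Definition regular_path w := [/\ xi 0 w = 0,
  forall s t, 0 <= s -> s <= t -> t <= 1 -> xi s w <= xi t w,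
  forall t, 0 <= t < 1 -> xi s w @[s --> t^'+] --> xi t w &
  ranked_jumps (xi ^~ w) (J ^~ w)].

Lemma regular_path_ae : {ae P, forall w, regular_path w}.
Proof. by case: xiS => h _ _; apply: filterS2 h JR => w [? ? ?] ?; split. Qed.

Let inc (n i : nat) (w : Om) : R := increment (xi ^~ w) n i.

Let minc n i : measurable_fun setT (inc n i).
Proof. by rewrite /inc /increment; apply: measurable_funB. Qed.

Lemma increment_laplace n i (s : R) : (i < n.+1)%N -> 0 <= s ->
  (\int[P]_w (expR (- (s * increment (xi ^~ w) n i)))%:E =
   (expR (- (n.+1%:R^-1 * s `^ al)))%:E)%E.
Proof.
move=> ni s0; have [_ _ h] := xiS.
by rewrite h ?gridS ?grid_ge0 ?grid_le// grid_le1.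
Qed.

Lemma regular_increment_ge0 w n i : regular_path w -> (i < n.+1)%N -> 0 <= inc n i w.
Proof. by move=> [_ h _ _] ni; have := increment_ge0 h (Ordinal ni). Qed.

Lemma increment_independent n (g : nat -> R -> R) : (forall i, unit_fun (g i)) ->
  (\int[P]_w (\prod_(i < n.+1) g i (inc n i w))%:E =
   (\prod_(i < n.+1) fine (\int[P]_w (g i (inc n i w))%:E))%:E)%E.
Proof.
move=> ug; apply: independent_prod => // A mA.
have [_ h _] := xiS.
apply: (h n.+1 (grid R n) A) => //.
- exact: grid_ge0.
- by move=> i _; exact: grid_le.
- by rewrite grid_le1.
Qed.

Lemma integral_expmix_increment (a b p q : R) n i : 0 <= a -> 0 <= b -> 0 <= p -> 0 <= q ->
  (i < n.+1)%N ->
  (\int[P]_w (expmix a b p q (Num.max 0 (inc n i w)))%:E =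
   (q * expR (- (n.+1%:R^-1 * a `^ al)) + p * expR (- (n.+1%:R^-1 * b `^ al)))%:E)%E.
Proof.
move=> a0 b0 p0 q0 ni.
have me (c : R) : measurable_fun setT (fun w => (expR (- (c * inc n i w)))%:E).
  apply/measurable_EFinP; apply: measurableT_comp => //; apply: measurableT_comp => //.
  exact: measurable_funM.
have mm : measurable_fun setT (fun w => Num.max 0 (inc n i w)).
  exact: measurable_maxr.
transitivity (\int[P]_w (q%:E * (expR (- (a * inc n i w)))%:E + p%:E * (expR (- (b * inc n i w)))%:E))%E.
  apply: ae_eq_integral => //.
  - apply/measurable_EFinP; rewrite /expmix; apply: measurable_funD; apply: measurable_funM => //;
    apply: measurableT_comp => //; apply: measurableT_comp => //; exact: measurable_funM.
  - by apply: emeasurable_funD; apply: emeasurable_funM.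
  - apply: filterS regular_path_ae => w gw _.
    by rewrite max_r ?regular_increment_ge0.
rewrite ge0_integralD//; last 4 first.
- by move=> w _; rewrite mule_ge0// lee_fin// expR_ge0.
- exact: emeasurable_funM.
- by move=> w _; rewrite mule_ge0// lee_fin// expR_ge0.
- exact: emeasurable_funM.
by rewrite !ge0_integralZl// !increment_laplace.
Qed.

Let T w : R := Defs.total (J ^~ w).

Lemma measurable_jump_total : measurable_fun setT T.
Proof. exact: measurable_total. Qed.

Lemma regular_total w : regular_path w ->
  [/\ series (J ^~ w) @ \oo --> T w, forall K, \sum_(k < K) J k w <= T w, T w <= xi 1 w &
      forall k, 0 < J k w].
Proof.
move=> [h0 hm hr [_ [tau [tinj trange JE]]]].
have Jpos k : 0 < J k w by exact: (ranked_gt0 hm trange JE).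
have ub K : \sum_(k < K) J k w <= xi 1 w by exact: (sum_ranked_le h0 hm tinj trange JE).
have nd : nondecreasing_seq (series (J ^~ w)).
  by apply/nondecreasing_seqP => n; rewrite seriesSr/= lerDl ltW.
have cv : cvgn (series (J ^~ w)).
  apply: nondecreasing_is_cvgn => //; exists (xi 1 w) => _ [n _ <-].
  by rewrite /series/= big_mkord.
split => //.
- by move=> K; rewrite -(big_mkord xpredT (J ^~ w)); exact: nondecreasing_cvgn_le.
- by apply: limr_le => //; apply: nearW => n; rewrite /series/= big_mkord.
Qed.

Lemma total_gt0 w : regular_path w -> 0 < T w.
Proof.
move=> gw; have [_ h _ pos] := regular_total gw.
by apply: lt_le_trans (h 1%N); rewrite big_ord1.
Qed.

(* Truncating the increments at [1/s] loses at most the jumps, while the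
   truncated increments have a total mean of order [s^(al-1)]. *)
Lemma total_deficit_le (s : R) : 0 < s ->
  (\int[P]_w (Num.max 0 (xi 1 w - T w))%:E <= (2 * s `^ (al - 1))%:E)%E.
Proof.
move=> s0.
have mm n i : measurable_fun setT (fun w => Num.min (Num.max 0 (inc n i w)) s^-1).
  by apply: measurable_minr => //; apply: measurable_maxr.
pose S n w : \bar R := (\sum_(i < n.+1) Num.min (Num.max 0 (inc n i w)) s^-1)%:E.
have mS n : measurable_fun setT (S n).
  by apply/measurable_EFinP; apply: measurable_sum.
have m0 n i w : 0 <= Num.min (Num.max 0 (inc n i w)) s^-1.
  by rewrite le_min le_max lexx/= invr_ge0 ltW.
have S0 n w : (0 <= S n w)%E by rewrite lee_fin sumr_ge0.
(* The pathwise bound holds from a rank that depends on [w], so it reaches the expectation through a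
   lower limit and Fatou's lemma. *)
apply: (@le_trans _ _ (\int[P]_w limn_einf (S ^~ w))%E).
  apply: ae_ge0_le_integral => //.
  - by move=> w _; rewrite lee_fin le_max lexx.
  - apply/measurable_EFinP; apply: measurable_maxr => //; apply: measurable_funB => //.
    exact: measurable_jump_total.
  - by move=> w _; apply: limn_einf_ge; exact: nearW.
  - rewrite (_ : (fun _ => _) = fun w => (- limn_esup (fun n => - S n w))%E).
      apply: measurableT_comp => //; apply: measurable_fun_limn_esup => n.
      exact: measurableT_comp.
    apply/funext => w; rewrite -[LHS]oppeK; congr (- _)%E.
    exact/esym/(limn_esupN (S ^~ w)).
  - apply: filterS regular_path_ae => w gw _.
    have [h0 hm hr [_ [tau [tinj trange JE]]]] := gw.
    have [_ hT TX _] := regular_total gw.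
    apply: limn_einf_ge.
    have s'0 : 0 < s^-1 by rewrite invr_gt0.
    have := sum_min_increment_near h0 hm hr trange JE s'0.
    apply: filterS => n [K hK]; rewrite /S lee_fin max_r ?subr_ge0//.
    apply: (le_trans _ (le_trans hK _)); first by rewrite lerB.
    by apply: ler_sum => i _; rewrite /inc max_r// regular_increment_ge0.
apply: (le_trans (fatou _ _ _ _)) => //.
apply: limn_einf_le => n.
rewrite /S; under eq_integral do rewrite -sumEFin.
rewrite ge0_integral_sum//; last 2 first.
- by move=> i; apply/measurable_EFinP.
- by move=> i w _; rewrite lee_fin.
have bnd i : (i < n.+1)%N ->
    (\int[P]_w (Num.min (Num.max 0 (inc n i w)) s^-1)%:E <= (n.+1%:R^-1 * (2 * s `^ (al - 1)))%:E)%E.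
  move=> ni.
  pose g w : R := expmix s s 0 1 (Num.max 0 (inc n i w)).
  have [mu1 g01] := @unit_fun_expmix R s s 0 1 (ltW s0) (lexx s) (lexx 0) ler01 (addr0 1).
  have mg : measurable_fun setT g by exact: (measurableT_comp mu1 (minc n i)).
  have s2 : 0 <= 2 / s by rewrite divr_ge0// ltW.
  have gE : (\int[P]_w (g w)%:E = (expR (- (n.+1%:R^-1 * s `^ al)))%:E)%E.
    by rewrite integral_expmix_increment ?(ltW s0)// mul1r mul0r addr0.
  (* The integrated form of [min (y, 1/s) <= (2/s) (1 - e^(-s y))], with the exponential on the left
     to keep integrands nonnegative; it comes from [1 - e^(-z) >= z / (1 + z)]. *)
  have : (\int[P]_w ((Num.min (Num.max 0 (inc n i w)) s^-1)%:E + (2 / s)%:E * (g w)%:E) <= (2 / s)%:E)%E.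
    apply: (@le_trans _ _ (\int[P]_w (cst (2 / s)%:E w))%E).
      apply: ge0_le_integral => //.
      - by move=> w _; rewrite adde_ge0// ?lee_fin// mulr_ge0// expmix_ge0.
      - by apply: emeasurable_funD; [exact/measurable_EFinP|apply: emeasurable_funM => //; exact/measurable_EFinP].
      - move=> w _; rewrite -EFinM -EFinD lee_fin /g /expmix mul0r addr0 mul1r.
        set y := Num.max 0 _; have y0 : 0 <= y by rewrite le_max lexx.
        have sy : 0 <= s * y by rewrite mulr_ge0// ltW.
        have sy1 : 0 < 1 + s * y by rewrite ltr_wpDr.
        have e : expR (- (s * y)) <= (1 + s * y)^-1.
          by rewrite expRN lef_pV2 ?posrE ?expR_gt0// expR_ge1Dx.
        apply: (@le_trans _ _ (Num.min y s^-1 + 2 / s * (1 + s * y)^-1)).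
          by rewrite lerD2l ler_wpM2l.
        rewrite -lerBrDr -[X in X - _]mulr1 -mulrBr.
        have -> : 2 / s * (1 - (1 + s * y)^-1) = 2 * y / (1 + s * y).
          by field; rewrite !gt_eqF.
        rewrite ge_min !ler_pdivlMr//; apply/orP.
        have [h|h] := leP (s * y) 1; [left|right].
          by rewrite mulrC ler_wpM2r//; lra.
        rewrite -(ler_pM2l s0) mulrA divff ?gt_eqF// mul1r; lra.
    by rewrite integral_cst// [X in (_ * X)%E]probability_setT mule1.
  rewrite ge0_integralD//; last 4 first.
  - by move=> w _; rewrite lee_fin.
  - exact/measurable_EFinP.
  - by move=> w _; rewrite mule_ge0// lee_fin// expmix_ge0.
  - by apply: emeasurable_funM => //; exact/measurable_EFinP.
  rewrite ge0_integralZl//; last 2 first.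
  - exact/measurable_EFinP.
  - by move=> w _; rewrite lee_fin expmix_ge0.
  rewrite gE -EFinM -leeBrDr// -EFinB => h; apply: (le_trans h); rewrite lee_fin.
  rewrite -[X in X - _]mulr1 -mulrBr.
  have -> : n.+1%:R^-1 * (2 * s `^ (al - 1)) = 2 / s * (n.+1%:R^-1 * s `^ al).
    by rewrite powRD ?(gt_eqF s0) ?implybT// powR_inv1 ?(ltW s0)//; ring.
  by rewrite ler_wpM2l// lerBlDr -lerBlDl; exact: (expR_ge1Dx (- _)).
apply: (@le_trans _ _ (\sum_(i < n.+1) (n.+1%:R^-1 * (2 * s `^ (al - 1)))%:E)%E).
  by apply: lee_sum => i _; exact: bnd.
rewrite sumEFin lee_fin sumr_const card_ord -[leLHS]mulr_natl mulrA divff ?mul1r// pnatr_eq0.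
Qed.

(** The subordinator is the sum of its jumps: since [al - 1 < 0], the bound on the expected deficit
    vanishes as [s] grows. *)
Lemma total_ae : {ae P, forall w, T w = xi 1 w}.
Proof.
pose D w : R := Num.max 0 (xi 1 w - T w).
have mD : measurable_fun setT (fun w => (D w)%:E).
  apply/measurable_EFinP; apply: measurable_maxr => //; apply: measurable_funB => //.
  exact: measurable_jump_total.
have D0 w : (0 <= (D w)%:E)%E by rewrite lee_fin le_max lexx.
have : (\int[P]_w `|(D w)%:E| = 0)%E.
  under eq_integral do rewrite gee0_abs//.
  apply/eqP; rewrite eq_le integral_ge0 ?andbT//; apply/lee_addgt0Pr => e e0.
  have ne0 : al - 1 != 0 by rewrite lt_eqF// subr_lt0.
  have e2 : 0 < e / 2 by rewrite divr_gt0.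
  (* This [s] makes the bound [2 s^(al-1)] equal to [e]. *)
  have h := @total_deficit_le ((e / 2) `^ (al - 1)^-1) (powR_gt0 _ e2).
  rewrite add0e (le_trans h)// lee_fin -powRrM mulVf// powRr1 ?(ltW e2)//.
  by rewrite mulrC divfK.
move/(ae_eq_integral_abs P measurableT mD) => h.
apply: filterS2 h regular_path_ae => w /(_ I) []/eqP; rewrite /D => h gw.
have [_ _ TX _] := regular_total gw.
by move: h; rewrite max_r ?subr_ge0// subr_eq0 => /eqP.
Qed.

Variables a b p q : R.
Hypotheses (a0 : 0 <= a) (ab : a <= b) (p0 : 0 <= p) (q0 : 0 <= q) (pq : q + p = 1).
Let f := expmix a b p q.
Let W w : R := limn (fun K => \prod_(k < K) f (Num.max 0 (J k w))).

Let uf : unit_fun (fun x => f (Num.max 0 x)). Proof. exact: unit_fun_expmix. Qed.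

Let mY K : measurable_fun setT (fun w => \prod_(k < K) f (Num.max 0 (J k w))).
Proof. by apply: measurable_prod => k _; apply: (measurableT_comp uf.1). Qed.

Let cvg_jump_prod w : (fun K => \prod_(k < K) f (Num.max 0 (J k w))) @ \oo --> W w.
Proof.
apply: nonincreasing_is_cvgn.
  apply/nonincreasing_seqP => n; rewrite big_ord_recr/=.
  rewrite ler_piMr//; first by apply: prodr_ge0 => k _; case/andP: (uf.2 (J k w)).
  by case/andP: (uf.2 (J n w)).
by exists 0 => _ [n _ <-]; apply: prodr_ge0 => k _; case/andP: (uf.2 (J k w)).
Qed.

Let deficit w : regular_path w -> T w - \sum_(k < K) J k w @[K --> \oo] --> (0 : R).
Proof.
move=> /regular_total[cT _ _ _].
suff : T w - \sum_(k < K) J k w @[K --> \oo] --> T w - T w by rewrite subrr.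
apply: cvgB; first exact: cvg_cst.
apply: cvg_trans cT; apply: near_eq_cvg; apply: nearW => K.
by rewrite /series/= big_mkord.
Qed.

Let deficit_expR (c : R) w : regular_path w ->
  expR (- (c * (T w - \sum_(k < K) J k w))) @[K --> \oo] --> (1 : R).
Proof.
move=> gw; rewrite -expR0 -[X in expR X]oppr0 -[X in - X](mulr0 c).
apply: (@cvg_comp _ _ _ (fun K => - (c * (T w - \sum_(k < K) J k w))) expR); last exact: continuous_expR.
by apply: cvgN; apply: cvgM; [exact: cvg_cst|exact: deficit].
Qed.

(** For each [K] the product over increments is eventually trapped by [prod_increment_near]. The gap
    factor tends to 1 because the jumps exhaust [xi 1]. *)
Let cvg_increment_prod w : regular_path w -> T w = xi 1 w ->
  \prod_(i < n.+1) f (Num.max 0 (inc n i w)) @[n --> \oo] --> W w.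
Proof.
move=> gw TX; have [h0 hm hr [_ [tau [tinj trange JE]]]] := gw.
have [_ _ _ Jpos] := regular_total gw.
apply: (@cvg_double_squeeze R
  (fun K => (\prod_(k < K) f (Num.max 0 (J k w))) * expR (- (b * (T w - \sum_(k < K) J k w))))
  (fun K => \prod_(k < K) f (Num.max 0 (J k w)))).
- move=> K.
  have f0 : f 0 = 1 by exact: expmix0.
  have fd u v : 0 <= u -> u <= v -> 0 <= f v <= f u.
    by move=> _ uv; rewrite expmix_ge0//= expmix_anti.
  have fe u v : 0 <= u -> 0 <= v -> f u * expR (- (b * v)) <= f (u + v).
    by move=> _; exact: expmix_superM.
  have := prod_increment_near h0 hm tinj trange JE K f0 fd fe.
  apply: filterS => n; rewrite TX.
  have -> : \prod_(k < K) f (Num.max 0 (J k w)) = \prod_(k < K) f (J k w).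
    by apply: eq_bigr => k _; rewrite max_r// ltW.
  suff -> : \prod_(i < n.+1) f (Num.max 0 (inc n i w)) = \prod_(i < n.+1) f (increment (xi ^~ w) n i) by [].
  by apply: eq_bigr => i _; rewrite max_r// regular_increment_ge0.
- rewrite -[X in _ --> X]mulr1; apply: cvgM; first exact: cvg_jump_prod.
  exact: deficit_expR.
- exact: cvg_jump_prod.
Qed.

Let unit_norm (x : R) : 0 <= x <= 1 -> `|x| <= 1.
Proof. by move=> /andP[x0 x1]; rewrite ger0_norm. Qed.

(** For each grid, independence makes the expectation an [n.+1]-th power, whose limit is
    [cvg_mix_expR_pow]; bounded convergence passes to the jumps. *)
Let integral_W : (\int[P]_w (W w)%:E = (expR (- (q * a `^ al + p * b `^ al)))%:E)%E.
Proof.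
have mW : measurable_fun setT W by exact: (measurable_limn mY).
have b0 := le_trans a0 ab.
have c1 : (\int[P]_w (\prod_(i < n.+1) f (Num.max 0 (inc n i w)))%:E @[n --> \oo] --> \int[P]_w (W w)%:E)%E.
  apply: (@bounded_convergence _ _ _ P _ _ 1) => //.
  - by move=> n; apply: measurable_prod => i _; apply: (measurableT_comp uf.1).
  - by apply: filterS2 regular_path_ae total_ae => w; exact: cvg_increment_prod.
  - move=> n w; apply: unit_norm.
    exact: (@unit_prod R n.+1 (fun i => f (Num.max 0 (inc n i w))) xpredT (fun i => uf.2 _)).
apply: (cvg_unique _ c1) => //.
rewrite (_ : (fun n => _) = (fun n =>
   ((q * expR (- (n.+1%:R^-1 * a `^ al)) + p * expR (- (n.+1%:R^-1 * b `^ al))) ^+ n.+1)%:E)).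
  by apply: cvg_EFin; [exact: nearW|apply: cvg_mix_expR_pow => //; exact: powR_ge0].
apply/funext => n; rewrite (@increment_independent n (fun=> fun x => f (Num.max 0 x)))//.
congr EFin; under eq_bigr do rewrite integral_expmix_increment//=.
by rewrite prodr_const card_ord.
Qed.

(** Pulling [e^(-a J)] out of each factor replaces the sum of the first [K] jumps by [T], at the
    price of [e^(-a (T - sum))], which tends to 1. *)
Lemma cvg_integral_jump_prod :
  (\int[P]_w (expR (- (a * Num.max 0 (T w))) *
      \prod_(k < K) (q + p * expR (- ((b - a) * Num.max 0 (J k w)))))%:E
    @[K --> \oo] --> (expR (- (q * a `^ al + p * b `^ al)))%:E)%E.
Proof.
have ba : 0 <= b - a by rewrite subr_ge0.
rewrite -integral_W; apply: (@bounded_convergence _ _ _ P _ _ 1).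
- move=> K; apply: measurable_funM.
    apply: measurableT_comp => //; apply: measurableT_comp => //; apply: measurable_funM => //.
    by apply: measurable_maxr => //; exact: measurable_jump_total.
  apply: measurable_prod => k _; apply: measurable_funD => //; apply: measurable_funM => //.
  apply: measurableT_comp => //; apply: measurableT_comp => //; apply: measurable_funM => //.
  exact: measurable_maxr.
- exact: (measurable_limn mY).
- apply: filterS regular_path_ae => w gw.
  have [_ _ _ Jpos] := regular_total gw.
  have E K : expR (- (a * Num.max 0 (T w))) * \prod_(k < K) (q + p * expR (- ((b - a) * Num.max 0 (J k w)))) =
     expR (- (a * (T w - \sum_(k < K) J k w))) * \prod_(k < K) f (Num.max 0 (J k w)).
    rewrite max_r ?ltW ?total_gt0//.
    have -> : expR (- (a * (T w - \sum_(k < K) J k w))) =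
        expR (- (a * T w)) * \prod_(k < K) expR (a * J k w).
      by rewrite -expR_sum -expRD; congr expR; rewrite -mulr_sumr; ring.
    rewrite -mulrA -big_split/=; congr (_ * _); apply: eq_bigr => k _.
    rewrite max_r ?ltW// /f /expmix mulrDr mulrCA -expRD subrr expR0 mulr1.
    by rewrite mulrCA -expRD; congr (_ + _ * expR _); ring.
  rewrite (_ : (fun K => _) = (fun K => expR (- (a * (T w - \sum_(k < K) J k w))) * \prod_(k < K) f (Num.max 0 (J k w)))).
    rewrite -[X in _ --> X]mul1r; apply: cvgM; first exact: deficit_expR.
    exact: cvg_jump_prod.
  exact/funext.
- move=> K w; apply: unit_norm.
  have h (k : nat) : 0 <= q + p * expR (- ((b - a) * Num.max 0 (J k w))) <= 1.
    rewrite addr_ge0 ?mulr_ge0 ?expR_ge0//= -pq lerD2l ler_piMr//.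
    by rewrite expR_le1 oppr_le0 mulr_ge0// le_max lexx.
  have /andP[h0 h1] := @unit_prod R K _ xpredT h.
  rewrite mulr_ge0 ?expR_ge0//= mulr_ile1 ?expR_ge0// expR_le1 oppr_le0 mulr_ge0//.
  by rewrite le_max lexx.
Qed.

End subordinator.

(** * Poisson-Dirichlet masses *)

Section marks.
Variables (R : realType) (d : measure_display) (Om : measurableType d)
  (P : probability Om R) (Q : nat -> {RV P >-> R}) (dE : measure_display)
  (E : measurableType dE) (F : probability E R) (Z : nat -> {RV P >-> E}) (C : set E) (p : R).
Hypothesis QZ : iid_independent_of Q F Z.
Hypotheses (mC : measurable C) (FC : F C = p%:E).

Let mark (s : nat -> bool) (i : nat) : set E := if s i then C else ~` C.

Let mmark s i : measurable (mark s i).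
Proof. by rewrite /mark; case: (s i) => //; exact: measurableC. Qed.

Let markE s i : F (mark s i) = (if s i then p else 1 - p)%:E.
Proof. by rewrite /mark; case: (s i); rewrite ?probability_setC ?[F C]FC// EFinB. Qed.

Let p01 : 0 <= p <= 1.
Proof. by rewrite -!lee_fin -FC measure_ge0 probability_le1. Qed.

Let prod_indic n (D : nat -> set E) w :
  \prod_(i < n) (\1_(D i) (Z i w) : R) = \1_(\bigcap_(i < n) [set w | D i (Z i w)]) w.
Proof.
rewrite indicE; have [/set_mem h|] := boolP (w \in _).
  by rewrite big1// => i _; rewrite indicE mem_set//; exact: (h _ (ltn_ord i)).
rewrite notin_setE => h.
have [i nD] : exists i : 'I_n, ~ D i (Z i w).
  apply: contrapT => h'; apply: h => i /= ilt.
  by apply: contrapT => nA; apply: h'; exists (Ordinal ilt).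
by rewrite (bigD1 i)//= indicE memNset// mul0r.
Qed.

(** For a fixed pattern [s], the mark indicators weight the joint law of the [Q i]; on rectangles,
    independence says that this weight acts as the constant probability of the pattern. *)
Lemma marked_prod_pattern n (s : nat -> bool) (g : nat -> R -> R) : (forall i, unit_fun (g i)) ->
  (\int[P]_w (\prod_(i < n) (\1_(if s i then C else ~` C) (Z i w) * g i (Q i w)))%:E =
   \int[P]_w ((\prod_(i < n) (if s i then p else 1 - p)) * \prod_(i < n) g i (Q i w))%:E)%E.
Proof.
move=> ug.
have mZ (D : set E) i : measurable D -> measurable_fun setT (fun w => \1_D (Z i w) : R).
  by move=> mD; apply: (measurableT_comp (measurable_indic mD)).
have q0 (b : bool) : 0 <= if b then p else 1 - p.
  by case: b; rewrite ?subr_ge0; case/andP: p01.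
pose V1 w : R := \prod_(i < n) (\1_(mark s i) (Z i w) : R).
pose V2 (w : Om) : R := \prod_(i < n) (if s i then p else 1 - p).
have V1m : measurable_fun setT V1.
  by apply: measurable_prod => i _; exact: mZ.
transitivity (weighted_prod P n Q V1 g).
  by apply: eq_integral => w _; rewrite /V1 -big_split.
apply: (@weighted_prod_ext R _ _ P _ _ P n Q Q V1 V2) => //.
- exact: measurable_cst.
- by move=> w; apply: prodr_ge0 => i _.
- by move=> w; apply: prodr_ge0 => i _.
move=> A mA.
have mQ : measurable (\bigcap_(i < n) [set w | A i (Q i w)]).
  apply: bigcap_measurableType => i _.
  by rewrite -[X in measurable X]setTI; exact: measurable_funPT.
have mZZ : measurable (\bigcap_(i < n) [set w | mark s i (Z i w)]).
  apply: bigcap_measurableType => i _.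
  by rewrite -[X in measurable X]setTI; apply: measurable_funPT => //; exact: mmark.
transitivity (\int[P]_(w in \bigcap_(i < n) [set w | A i (Q i w)])
    (\1_(\bigcap_(i < n) [set w | mark s i (Z i w)]) w : R)%:E)%E.
  by apply: eq_integral => w _; rewrite /V1 prod_indic.
rewrite integral_indic//.
transitivity (P (\bigcap_(i < n) [set w | A i (Q i w) /\ mark s i (Z i w)])).
  congr (P _); apply/seteqP; split => w.
    by move=> [h1 h2] i /= ilt; split; [exact: h2|exact: h1].
  by move=> h; split => i ilt; case: (h i ilt).
rewrite (QZ n mA (mmark s)).
transitivity (\int[P]_(w in \bigcap_(i < n) [set w | A i (Q i w)]) (cst (V2 point)%:E w))%E; last by [].
rewrite integral_cst// muleC; congr (_ * _)%E.
by rewrite /V2 -prodEFin; apply: eq_bigr => i _; rewrite markE.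
Qed.

(** Each factor splits into a marked and an unmarked term. The product expands over the [2^n]
    patterns, each handled by [marked_prod_pattern], and is then refolded. *)
Lemma marked_prod n (g : R -> R) : unit_fun g ->
  (\int[P]_w (\prod_(i < n) (if Z i w \in C then g (Q i w) else 1))%:E =
   \int[P]_w (\prod_(i < n) (1 - p + p * g (Q i w)))%:E)%E.
Proof.
move=> ug.
(* Patterns are extended by [true] beyond [n], since [iid_independent_of] takes infinite sequences
   of sets. *)
pose s (f : {ffun 'I_n -> bool}) (i : nat) : bool := oapp f true (insub i).
have sE f (i : 'I_n) : s f i = f i by rewrite /s valK.
pose gg f i : R -> R := if s f i then g else cst 1.
have u1 : unit_fun (cst 1 : R -> R).
  by split; [exact: measurable_cst|move=> x; rewrite /cst lexx ler01].
have ugg f i : unit_fun (gg f i) by rewrite /gg; case: (s f i).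
have mgg f i : measurable_fun setT (fun w => gg f i (Q i w)) by exact: (measurableT_comp (ugg f i).1).
have mZ (D : set E) i : measurable D -> measurable_fun setT (fun w => \1_D (Z i w) : R).
  by move=> mD; apply: (measurableT_comp (measurable_indic mD)).
have mk f i : measurable (if s f i then C else ~` C) by exact: (mmark (s f)).
have gg0 f i x : 0 <= gg f i x by case/andP: ((ugg f i).2 x).
have q0 (b : bool) : 0 <= if b then p else 1 - p.
  by case: b; rewrite ?subr_ge0; case/andP: p01.
transitivity (\int[P]_w (\sum_(f : {ffun 'I_n -> bool})
    (\prod_(i < n) (\1_(if s f i then C else ~` C) (Z i w) * gg f i (Q i w)))%:E))%E.
  apply: eq_integral => w _; rewrite sumEFin; congr EFin.
  rewrite [LHS](_ : _ = \prod_(i < n) \sum_(b : bool)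
     ((\1_(if b then C else ~` C) (Z i w) : R) * (if b then g else cst 1) (Q i w))); last first.
    apply: eq_bigr => i _; rewrite big_bool/= !indicE in_setC.
    by case: (Z i w \in C); rewrite /= ?mul1r ?mul0r ?addr0 ?add0r.
  rewrite bigA_distr_bigA; apply: eq_bigr => f _; apply: eq_bigr => i _.
  by rewrite /gg sE.
rewrite ge0_integral_sum//; last 2 first.
- by move=> f; apply/measurable_EFinP; apply: measurable_prod => i _; apply: measurable_funM => //; exact: mZ.
- by move=> f w _; rewrite lee_fin prodr_ge0// => i _; rewrite mulr_ge0.
transitivity (\sum_(f : {ffun 'I_n -> bool})
   \int[P]_w ((\prod_(i < n) (if s f i then p else 1 - p)) * \prod_(i < n) gg f i (Q i w))%:E)%E.
  by apply: eq_bigr => f _; exact: marked_prod_pattern.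
rewrite -ge0_integral_sum//; last 2 first.
- move=> f; apply/measurable_EFinP; apply: measurable_funM => //.
  by apply: measurable_prod.
- by move=> f w _; rewrite lee_fin mulr_ge0// prodr_ge0.
apply: eq_integral => w _; rewrite sumEFin; congr EFin.
rewrite [RHS](_ : _ = \prod_(i < n) \sum_(b : bool)
   ((if b then p else 1 - p) * (if b then g else cst 1) (Q i w))); last first.
  by apply: eq_bigr => i _; rewrite big_bool /= mulr1 addrC.
rewrite bigA_distr_bigA; apply: eq_bigr => f _; rewrite -big_split; apply: eq_bigr => i _.
by rewrite /gg sE.
Qed.

End marks.

(** * Normalized jumps under the change of measure *)

Section normalized_jumps.
Variables (R : realType) (al tau : R) (d : measure_display) (Om : measurableType d)
  (P : probability Om R) (xi : R -> {RV P >-> R}) (J : nat -> {RV P >-> R}) (k : R)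
  (d' : measure_display) (Om' : measurableType d') (P' : probability Om' R)
  (Q : nat -> {RV P' >-> R}).
Hypotheses (al0 : 0 < al) (al1 : al < 1) (k0 : 0 < k).
Hypothesis xiS : stable_subordinator al xi.
Hypothesis JR : {ae P, forall w, ranked_jumps (xi ^~ w) (J ^~ w)}.
Let T w : R := Defs.total (J ^~ w).
Hypothesis QE : forall (n : nat) (A : nat -> set R), (forall i, measurable (A i)) ->
  P' (\bigcap_(i < n) [set w | A i (Q i w)]) =
  (\int[P]_(w in \bigcap_(i < n) [set w | A i (J i w / T w)%R]) (k * T w `^ (- tau))%:E)%E.

Let mT : measurable_fun setT T.
Proof. by apply: measurable_total => n. Qed.

Let mJT i : measurable_fun setT (fun w => J i w / T w).
Proof. by apply: measurable_funM => //; apply: measurableT_comp => //; exact: measurable_inv. Qed.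

Let V w : R := k * T w `^ (- tau).

Let mV : measurable_fun setT V.
Proof. by apply: measurable_funM => //; apply: (measurableT_comp (measurable_powR _)). Qed.

Let V0 w : 0 <= V w. Proof. by rewrite mulr_ge0 ?powR_ge0// ltW. Qed.

Lemma normalized_prod n (g : nat -> R -> R) : (forall i, unit_fun (g i)) ->
  (\int[P']_w (\prod_(i < n) g i (Q i w))%:E =
   \int[P]_w (k * T w `^ (- tau) * \prod_(i < n) g i (J i w / T w))%:E)%E.
Proof.
move=> ug; have := @weighted_prod_ext R _ _ P' _ _ P n Q (fun i w => J i w / T w) (cst 1) V.
rewrite /weighted_prod => h; rewrite -[RHS]h//.
  by apply: eq_integral => w _; rewrite mul1r.
move=> A mA; rewrite -[RHS]QE//.
rewrite [LHS](_ : _ = \int[P']_(w in \bigcap_(i < n) [set w | A i (Q i w)]) (cst 1 w))%E//.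
rewrite integral_cst ?mul1e//.
apply: bigcap_measurableType => i _.
by rewrite -[X in measurable X]setTI; exact: measurable_funPT.
Qed.

Lemma normalized_single i (g : R -> R) : unit_fun g ->
  (\int[P']_w (g (Q i w))%:E = \int[P]_w (k * T w `^ (- tau) * g (J i w / T w))%:E)%E.
Proof.
move=> ug; pose gg j : R -> R := if j == i then g else cst 1.
have ugg j : unit_fun (gg j).
  rewrite /gg; case: eqP => // _; split; first exact: measurable_cst.
  by move=> x; rewrite /cst lexx ler01.
have E (a : nat -> R) : \prod_(j < i.+1) gg j (a j) = g (a i).
  rewrite big_ord_recr/= big1 ?mul1r /gg ?eqxx// => j _.
  by rewrite ltn_eqF// /cst.
transitivity (\int[P']_w (\prod_(j < i.+1) gg j (Q j w))%:E)%E.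
  by apply: eq_integral => w _; rewrite (E (fun j => Q j w)).
rewrite normalized_prod//.
by apply: eq_integral => w _; rewrite (E (fun j => J j w / T w)).
Qed.

(** The finite-dimensional identity at [n = 0] forces the change of measure to have mass 1. *)
Lemma integral_weight : (\int[P]_w (k * T w `^ (- tau))%:E = 1)%E.
Proof.
have := @normalized_prod 0%N (fun=> cst 1).
under eq_integral do rewrite big_ord0; rewrite integral_cst// mul1e => h.
have u : forall i : nat, unit_fun (cst 1 : R -> R).
  by split; [exact: measurable_cst|move=> x; rewrite /cst lexx ler01].
have := h u; rewrite [X in X = _]probability_setT => ->.
by apply: eq_integral => w _; rewrite big_ord0 mulr1.
Qed.

(** The [Q i] lie in [[0, 1]] only almost surely; clipping is bounded at every real and changes no
    value in [[0, 1]]. *)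
Let clip (x : R) : R := Num.min 1 (Num.max 0 x).

Let uclip : unit_fun clip.
Proof.
split.
  by apply: measurable_minr => //; apply: measurable_maxr => //; exact: measurable_id.
by move=> x; rewrite /clip le_min ler01 le_max lexx/= ge_min lexx.
Qed.

Let regular_ratio w i : regular_path xi J w -> 0 <= J i w / T w <= 1.
Proof.
move=> gw; have [_ sT _ Jpos] := regular_total gw; have T0 := total_gt0 gw.
rewrite divr_ge0 ?(ltW (Jpos i)) ?(ltW T0)//= ler_pdivrMr// mul1r.
apply: le_trans (sT i.+1); rewrite big_ord_recr/= lerDr sumr_ge0// => j _.
exact: ltW.
Qed.

Lemma normalized_ge0_ae : {ae P', forall w i, 0 <= Q i w <= 1}.
Proof.
pose U := (`[0%R, 1%R]%classic : set R).
have mU : measurable U by exact: measurable_itv.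
have h i : P' [set w | U (Q i w)] = 1%E.
  have mQ : measurable [set w | U (Q i w)].
    by rewrite -[X in measurable X]setTI; exact: measurable_funPT.
  have := normalized_single i (unit_fun_indic mU).
  rewrite [LHS](_ : _ = P' [set w | U (Q i w)]); last first.
    by rewrite -[in RHS](setIT [set w | _])-integral_indic.
  move=> ->; rewrite -integral_weight; apply: ae_eq_integral => //.
  - apply/measurable_EFinP; apply: measurable_funM => //.
    by apply: (measurableT_comp (measurable_indic mU)); exact: mJT.
  - exact/measurable_EFinP.
  - apply: filterS (regular_path_ae xiS JR) => w gw _.
    have UJ : U (J i w / T w) by rewrite /U/= in_itv/=; exact: regular_ratio.
    by rewrite indicE mem_set ?mulr1.
apply/ae_foralln => i.
exists (~` [set w | U (Q i w)]); split.
- by apply: measurableC; rewrite -[X in measurable X]setTI; exact: measurable_funPT.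
- apply: (probability_null _ (h i)).
  by rewrite -[X in measurable X]setTI; exact: measurable_funPT.
- by move=> w /= nU hU; apply: nU; move: hU; rewrite /U/= in_itv.
Qed.

(** The [Q i] and the paths of [xi] live on different spaces, so no pathwise bound transfers. But
    the expected sum of the clipped terms is at most 1, because the normalized jumps sum to at most
    1, and a finite expectation forces a finite sum almost surely. *)
Lemma normalized_sum_ae : {ae P', forall w, exists M : R, forall K, \sum_(i < K) Q i w <= M}.
Proof.
have mc i : measurable_fun setT (fun w => (clip (Q i w))%:E).
  by apply/measurable_EFinP; apply: (measurableT_comp uclip.1).
have c0 x : 0 <= clip x by case/andP: (uclip.2 x).
have mT' i : measurable_fun setT (fun w => (k * T w `^ (- tau) * clip (J i w / T w))%:E).
  by apply/measurable_EFinP; apply: measurable_funM => //; apply: (measurableT_comp uclip.1); exact: mJT.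
have I : (\int[P']_w (\sum_(i <oo) (clip (Q i w))%:E) <= 1)%E.
  rewrite integral_nneseries//; last by move=> i w _; rewrite lee_fin.
  apply: lime_le.
    by apply: is_cvg_nneseries => i _ _; apply: integral_ge0 => w _; rewrite lee_fin.
  apply: nearW => K; rewrite big_mkord.
  under eq_bigr do rewrite (normalized_single _ uclip).
  rewrite -ge0_integral_sum//; last by move=> i w _; rewrite lee_fin (mulr_ge0 (V0 w)).
  rewrite -integral_weight; apply: ae_ge0_le_integral => //.
  - by move=> w _; apply: sume_ge0 => i _; rewrite lee_fin (mulr_ge0 (V0 w)).
  - exact: emeasurable_sum.
  - by move=> w _; rewrite lee_fin (V0 w).
  - exact/measurable_EFinP.
  - apply: filterS (regular_path_ae xiS JR) => w gw _.
    rewrite sumEFin lee_fin -mulr_sumr ler_piMr ?(V0 w)//.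
    have [_ sT _ Jpos] := regular_total gw; have T0 := total_gt0 gw.
    apply: (@le_trans _ _ (\sum_(i < K) (J i w / T w))).
      apply: ler_sum => i _; rewrite /clip max_r ?ge_min ?lexx ?orbT//.
      by case/andP: (regular_ratio i gw).
    by rewrite -mulr_suml ler_pdivrMr// mul1r.
have mS : measurable_fun setT (fun w => \sum_(i <oo) (clip (Q i w))%:E)%E.
  by apply: ge0_emeasurable_sum => // i w _ _; rewrite lee_fin.
have S0 w : (0 <= \sum_(i <oo) (clip (Q i w))%:E)%E.
  by apply: nneseries_ge0 => i _ _; rewrite lee_fin.
have iS : P'.-integrable setT (fun w => \sum_(i <oo) (clip (Q i w))%:E)%E.
  apply/integrableP; split => //; under eq_integral do rewrite gee0_abs//.
  by rewrite (le_lt_trans I)// ltry.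
apply: filterS2 (integrable_ae measurableT iS) normalized_ge0_ae => w /(_ Logic.I) Sf Q01.
exists (fine (\sum_(i <oo) (clip (Q i w))%:E)%E) => K.
rewrite -lee_fin fineK// -sumEFin -(big_mkord xpredT (fun i => (Q i w)%:E)).
rewrite (eq_bigr (fun i => (clip (Q i w))%:E)); last first.
  by move=> i _; have /andP[h1 h2] := Q01 i; rewrite /clip max_r// min_r.
by apply: nneseries_lim_ge => i _ _; rewrite lee_fin.
Qed.

End normalized_jumps.

(** * The Stieltjes transform of the Poisson-Dirichlet mass *)

Section pd_mass.
Variables (R : realType) (al theta p : R) (d : measure_display) (Om : measurableType d)
  (P : probability Om R) (xi : R -> {RV P >-> R}) (J : nat -> {RV P >-> R}) (k : R)
  (d' : measure_display) (Om' : measurableType d') (P' : probability Om' R)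
  (Q : nat -> {RV P' >-> R}) (dE : measure_display)
  (E : measurableType dE) (F : probability E R) (Z : nat -> {RV P' >-> E}) (C : set E).
Let tau := al * theta.
Let T w : R := Defs.total (J ^~ w).
Hypotheses (al0 : 0 < al) (al1 : al < 1) (th0 : 0 < theta) (k0 : 0 < k).
Hypothesis xiS : stable_subordinator al xi.
Hypothesis JR : {ae P, forall w, ranked_jumps (xi ^~ w) (J ^~ w)}.
Hypothesis QE : forall (n : nat) (A : nat -> set R), (forall i, measurable (A i)) ->
  P' (\bigcap_(i < n) [set w | A i (Q i w)]) =
  (\int[P]_(w in \bigcap_(i < n) [set w | A i (J i w / T w)%R]) (k * T w `^ (- tau))%:E)%E.
Hypothesis QZ : iid_independent_of Q F Z.
Hypotheses (mC : measurable C) (FC : F C = p%:E).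
Variable G : probability R R.
Hypothesis Gt : gamma_law tau G.

Local Notation mu := (@lebesgue_measure R).
Local Notation D := (`[0%R, +oo[%classic : set R).
Local Notation D1 := (`]0%R, +oo[%classic : set R).
Let mD1 : measurable D1. Proof. exact: measurable_itv. Qed.
Let mD : measurable D. Proof. exact: measurable_itv. Qed.

Let p01 : 0 <= p <= 1.
Proof. by rewrite -!lee_fin -FC measure_ge0 probability_le1. Qed.
Let p0 : 0 <= p. Proof. by case/andP: p01. Qed.
Let q0 : 0 <= 1 - p. Proof. by rewrite subr_ge0; case/andP: p01. Qed.
Let pq : 1 - p + p = 1. Proof. by rewrite subrK. Qed.

Let mT : measurable_fun setT T.
Proof. by apply: measurable_total => n. Qed.

Let mmax0 d0 (X : measurableType d0) (f : X -> R) : measurable_fun setT f ->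
  measurable_fun setT (fun x => Num.max 0 (f x)).
Proof. by move=> mf; apply: measurable_maxr. Qed.

Variable lam : R.
Hypothesis lam0 : 0 <= lam.

Let mass K w : R := \sum_(i < K) Num.max 0 (Q i w) * \1_C (Z i w).

Let m1C i : measurable_fun setT (fun w => \1_C (Z i w) : R).
Proof. exact: (measurableT_comp (measurable_indic mC)). Qed.

Let mmass K : measurable_fun setT (mass K).
Proof. by apply: measurable_sum => i; apply: measurable_funM => //; exact: mmax0. Qed.

Let mass0 K w : 0 <= mass K w.
Proof. by apply: sumr_ge0 => i _; rewrite mulr_ge0// le_max lexx. Qed.

(** The functional of the unnormalized jumps that remains once [t] is rescaled by [T]. The clamps
    [Num.max 0] keep the integrand bounded on irregular paths. *)
Let H K (u : R) : \bar R := (\int[P]_w (expR (- (u * Num.max 0 (T w))) *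
   \prod_(i < K) (1 - p + p * expR (- (lam * u * Num.max 0 (J i w)))))%:E)%E.

Let mark_laplace K t : 0 <= t ->
  (\int[P']_w (expR (- (lam * mass K w * t)))%:E =
   \int[P]_w (k * T w `^ (- tau) *
     \prod_(i < K) (1 - p + p * expR (- (lam * t * Num.max 0 (J i w / T w)))))%:E)%E.
Proof.
move=> t0; have lt0 : 0 <= lam * t by rewrite mulr_ge0.
pose g (x : R) : R := expR (- (lam * t * Num.max 0 x)).
have ug : unit_fun g.
  split.
    apply: measurableT_comp => //; apply: measurableT_comp => //; apply: measurable_funM => //.
    by apply: mmax0; exact: measurable_id.
  by move=> x; rewrite expR_ge0 expR_le1 oppr_le0 mulr_ge0// le_max lexx.
transitivity (\int[P']_w (\prod_(i < K) (if Z i w \in C then g (Q i w) else 1))%:E)%E.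
  apply: eq_integral => w _; rewrite /mass mulr_sumr mulr_suml -sumrN expR_sum.
  congr EFin; apply: eq_bigr => i _; rewrite indicE /g.
  by case: (_ \in _); rewrite ?mulr1 ?mulr0 ?mul0r ?oppr0 ?expR0// -!mulrA (mulrC _ t).
rewrite (marked_prod QZ mC FC)//.
apply: (@normalized_prod _ _ _ _ _ _ _ _ _ _ _ k0 QE K (fun=> fun x => 1 - p + p * g x)) => _.
split; first by apply: measurable_funD => //; apply: measurable_funM => //; case: ug.
move=> x; have /andP[g0 g1] := ug.2 x.
by rewrite addr_ge0 ?mulr_ge0//= -[leRHS]pq lerD2l ler_piMr.
Qed.

Let phi K (w : Om) (t : R) : R := k * T w `^ (- tau) *
  \prod_(i < K) (1 - p + p * expR (- (lam * t * Num.max 0 (J i w / T w)))) *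
  (t `^ (tau - 1) * expR (- t)).

Let psi K (w : Om) (u : R) : R := k * u `^ (tau - 1) * (expR (- (u * Num.max 0 (T w))) *
   \prod_(i < K) (1 - p + p * expR (- (lam * u * Num.max 0 (J i w))))).

Let mprod K d0 (X : measurableType d0) (a : nat -> X -> R) :
  (forall i, measurable_fun setT (a i)) ->
  measurable_fun setT (fun x => \prod_(i < K) (1 - p + p * expR (a i x))).
Proof.
move=> ma; apply: measurable_prod => i _; apply: measurable_funD => //.
by apply: measurable_funM => //; apply: measurableT_comp.
Qed.

Let mfst (f : Om -> R) : measurable_fun setT f ->
  measurable_fun setT (fun z : Om * R => f z.1).
Proof. by move=> mf; apply: measurableT_comp. Qed.

Let mphi K : measurable_fun setT (fun z : Om * R => phi K z.1 z.2).
Proof.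
apply: measurable_funM; last by meas.
apply: measurable_funM; first apply: measurable_funM => //.
  by apply: (measurableT_comp (measurable_powR _)); exact: mfst.
apply: (mprod K (a := fun i z => - (lam * z.2 * Num.max 0 (J i z.1 / T z.1)))) => i.
apply: measurableT_comp => //; apply: measurable_funM; first by meas.
apply: mmax0; apply: measurable_funM; first exact: (mfst (f := J i)).
by apply: (measurableT_comp (@measurable_inv R)); exact: mfst.
Qed.

Let mpsi K : measurable_fun setT (fun z : Om * R => psi K z.1 z.2).
Proof.
apply: measurable_funM; first by meas.
apply: measurable_funM.
  apply: measurableT_comp => //; apply: measurableT_comp => //.
  by apply: measurable_funM; [meas|apply: mmax0; exact: mfst].
apply: (mprod K (a := fun i z => - (lam * z.2 * Num.max 0 (J i z.1)))) => i.
apply: measurableT_comp => //; apply: measurable_funM; first by meas.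
by apply: mmax0; exact: (mfst (f := J i)).
Qed.

Let mphi' K : measurable_fun setT (fun z : Om * measurableTypeR R => phi K z.1 z.2).
Proof. exact: (mphi K). Qed.

Let mpsi' K : measurable_fun setT (fun z : Om * measurableTypeR R => psi K z.1 z.2).
Proof. exact: (mpsi K). Qed.

Let phi0 K w t : 0 <= phi K w t.
Proof. rewrite /phi !mulr_ge0 ?powR_ge0 ?expR_ge0 ?(ltW k0)//; by apply: prodr_ge0 => i _; rewrite addr_ge0 ?mulr_ge0 ?expR_ge0. Qed.

Let psi0 K w t : 0 <= psi K w t.
Proof. rewrite /psi !mulr_ge0 ?powR_ge0 ?expR_ge0 ?(ltW k0)//; by apply: prodr_ge0 => i _; rewrite addr_ge0 ?mulr_ge0 ?expR_ge0. Qed.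

(* The substitution [t = T u] cancels the weight [T^-tau]. *)
Let phi_psi K w : regular_path xi J w ->
  (\int[mu]_(t in D1) (phi K w t)%:E = \int[mu]_(u in D1) (psi K w u)%:E)%E.
Proof.
move=> gw; have T0 := total_gt0 gw; rewrite -/(T w) in T0.
have [_ _ _ Jpos] := regular_total gw.
have mphiw : measurable_fun setT (fun t => (phi K w t)%:E).
  by apply/measurable_EFinP; exact: (measurableT_comp (mphi K) (measurable_pair1 w)).
rewrite (ge0_integral_scale T0 mphiw); last by move=> t _; rewrite lee_fin.
rewrite -ge0_integralZl; last 4 first.
- exact: mD1.
- by apply: measurable_funTS; apply: (measurableT_comp mphiw); meas.
- by move=> u _; rewrite lee_fin.
- by rewrite lee_fin ltW.
apply: eq_integral => u /set_mem/=; rewrite in_itv/= andbT => u0.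
rewrite -EFinM; congr EFin; rewrite /phi /psi.
rewrite (max_r (ltW T0)) powRM ?(ltW T0) ?(ltW u0)//.
have -> : \prod_(i < K) (1 - p + p * expR (- (lam * (T w * u) * Num.max 0 (J i w / T w)))) =
   \prod_(i < K) (1 - p + p * expR (- (lam * u * Num.max 0 (J i w)))).
  apply: eq_bigr => i _; rewrite (max_r (ltW (Jpos i))) max_r ?divr_ge0 ?(ltW (Jpos i)) ?(ltW T0)//.
  by congr (_ + _ * expR _); field; rewrite gt_eqF.
set X := \prod_(i < K) _.
have TT : T w * T w `^ (- tau) * T w `^ (tau - 1) = 1.
  rewrite mulrAC mulr_powRB1 ?(ltW T0)//; last exact: mulr_gt0.
  by rewrite -powRD ?(gt_eqF T0) ?implybT// subrr powRr0.
rewrite (mulrC u (T w)).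
transitivity (T w * T w `^ (- tau) * T w `^ (tau - 1) * (k * u `^ (tau - 1) * (expR (- (T w * u)) * X))).
  by ring.
by rewrite TT mul1r.
Qed.

Variable kG : R.
Hypothesis GE : forall g : R -> \bar R,
  measurable_fun setT g -> (forall x, 0 <= g x)%E ->
  (\int[G]_x g x = kG%:E * \int[mu]_(x in D1) (g x * (x `^ (tau - 1) * expR (- x))%:E))%E.

(** The gamma law turns the power into an exponential, to which [mark_laplace] applies at fixed [t].
    The rescaling by [T] takes place at fixed [w], so the integrals are exchanged before and after
    it. *)
Let mass_transform K :
  (\int[P']_w ((1 + lam * mass K w) `^ (- tau))%:E =
   kG%:E * \int[mu]_(u in D1) ((k * u `^ (tau - 1))%:E * H K u))%E.
Proof.
transitivity (\int[P']_w \int[G]_t (expR (- (lam * mass K w * t)))%:E)%E.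
  by apply: eq_integral => w _; rewrite (gamma_laplace Gt)// mulr_ge0.
have me : measurable_fun setT (fun z : Om' * R => expR (- (lam * mass K z.1 * z.2))).
  apply: measurableT_comp => //; apply: measurableT_comp => //; apply: measurable_funM; last by meas.
  apply: measurable_funM => //; apply: (measurableT_comp (mmass K)); exact: measurable_fst.
rewrite (@tonelli_on _ _ _ _ R P' G setT setT measurableT measurableT
  (fun w t => expR (- (lam * mass K w * t))))//.
rewrite GE; last 2 first.
- apply: (@measurable_integral_param _ _ _ _ R P' setT setT _ _ (fun t w => expR (- (lam * mass K w * t)))) => //.
  apply: measurableT_comp => //; apply: measurableT_comp => //; apply: measurable_funM; last exact: measurable_fst.
  by apply: measurable_funM => //; apply: (measurableT_comp (mmass K)); exact: measurable_snd.
- by move=> t; apply: integral_ge0 => w _; rewrite lee_fin expR_ge0.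
congr (_ * _)%E.
transitivity (\int[mu]_(t in D1) \int[P]_w (phi K w t)%:E)%E.
  apply: eq_integral => t /set_mem/=; rewrite in_itv/= andbT => t0.
  rewrite mark_laplace ?(ltW t0)// muleC -ge0_integralZl//; last 3 first.
  - apply/measurable_EFinP; apply: measurable_funM.
      by apply: measurable_funM => //; apply: (measurableT_comp (measurable_powR _)).
    apply: (mprod K (a := fun i w => - (lam * t * Num.max 0 (J i w / T w)))) => i.
    apply: measurableT_comp => //; apply: measurable_funM => //; apply: mmax0.
    by apply: measurable_funM => //; apply: (measurableT_comp (@measurable_inv R)).
  - move=> w _; rewrite lee_fin mulr_ge0 ?mulr_ge0 ?powR_ge0 ?(ltW k0)//; by apply: prodr_ge0 => i _; rewrite addr_ge0 ?mulr_ge0 ?expR_ge0.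
  - by rewrite lee_fin mulr_ge0 ?powR_ge0 ?expR_ge0.
  by apply: eq_integral => w _; rewrite -EFinM mulrC.
rewrite -(@tonelli_on _ _ _ _ R P mu setT D1 measurableT mD1 (phi K))//.
transitivity (\int[P]_w \int[mu]_(u in D1) (psi K w u)%:E)%E.
  apply: ae_eq_integral => //.
  - by apply: (@measurable_integral_param _ _ _ _ R mu setT D1 measurableT mD1 (phi K)).
  - by apply: (@measurable_integral_param _ _ _ _ R mu setT D1 measurableT mD1 (psi K)).
  - by apply: filterS (regular_path_ae xiS JR) => w gw _; exact: phi_psi.
rewrite (@tonelli_on _ _ _ _ R P mu setT D1 measurableT mD1 (psi K))//.
apply: eq_integral => u /set_mem/=; rewrite in_itv/= andbT => u0.
rewrite /H -ge0_integralZl//.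
- apply/measurable_EFinP; apply: measurable_funM.
    apply: measurableT_comp => //; apply: measurableT_comp => //.
    by apply: measurable_funM => //; exact: mmax0.
  apply: (mprod K (a := fun i w => - (lam * u * Num.max 0 (J i w)))) => i.
  by apply: measurableT_comp => //; apply: measurable_funM => //; apply: mmax0.
- by move=> w _; rewrite lee_fin mulr_ge0 ?expR_ge0//; by apply: prodr_ge0 => i _; rewrite addr_ge0 ?mulr_ge0 ?expR_ge0.
- by rewrite lee_fin mulr_ge0 ?powR_ge0// ltW.
Qed.

Let kap := 1 - p + p * (1 + lam) `^ al.

Let kap0 : 0 < kap.
Proof.
have l1 : 0 < (1 + lam) `^ al by rewrite powR_gt0// ltr_wpDr.
have [p00|pn0] := eqVneq p 0; first by rewrite /kap p00 mul0r subr0 addr0.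
by rewrite /kap ltr_wpDl// mulr_gt0// lt_def pn0 p0.
Qed.

(** [cvg_integral_jump_prod] with rate [u] for unmarked jumps and [(1 + lam) u] for marked ones. *)
Let cvg_H (u : R) : 0 < u -> (H K u @[K --> \oo] --> (expR (- (kap * u `^ al)))%:E)%E.
Proof.
move=> u0; have lu : u <= u + lam * u by rewrite lerDl mulr_ge0// ltW.
have := cvg_integral_jump_prod al1 xiS JR (ltW u0) lu p0 q0 pq.
rewrite [X in (expR (- X))%:E](_ : _ = kap * u `^ al); last first.
  have -> : u + lam * u = (1 + lam) * u by ring.
  by rewrite powRM ?(ltW u0)// ?addr_ge0// /kap; ring.
by rewrite [u + _ - u]addrC addKr.
Qed.

(** Equal rates [a = b = u] make every factor 1 and the limit [e^(-u^al)], which bounds [H K u] for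
    all [K]. This supplies the integrable majorant below. *)
Let H_le K (u : R) : 0 < u -> (H K u <= (expR (- u `^ al))%:E)%E.
Proof.
move=> u0; have := cvg_integral_jump_prod al1 xiS JR (ltW u0) (lexx u) p0 q0 pq.
rewrite -mulrDl pq mul1r => c.
rewrite -(cvg_lim _ c)//; apply: lime_ge; first by apply/cvg_ex; eexists; exact: c.
apply: nearW => n; apply: ge0_le_integral => //.
- by move=> w _; rewrite lee_fin mulr_ge0 ?expR_ge0//; by apply: prodr_ge0 => i _; rewrite addr_ge0 ?mulr_ge0 ?expR_ge0.
- apply/measurable_EFinP; apply: measurable_funM.
    apply: measurableT_comp => //; apply: measurableT_comp => //.
    by apply: measurable_funM => //; exact: mmax0.
  apply: (mprod K (a := fun i w => - (lam * u * Num.max 0 (J i w)))) => i.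
  by apply: measurableT_comp => //; apply: measurable_funM => //; apply: mmax0.
- apply/measurable_EFinP; apply: measurable_funM.
    apply: measurableT_comp => //; apply: measurableT_comp => //.
    by apply: measurable_funM => //; exact: mmax0.
  apply: (mprod n (a := fun i w => - ((u - u) * Num.max 0 (J i w)))) => i.
  by apply: measurableT_comp => //; apply: measurable_funM => //; apply: mmax0.
- move=> w _; rewrite lee_fin ler_wpM2l ?expR_ge0//.
  rewrite [leRHS]big1; last first.
    by move=> i _; rewrite subrr mul0r oppr0 expR0 mulr1.
  have h (j : nat) : 0 <= 1 - p + p * expR (- (lam * u * Num.max 0 (J j w))) <= 1.
    rewrite addr_ge0 ?mulr_ge0 ?expR_ge0//= -[leRHS]pq lerD2l ler_piMr//.
    rewrite expR_le1 oppr_le0 mulr_ge0 ?mulr_ge0// ?(ltW u0)//.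
    by rewrite le_max lexx.
  by have /andP[] := @unit_prod R K _ xpredT h.
Qed.

Let H_ge0 K u : (0 <= H K u)%E.
Proof.
apply: integral_ge0 => w _; rewrite lee_fin mulr_ge0 ?expR_ge0//.
by apply: prodr_ge0 => i _; rewrite addr_ge0 ?mulr_ge0 ?expR_ge0.
Qed.

Let mH K : measurable_fun D1 (H K).
Proof.
apply: (@measurable_integral_param _ _ _ _ R P D1 setT mD1 measurableT
  (fun u w => expR (- (u * Num.max 0 (T w))) *
   \prod_(i < K) (1 - p + p * expR (- (lam * u * Num.max 0 (J i w)))))); last first.
  move=> u w _ _; rewrite mulr_ge0 ?expR_ge0//.
  by apply: prodr_ge0 => i _; rewrite addr_ge0 ?mulr_ge0 ?expR_ge0.
have msnd (f : Om -> R) : measurable_fun setT f ->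
    measurable_fun setT (fun z : measurableTypeR R * Om => f z.2).
  by move=> mf; apply: measurableT_comp.
apply: measurable_funM.
  apply: measurableT_comp => //; apply: measurableT_comp => //.
  by apply: measurable_funM => //; apply: mmax0; exact: msnd.
apply: (mprod K (a := fun i z => - (lam * z.1 * Num.max 0 (J i z.2)))) => i.
apply: measurableT_comp => //; apply: measurable_funM; first exact: measurable_funM.
by apply: mmax0; exact: (msnd (J i)).
Qed.

Variable c : R.
Hypothesis cE : forall u : R, 0 < u ->
  (\int[mu]_(t in D1) (t `^ (tau - 1) * expR (- (u * t `^ al)))%:E = (c * u `^ (- theta))%:E)%E.

Let cvg_mass_transform :
  (\int[mu]_(u in D1) ((k * u `^ (tau - 1))%:E * H K u) @[K --> \oo] -->
    (k * c * kap `^ (- theta))%:E)%E.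
Proof.
have intE (z : R) : 0 < z -> (\int[mu]_(u in D1) (k * u `^ (tau - 1) * expR (- (z * u `^ al)))%:E =
    (k * c * z `^ (- theta))%:E)%E.
  move=> z0; rewrite -mulrA EFinM -cE// -ge0_integralZl//.
  - by apply: eq_integral => u _; rewrite -EFinM mulrA.
  - by apply: measurable_funTS; meas.
  - by move=> u _; rewrite lee_fin mulr_ge0 ?powR_ge0 ?expR_ge0.
  - by rewrite lee_fin ltW.
rewrite -intE//.
have m1 K : measurable_fun D1 (fun u : measurableTypeR R => (k * u `^ (tau - 1))%:E * H K u)%E.
  by apply: emeasurable_funM => //; apply: measurable_funTS; meas.
have m2 : measurable_fun D1 (fun u : measurableTypeR R => (k * u `^ (tau - 1) * expR (- (kap * u `^ al)))%:E).
  by apply: measurable_funTS; meas.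
have h1 : {ae mu, forall u, D1 u -> ((k * u `^ (tau - 1))%:E * H K u)%E @[K --> \oo] -->
    (k * u `^ (tau - 1) * expR (- (kap * u `^ al)))%:E}.
  apply: aeW => u /=; rewrite in_itv/= andbT => u0.
    by rewrite EFinM; refine (cvgeZl (y := (k * u `^ (tau - 1))%:E) _ (cvg_H u0)).
have h2 : mu.-integrable D1 (fun u => (k * u `^ (tau - 1) * expR (- (1 * u `^ al)))%:E).
  apply/integrableP; split; first by apply: measurable_funTS; meas.
  under eq_integral do rewrite gee0_abs ?lee_fin ?mulr_ge0 ?powR_ge0 ?expR_ge0 ?(ltW k0)//.
  by rewrite intE// ltry.
have h3 : {ae mu, forall u K, D1 u -> (`|(k * u `^ (tau - 1))%:E * H K u| <=
    (k * u `^ (tau - 1) * expR (- (1 * u `^ al)))%:E)%E}.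
  apply: aeW => u K /=; rewrite in_itv/= andbT => u0.
  have ku : 0 <= k * u `^ (tau - 1) by rewrite mulr_ge0 ?powR_ge0// ltW.
  rewrite gee0_abs ?mule_ge0// mul1r [leRHS]EFinM lee_wpmul2l ?lee_fin//; exact: H_le.
by have [_ _] := @dominated_convergence _ (measurableTypeR R) R mu D1 mD1 _ _ _ m1 m2 h1 h2 h3.
Qed.

Let S w : R := Defs.total (fun i => Q i w * \1_C (Z i w)).

Lemma measurable_mark_total : measurable_fun setT S.
Proof. by apply: (measurable_total (J := fun i w => Q i w * \1_C (Z i w))) => i; apply: measurable_funM. Qed.

(** Almost surely the series converges, so that [total] is a genuine limit, and the terms are
    nonnegative, so that [mass] is its partial sum. *)
Let mass_cvg_ae : {ae P', forall w, (mass K w @[K --> \oo] --> S w) /\ 0 <= S w}.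
Proof.
apply: filterS2 (normalized_sum_ae k0 xiS JR QE) (normalized_ge0_ae k0 xiS JR QE) => w [M hM] Q01.
have Q0 i : 0 <= Q i w by case/andP: (Q01 i).
have SE : series (fun i => Q i w * \1_C (Z i w)) = mass ^~ w.
  apply/funext => K; rewrite /series/= big_mkord; apply: eq_bigr => i _.
  by rewrite max_r.
have cvS : cvgn (series (fun i => Q i w * \1_C (Z i w))).
  apply: nondecreasing_is_cvgn.
    by apply/nondecreasing_seqP => n; rewrite seriesSr/= lerDl mulr_ge0.
  exists M => _ [K _ <-]; rewrite SE; apply: le_trans (hM K); apply: ler_sum => i _.
  by rewrite max_r// ler_piMr// indicE; case: (_ \in _).
have cS : (mass ^~ w) @ \oo --> S w by rewrite -SE; exact: cvS.
split; first exact: cS.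
apply: limr_ge => //; apply: nearW => K; rewrite SE; exact: mass0.
Qed.

Let cvg_mass_powR :
  (\int[P']_w ((1 + lam * mass K w) `^ (- tau))%:E @[K --> \oo] -->
   \int[P']_w ((1 + lam * Num.max 0 (S w)) `^ (- tau))%:E)%E.
Proof.
have tau0 : 0 < tau by exact: mulr_gt0.
apply: (@bounded_convergence _ _ _ P' _ _ 1).
- move=> K; apply: (measurableT_comp (measurable_powR _)).
  by apply: measurable_funD => //; apply: measurable_funM.
- apply: (measurableT_comp (measurable_powR _)).
  apply: measurable_funD => //; apply: measurable_funM => //; apply: mmax0; exact: measurable_mark_total.
- apply: filterS mass_cvg_ae => w [cw S0].
  rewrite max_r//.
  apply: (@cvg_comp _ _ _ (fun K => 1 + lam * mass K w) (fun x => x `^ (- tau))).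
    by apply: cvgD; [exact: cvg_cst|apply: cvgM; [exact: cvg_cst|exact: cw]].
  by apply: continuous_powR_gt0; rewrite ltr_wpDr// mulr_ge0.
- move=> K w; rewrite ger0_norm ?powR_ge0// -[leRHS](powRr0 (1 + lam * mass K w)).
  by apply: ler_powR; rewrite ?lerDl ?mulr_ge0// oppr_le0 ltW.
Qed.

Lemma mark_total_transform :
  (\int[P']_w ((1 + lam * Num.max 0 (S w)) `^ (- tau))%:E = (kG * (k * c) * kap `^ (- theta))%:E)%E.
Proof.
apply: (cvg_unique _ cvg_mass_powR) => //.
rewrite (_ : (fun K => _) = (fun K => kG%:E * \int[mu]_(u in D1) ((k * u `^ (tau - 1))%:E * H K u))%E).
  by rewrite -mulrA EFinM; refine (cvgeZl (y := kG%:E) _ cvg_mass_transform).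
exact/funext.
Qed.

Lemma mark_total_ge0_ae : {ae P', forall w, 0 <= S w}.
Proof. by apply: filterS mass_cvg_ae => w []. Qed.

End pd_mass.

Lemma PD_mass_transform (R : realType) (al theta p : R) (G mu : probability R R) :
  0 < al -> al < 1 -> 0 < theta -> gamma_law (al * theta) G ->
  PD_mass_law al (al * theta) p mu ->
  mu `[0%R, +oo[%classic = 1%E /\ forall lam : R, 0 <= lam ->
  (\int[mu]_(m in `[0%R, +oo[) ((1 + lam * m) `^ (- (al * theta)))%:E =
   ((1 - p + p * (1 + lam) `^ al) `^ (- theta))%:E)%E.
Proof.
move=> al0 al1 th0 Gt [d' [Om' [P' [Q [dE [E [F [Z [C [QPD _ QZ [mC FC] muE]]]]]]]]]].
have [d [Om [P [xi [J [k [xiS JR k0 QE]]]]]]] := QPD.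
have [kG kG0 GE] := gamma_law_integral Gt.
have [c c0 cE] := integral_powR_expR_powR al0 th0 Gt.
pose S w : R := Defs.total (fun i => Q i w * \1_C (Z i w)).
have mS : measurable_fun setT S by exact: measurable_mark_total.
have mD : measurable (`[0%R, +oo[%classic : set R) by exact: measurable_itv.
pose X : {mfun Om' >-> R} := HB.pack S (isMeasurableFun.Build _ _ _ _ S mS).
have muX : same_law mu (distribution P' X) by move=> A mA; rewrite muE.
have S0 := mark_total_ge0_ae Z C k0 xiS JR QE.
have muD : mu `[0%R, +oo[%classic = 1%E.
  apply: probability_null_full => //; rewrite muX; last exact: measurableC.
  have [N [mN N0 SN]] := S0; apply: (subset_measure0 _ mN _ N0).
    by rewrite -[Y in measurable Y]setTI; exact: (mS measurableT _ (measurableC mD)).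
  move=> w /= nS; apply: SN => /= SS; apply: nS.
  by rewrite in_itv/= andbT.
split => // lam lam0.
have T (l : R) : 0 <= l -> (\int[mu]_(m in `[0%R, +oo[) ((1 + l * m) `^ (- (al * theta)))%:E =
   (kG * (k * c) * (1 - p + p * (1 + l) `^ al) `^ (- theta))%:E)%E.
  move=> l0.
  rewrite -(mark_total_transform al0 al1 th0 k0 xiS JR QE QZ mC FC Gt l0 GE cE).
  rewrite (integral_fullP mD muD); last by meas.
  have mf : measurable_fun setT (fun m : R => ((1 + l * m) `^ (- (al * theta)))%:E) by meas.
  have f0 (y : R) : (0 <= ((1 + l * y) `^ (- (al * theta)))%:E)%E by rewrite lee_fin powR_ge0.
  rewrite (same_law_integral _ _ muX) (ge0_integral_distribution X mf f0).
  apply: ae_eq_integral => //.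
  - apply/measurable_EFinP; apply: (measurableT_comp (measurable_powR _)).
    by apply: measurable_funD => //; apply: measurable_funM.
  - apply/measurable_EFinP; apply: (measurableT_comp (measurable_powR _)).
    by apply: measurable_funD => //; apply: measurable_funM => //; apply: measurable_maxr.
  - by apply: filterS S0 => w Sw _; rewrite max_r.
(* At [lam = 0] the transform is a total mass, which fixes the product of the three unevaluated
   constants. *)
have c1 : kG * (k * c) = 1.
  have := T 0 (lexx 0); under eq_integral do rewrite mul0r addr0 powR1.
  rewrite integral_cst// mul1e [X in X = _]muD addr0 powR1 mulr1 subrK powR1 mulr1.
  by case.
by rewrite T// c1 mul1r.
Qed.

(** * Size biasing *)

Section log_inequality.
Variable R : realType.

Lemma ln_concave_1 (w r : R) : 0 <= w <= 1 -> 0 < r -> w * ln r <= ln (1 - w + w * r).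
Proof.
move=> /andP[w0 w1] r0; set y := ln r.
have h : expR (w * y) <= 1 - w + w * r.
  have -> : r = expR y by rewrite lnK.
  have h1 := expR_ge1Dx (y - w * y); have h2 := expR_ge1Dx (- (w * y)).
  have -> : 1 - w + w * expR y =
     expR (w * y) * ((1 - w) * expR (- (w * y)) + w * expR (y - w * y)).
    rewrite mulrDr mulrCA (mulrCA (expR (w * y)) w) -!expRD.
    by rewrite subrr expR0 mulr1 [w * y + _]addrC subrK.
  rewrite -[leLHS]mulr1 ler_wpM2l ?expR_ge0//.
  have w1' : 0 <= 1 - w by rewrite subr_ge0.
  apply: le_trans (lerD (ler_wpM2l w1' h2) (ler_wpM2l w0 h1)).
  by rewrite le_eqVlt; apply/orP; left; apply/eqP; ring.
rewrite -[leLHS]expRK ler_ln ?posrE ?expR_gt0//.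
exact: lt_le_trans (expR_gt0 _) h.
Qed.

(** The tangent line at [ln u] of the convex function [y |-> ln (1 + e^y)], whose slope there is
    [u / (1 + u)]. *)
Lemma ln_ratio_ge (u v : R) : 0 < u -> 0 < v ->
  u / (1 + u) * (ln v - ln u) <= ln (1 + v) - ln (1 + u).
Proof.
move=> u0 v0; have u1 : 0 < 1 + u by rewrite addr_gt0.
have v1 : 0 < 1 + v by rewrite addr_gt0.
rewrite -!ln_div ?posrE//.
have -> : (1 + v) / (1 + u) = 1 - u / (1 + u) + u / (1 + u) * (v / u).
  by field; rewrite !gt_eqF.
apply: ln_concave_1; last exact: divr_gt0.
by rewrite divr_ge0 ?(ltW u0) ?(ltW u1)//= ler_pdivrMr// mul1r lerDr.
Qed.

End log_inequality.

(** * The Stieltjes transform of order 1 of a Lamperti variable *)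

Section lamperti_stieltjes.
Variables (R : realType) (al : R).
Hypothesis al0 : 0 < al.
Local Notation D1 := (`]0%R, +oo[%classic : set R).
Let mD1 : measurable D1. Proof. exact: measurable_itv. Qed.
Variable rho : probability R R.
Hypothesis rhoE : lamperti_law al rho.
Let rhoD : rho D1 = 1%E. Proof. exact: lamperti_full rhoE. Qed.

Let h (s : R) : \bar R := (\int[rho]_(x in D1) (s * x / (1 + s * x))%:E)%E.
Let kk (s : R) : R := s `^ al / (1 + s `^ al).
Let LL (s : R) : R := al^-1 * ln (1 + s `^ al).

Let logE (s : R) : 0 <= s -> (\int[rho]_(x in D1) (ln (1 + s * x))%:E = (LL s)%:E)%E.
Proof.
move=> s0; have := lamperti_log al0 rhoE ler01 (lexx 0) s0.
under eq_integral do rewrite mul1r mul0r addr0 divr1.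
by move=> ->; rewrite mulr1 add0r powR0 ?gt_eqF// addr0 ln1 subr0.
Qed.

(* [s |-> s x / (1 + s x)] is the derivative of [ln (1 + s x)] in [ln s], and it
   is nondecreasing. *)
Let h0 (s x : R) : 0 < s -> 0 < x -> 0 <= s * x / (1 + s * x) <= 1.
Proof.
move=> s0 x0; have sx : 0 < s * x by rewrite mulr_gt0.
by rewrite divr_ge0 ?(ltW sx) ?addr_ge0 ?(ltW sx)//= ler_pdivrMr ?addr_gt0// mul1r lerDr.
Qed.

Let mh (s : R) : measurable_fun D1 (fun x : R => (s * x / (1 + s * x))%:E).
Proof. by apply: measurable_funTS; meas. Qed.

Let mlog (s : R) : measurable_fun D1 (fun x : R => (ln (1 + s * x))%:E).
Proof. by apply: measurable_funTS; meas. Qed.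

Let hE (s : R) : 0 < s -> h s = (fine (h s))%:E.
Proof.
move=> s0; have hx x : D1 x -> 0 <= s * x / (1 + s * x) <= 1.
  by rewrite /= in_itv/= andbT; exact: h0.
rewrite fineK// ge0_fin_numE; last first.
  by apply: integral_ge0 => x /hx /andP[]; rewrite lee_fin.
apply: (@le_lt_trans _ _ (\int[rho]_(x in D1) (cst 1 x))%E).
  apply: ge0_le_integral => //.
  - by move=> x /hx /andP[]; rewrite lee_fin.
  - by move=> x /hx /andP[]; rewrite lee_fin.
by rewrite integral_cst// mul1e (le_lt_trans (probability_le1 _ _))// ltry.
Qed.

(** [ln_ratio_ge] integrated over [x]: as a function of [ln s], [LL] is supported at [a] by a line
    of slope [h a]. The two orders of [a] and [b] are separated to keep integrands nonnegative. *)
Let h_LL (a b : R) : 0 < a -> 0 < b -> fine (h a) * (ln b - ln a) <= LL b - LL a.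
Proof.
move=> a0 b0.
have lx (s x : R) : 0 < s -> 0 < x -> 0 <= ln (1 + s * x).
  by move=> s0 x0; rewrite ln_ge0// lerDl mulr_ge0// ltW.
have key x : 0 < x -> a * x / (1 + a * x) * (ln b - ln a) <= ln (1 + b * x) - ln (1 + a * x).
  move=> x0; have := @ln_ratio_ge R (a * x) (b * x) (mulr_gt0 a0 x0) (mulr_gt0 b0 x0).
  by rewrite !lnM ?posrE// opprD addrACA subrr addr0.
have [ab|ba] := leP a b.
  have ln0 : 0 <= ln b - ln a by rewrite subr_ge0 ler_ln ?posrE.
  rewrite lerBrDr -lee_fin EFinD EFinM -hE// -!logE ?(ltW a0) ?(ltW b0)//.
  rewrite muleC /h -ge0_integralZl//; last first.
    by move=> x /=; rewrite in_itv/= andbT => x0; rewrite lee_fin; case/andP: (h0 a0 x0).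
  rewrite -ge0_integralD//; last 3 first.
  - move=> x /=; rewrite in_itv/= andbT => x0; rewrite -EFinM lee_fin mulr_ge0//.
    by case/andP: (h0 a0 x0).
  - exact: emeasurable_funM.
  - by move=> x /=; rewrite in_itv/= andbT => x0; rewrite lee_fin lx.
  apply: ge0_le_integral => //.
  - move=> x /=; rewrite in_itv/= andbT => x0; rewrite -EFinM -EFinD lee_fin addr_ge0 ?lx// mulr_ge0//.
    by case/andP: (h0 a0 x0).
  - by apply: emeasurable_funD => //; exact: emeasurable_funM.
  - move=> x /=; rewrite in_itv/= andbT => x0; rewrite -EFinM -EFinD lee_fin.
    by rewrite -lerBrDr mulrC key.
have ln0 : 0 <= ln a - ln b by rewrite subr_ge0 ler_ln ?posrE// ltW.
suff H : LL a <= fine (h a) * (ln a - ln b) + LL b.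
  by rewrite -[ln b - ln a]opprB mulrN lerNl opprB lerBlDr.
rewrite -lee_fin [leRHS]EFinD (EFinM (fine (h a))) -hE// -!logE ?(ltW a0) ?(ltW b0)//.
rewrite [X in (_ <= X + _)%E]muleC /h -ge0_integralZl//; last first.
  by move=> x /=; rewrite in_itv/= andbT => x0; rewrite lee_fin; case/andP: (h0 a0 x0).
rewrite -ge0_integralD//; last 3 first.
- move=> x /=; rewrite in_itv/= andbT => x0; rewrite -EFinM lee_fin mulr_ge0//.
  by case/andP: (h0 a0 x0).
- exact: emeasurable_funM.
- by move=> x /=; rewrite in_itv/= andbT => x0; rewrite lee_fin lx.
apply: ge0_le_integral => //.
- by move=> x /=; rewrite in_itv/= andbT => x0; rewrite lee_fin lx.
- by apply: emeasurable_funD => //; exact: emeasurable_funM.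
- move=> x /=; rewrite in_itv/= andbT => x0; rewrite -EFinM -EFinD lee_fin.
  by have := key x x0; rewrite -[ln b - ln a]opprB mulrN lerNl opprB lerBlDr [X in _ <= X + _]mulrC.
Qed.

(** The tangent inequality at base point [b^al]: [LL] is supported at [b] by a line of slope
    [kk b]. *)
Let kk_LL (a b : R) : 0 < a -> 0 < b -> LL b - LL a <= kk b * (ln b - ln a).
Proof.
move=> a0 b0.
have := @ln_ratio_ge R (b `^ al) (a `^ al) (powR_gt0 _ b0) (powR_gt0 _ a0).
rewrite !ln_powR -mulrBr -/(kk b) => h1.
rewrite /LL -mulrBr -(ler_pM2l al0) mulrA divff ?gt_eqF// mul1r.
have -> : al * (kk b * (ln b - ln a)) = - (kk b * (al * (ln a - ln b))) by ring.
by rewrite lerNr opprB.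
Qed.

Let continuous_kk (a : R) : 0 < a -> {for a, continuous kk}.
Proof.
move=> a0; apply: cvgM; first exact: continuous_powR_gt0.
apply: cvgV; first by rewrite gt_eqF// ltr_wpDr// powR_ge0.
by apply: cvgD; [exact: cvg_cst|exact: continuous_powR_gt0].
Qed.

(** The two bounds combine into [h a (ln b - ln a) <= kk b (ln b - ln a)]. Dividing on either side
    of [a] and letting [b] tend to [a] pins [h a], with no differentiation under the integral. *)
Lemma lamperti_stieltjes_log (a : R) : 0 < a -> h a = (kk a)%:E.
Proof.
move=> a0; rewrite hE//; congr EFin; apply/le_anti/andP; split.
- have c : kk b @[b --> a^'+] --> kk a.
    by apply: cvg_at_right_filter; exact: continuous_kk.
  rewrite -(cvg_lim _ c)//; apply: limr_ge; first by apply/cvg_ex; eexists; exact: c.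
  near=> b; have ab : a < b by near: b; exact: nbhs_right_gt.
  have b0 := lt_trans a0 ab.
  have l0 : 0 < ln b - ln a by rewrite subr_gt0 ltr_ln ?posrE.
  by rewrite -(ler_pM2r l0); exact: le_trans (h_LL a0 b0) (kk_LL a0 b0).
- have c : kk b @[b --> a^'-] --> kk a.
    by apply: cvg_at_left_filter; exact: continuous_kk.
  rewrite -(cvg_lim _ c)//; apply: limr_le; first by apply/cvg_ex; eexists; exact: c.
  near=> b; have ab : b < a by near: b; exact: nbhs_left_lt.
  have b0 : 0 < b by near: b; exact: nbhs_left_gt.
  have l0 : ln b - ln a < 0 by rewrite subr_lt0 ltr_ln ?posrE.
  by rewrite -(ler_nM2r l0); exact: le_trans (h_LL a0 b0) (kk_LL a0 b0).
Unshelve. all: by end_near. Qed.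

Lemma lamperti_stieltjes (a : R) : 0 < a ->
  (\int[rho]_(x in D1) ((1 + a * x)^-1)%:E = ((1 + a `^ al)^-1)%:E)%E.
Proof.
move=> a0.
have x1 x : D1 x -> 0 < 1 + a * x.
  by rewrite /= in_itv/= andbT => x0; rewrite ltr_wpDr// mulr_ge0// ltW.
have : (\int[rho]_(x in D1) ((1 + a * x)^-1)%:E + h a = 1)%E.
  rewrite -ge0_integralD//.
  - rewrite -rhoD -[RHS]mul1e -integral_cst//; apply: eq_integral => x /set_mem Dx.
    by rewrite -EFinD; congr EFin; field; rewrite gt_eqF ?x1.
  - by move=> x Dx; rewrite lee_fin invr_ge0 ltW ?x1.
  - by apply: measurable_funTS; meas.
  - by move=> x /=; rewrite in_itv/= andbT => x0; rewrite lee_fin; case/andP: (h0 a0 x0).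
rewrite lamperti_stieltjes_log// => e.
have := congr1 (fun z => z - (kk a)%:E)%E e; rewrite addeK// => ->.
rewrite -EFinB; congr EFin.
by rewrite /kk; field; rewrite gt_eqF// ltr_wpDr// powR_ge0.
Qed.

End lamperti_stieltjes.

(** * The change of variable [b = y / (1 + y)] *)

Section unit_interval_substitution.
Variable R : realType.
Local Notation mu := (@lebesgue_measure R).
Local Notation D := (`[0%R, +oo[%classic : set R).
Local Notation D1 := (`]0%R, +oo[%classic : set R).
Local Notation I := (`]0%R, 1%R[%classic : set R).
Let mD1 : measurable D1. Proof. exact: measurable_itv. Qed.
Let mD : measurable D. Proof. exact: measurable_itv. Qed.

Let psi (y : R) : R := (1 + y)^-1.

Let psi_neq0 (y : R) : 0 < y -> 1 + y != 0.
Proof. by move=> y0; rewrite gt_eqF// addr_gt0. Qed.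

Let derive_psi (y : R) : 0 < y -> is_derive y 1 psi (- psi y ^+ 2).
Proof.
move=> y0; have h : is_derive y 1 (fun z : R => 1 + z) 1.
  have h := @is_deriveD _ _ _ (cst (1 : R)) (@id R) y 1 _ _ (is_derive_cst _ _ _) (is_derive_id _ _).
  by apply: (is_derive_eq h); rewrite add0r.
have := @is_deriveV R (fun z : R => 1 + z) y 1 1 (psi_neq0 y0) h.
by move=> h1; apply: (is_derive_eq h1); rewrite /GRing.scale/= mulr1 exprVn.
Qed.

Let psi_y : psi y @[y --> +oo] --> (0 : R).
Proof.
apply/cvgrPdist_lt => e e0; near=> y.
have ye : e^-1 < y by near: y; apply: nbhs_pinfty_gt; exact: num_real.
have e'0 : 0 < e^-1 by rewrite invr_gt0.
rewrite sub0r normrN gtr0_norm ?invr_gt0 ?addr_gt0//.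
by rewrite invf_plt ?posrE ?addr_gt0// (lt_trans ye)// ltrDr.
Unshelve. all: by end_near. Qed.

Let psi_0 : psi y @[y --> 0^'+] --> (1 : R).
Proof.
apply: cvg_at_right_filter; rewrite -[X in _ --> X]invr1 -[X in X^-1](addr0 1).
apply: cvgV; first by rewrite addr0 oner_neq0.
by apply: cvgD; [exact: cvg_cst|exact: cvg_id].
Qed.

Let continuous_psi (y : R) : 0 < y -> {for y, continuous psi}.
Proof.
move=> y0; apply: cvgV; first exact: psi_neq0.
by apply: cvgD; [exact: cvg_cst|exact: cvg_id].
Qed.

Let integral_psi2 : (\int[mu]_(y in D1) (psi y ^+ 2)%:E = 1)%E.
Proof.
have -> : (1 = (0 - (-1) : R)%:E)%E by rewrite sub0r opprK.
apply: (@ge0_FTC_0y R (fun y => psi y ^+ 2) (fun y => - psi y)).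
- by move=> y y0; rewrite sqr_ge0.
- by move=> y y0; apply: cvgM; exact: continuous_psi.
- by move=> y y0; have h := derive_psi y0; apply: is_derive_eq; rewrite opprK.
- by apply: cvgN; exact: psi_0.
- by rewrite -[X in _ --> X]oppr0; apply: cvgN; exact: psi_y.
Qed.

Let integral_psi_expR (lam : R) : 0 < lam ->
  (\int[mu]_(y in D1) (expR (- (lam * (1 - psi y))) * psi y ^+ 2)%:E =
   ((1 - expR (- lam)) / lam)%:E)%E.
Proof.
move=> lam0.
have -> : (1 - expR (- lam)) / lam =
    - lam^-1 * expR (- (lam * (1 - 0))) - (- lam^-1 * expR (- (lam * (1 - 1)))).
  by rewrite subr0 (subrr 1) mulr0 oppr0 expR0 !mulr1; ring.
apply: (@ge0_FTC_0y R (fun y => expR (- (lam * (1 - psi y))) * psi y ^+ 2)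
  (fun y => - lam^-1 * expR (- (lam * (1 - psi y))))).
- by move=> y y0; rewrite mulr_ge0 ?expR_ge0// sqr_ge0.
- move=> y y0; apply: cvgM; last by apply: cvgM; exact: continuous_psi.
  apply: (@continuous_comp R R R (fun y => - (lam * (1 - psi y))) expR); last exact: continuous_expR.
  apply: cvgN; apply: cvgM; first exact: cvg_cst.
  by apply: cvgB; [exact: cvg_cst|exact: continuous_psi].
- move=> y y0; have h := derive_psi y0.
  have h1 : is_derive y 1 (fun y => - (lam * (1 - psi y))) (- (lam * (psi y ^+ 2))).
    by apply: is_derive_eq; rewrite /GRing.scale/= add0r mul1r opprK.
  have h2 := @is_derive1_comp R (@expR R) (fun y => - (lam * (1 - psi y))) y _ _ (is_derive_expR _) h1.
  have h3 := @is_deriveZ _ _ _ (fun y : R => expR (- (lam * (1 - psi y)))) (- lam^-1) y 1 _ h2.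
  by apply: (is_derive_eq h3); rewrite /GRing.scale/=; field; rewrite gt_eqF.
- apply: cvgM; first exact: cvg_cst.
  apply: (@cvg_comp _ _ _ (fun y => - (lam * (1 - psi y))) expR _ (nbhs (- (lam * (1 - 1))))); last exact: continuous_expR.
  by apply: cvgN; apply: cvgM; [exact: cvg_cst|apply: cvgB; [exact: cvg_cst|exact: psi_0]].
- apply: cvgM; first exact: cvg_cst.
  apply: (@cvg_comp _ _ _ (fun y => - (lam * (1 - psi y))) expR _ (nbhs (- (lam * (1 - 0))))); last exact: continuous_expR.
  by apply: cvgN; apply: cvgM; [exact: cvg_cst|apply: cvgB; [exact: cvg_cst|exact: psi_y]].
Qed.

(* Both sides are measures in [g]; their Laplace transforms are elementary. *)
Lemma unit_interval_substitution (g : R -> \bar R) :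
  measurable_fun [set: R] g -> (forall x, 0 <= g x)%E ->
  (\int[mu]_(b in I) g b = \int[mu]_(y in D1) (g (y / (1 + y))%R * ((1 + y)^-1 ^+ 2)%:E))%E.
Proof.
pose w1 (x : measurableTypeR R) : \bar R := (\1_I x : R)%:E.
pose w2 (x : measurableTypeR R) : \bar R := (psi x ^+ 2 * \1_D1 x)%:E.
have mw1 : measurable_fun setT w1 by apply/measurable_EFinP; exact: measurable_indic.
have mpsi : measurable_fun [set: measurableTypeR R] psi by rewrite /psi; meas.
have mw2 : measurable_fun setT w2.
  apply/measurable_EFinP; apply: measurable_funM; last exact: measurable_indic.
  exact: measurable_funX.
have w10 x : (0 <= w1 x)%E by rewrite lee_fin.
have w20 x : (0 <= w2 x)%E by rewrite lee_fin mulr_ge0// sqr_ge0.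
have [n1 n1E] := density_measure_ex mu mw1 w10.
have [n2 n2E] := density_measure_ex mu mw2 w20.
have indicM (E : set (measurableTypeR R)) (f h : measurableTypeR R -> \bar R) : measurable E ->
    (forall x, h x = f x * (\1_E x : R)%:E)%E -> (\int[mu]_x h x = \int[mu]_(x in E) f x)%E.
  move=> mE hE; rewrite [RHS]integral_mkcond; apply: eq_integral => x _.
  by rewrite hE patchE indicE; case: (x \in E); rewrite ?mule1 ?mule0.
have int1 (f : R -> \bar R) : measurable_fun [set: R] f -> (forall x, 0 <= f x)%E ->
    (\int[n1]_x f x = \int[mu]_(x in I) f x)%E.
  by move=> mf f0; rewrite (integral_density mw1 w10 n1E)//; exact: indicM.
have int2 (f : R -> \bar R) : measurable_fun [set: R] f -> (forall x, 0 <= f x)%E ->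
    (\int[n2]_x f x = \int[mu]_(x in D1) (f x * (psi x ^+ 2)%:E))%E.
  move=> mf f0; rewrite (integral_density mw2 w20 n2E)//; apply: indicM => // x.
  by rewrite -muleA -EFinM.
pose id' : measurableTypeR R -> R := id.
have mid' : measurable_fun [set: measurableTypeR R] id' by move=> _ Y mY; rewrite setTI; exact: mY.
pose phi (y : measurableTypeR R) : R := y / (1 + y).
have mphi : measurable_fun [set: measurableTypeR R] phi by rewrite /phi; meas.
pose m1_ := (pushforward n1 id' : {measure set R -> \bar R}); pose m1 := m1_ mid'.
pose m2_ := (pushforward n2 phi : {measure set R -> \bar R}); pose m2 := m2_ mphi.
have Im1 (f : R -> \bar R) : measurable_fun [set: R] f -> (forall x, 0 <= f x)%E ->
    (\int[m1]_x f x = \int[mu]_(x in I) f x)%E.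
  move=> mf f0; rewrite -int1//.
  by rewrite /m1 (@ge0_integral_pushforward _ _ _ _ _ id' mid' n1 setT f measurableT mf (fun y _ => f0 y)).
have Im2 (f : R -> \bar R) : measurable_fun [set: R] f -> (forall x, 0 <= f x)%E ->
    (\int[m2]_x f x = \int[mu]_(x in D1) (f (phi x) * (psi x ^+ 2)%:E))%E.
  move=> mf f0; rewrite -int2//; last exact: (measurableT_comp mf mphi).
  by rewrite /m2 (@ge0_integral_pushforward _ _ _ _ _ phi mphi n2 setT f measurableT mf (fun y _ => f0 y)).
suff E A : measurable A -> m1 A = m2 A.
  move=> mg g0; rewrite -Im1// -(Im2 g)//.
  by apply: eq_measure_integral => A mA _; exact: E.
have mass1 : (m1 setT = 1)%E.
  transitivity (\int[m1]_x (cst 1%E x))%E; first by rewrite integral_cst// mul1e.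
  rewrite Im1// integral_cst// mul1e.
  by rewrite [LHS]lebesgue_measure_itv/= lte_fin ltr01 oppr0 adde0.
have mass2 : (m2 setT = 1)%E.
  transitivity (\int[m2]_x (cst 1%E x))%E; first by rewrite integral_cst// mul1e.
  by rewrite Im2//; under eq_integral do rewrite mul1e.
have null1 : m1 (~` D) = 0%E.
  rewrite -[~` D]setIT -integral_indic//; last exact: measurableC.
  rewrite Im1//; last exact/measurable_EFinP/measurable_indic/measurableC.
  rewrite integral0_eq// => x /=; rewrite in_itv/= => /andP[x0 _].
  by rewrite indicE memNset// => /=; apply; rewrite in_itv/= andbT ltW.
have null2 : m2 (~` D) = 0%E.
  rewrite -[~` D]setIT -integral_indic//; last exact: measurableC.
  rewrite Im2//; last exact/measurable_EFinP/measurable_indic/measurableC.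
  rewrite integral0_eq// => x /=; rewrite in_itv/= andbT => x0.
  rewrite indicE memNset ?mul0e// => /=; apply; rewrite in_itv/= andbT.
  by rewrite divr_ge0 ?addr_ge0// ltW.
apply: (@laplace_unique R m1 m2) => //.
- by rewrite mass1 ltry.
- by rewrite mass2 ltry.
move=> lam; rewrite le_eqVlt => /predU1P[<-|lam0].
  have E1 (m : {measure set R -> \bar R}) : (m (~` D) = 0 -> m setT = 1 ->
      \int[m]_(x in D) (expR (- (0 * x)))%:E = 1)%E.
    move=> m0 m1'; rewrite (integral_full mD m0); last by meas.
    under eq_integral do rewrite mul0r oppr0 expR0.
    by rewrite integral_cst// mul1e.
  by rewrite !E1.
have me : measurable_fun [set: R] (fun x : R => (expR (- (lam * x)))%:E) by meas.
rewrite (integral_full mD null1 me) (integral_full mD null2 me) Im1// Im2//.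
transitivity (((1 - expR (- lam)) / lam)%:E).
  rewrite integral_itv_bndo_bndc; last by apply: measurable_funTS; meas.
  rewrite integral_itv_obnd_cbnd; last by apply: measurable_funTS; meas.
  under eq_integral do rewrite mulrC.
  by rewrite integral_expR_inv// mul0r oppr0 expR0 mul1r.
rewrite -(integral_psi_expR lam0); apply: eq_integral => y /set_mem/=; rewrite in_itv/= andbT => y0.
rewrite -EFinM; congr (expR _ * _)%:E; rewrite /phi /psi; congr (- (_ * _)).
by field; rewrite psi_neq0.
Qed.

End unit_interval_substitution.

(** * Beta laws with parameters [al] and [1 - al] *)

Section beta.
Variables (R : realType) (al : R) (B : probability R R).
Hypotheses (al0 : 0 < al) (BE : beta_law al (1 - al) B).
Local Notation mu := (@lebesgue_measure R).
Local Notation D := (`[0%R, +oo[%classic : set R).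
Local Notation D1 := (`]0%R, +oo[%classic : set R).
Local Notation I := (`]0%R, 1%R[%classic : set R).
Let mD1 : measurable D1. Proof. exact: measurable_itv. Qed.
Let mD : measurable D. Proof. exact: measurable_itv. Qed.
Let mI : measurable I. Proof. exact: measurable_itv. Qed.

Lemma beta_law_ge0 : B D = 1%E.
Proof.
apply: probability_gt0_ge0; have [k k0 [_ _ h]] := BE.
apply: probability_null_full => //; rewrite h; last exact: measurableC.
rewrite (_ : _ `&` _ = set0) ?integral_set0//; apply/seteqP; split => // x [nD].
by rewrite /= in_itv/= => /andP[x0 _]; apply: nD; rewrite /= in_itv/= x0.
Qed.

(** With [b = y / (1 + y)] the integrand becomes [y^(al-1) / (1 + (1 + m) y)], and scaling by
    [1 + m] extracts [(1 + m)^(-al)]; [m = 0] fixes the constant. The absolute value keeps the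
    integrand nonnegative on the whole line. *)
Lemma beta_stieltjes (m : R) : 0 <= m ->
  (\int[B]_b ((1 + m * `|b|)^-1)%:E = ((1 + m) `^ (- al))%:E)%E.
Proof.
have [k k0 kE] := BE.
pose h (y : R) : \bar R := (k * (y `^ (al - 1) / (1 + `|y|)))%:E.
have mh : measurable_fun [set: R] h.
  rewrite /h; apply/measurable_EFinP; apply: measurable_funM => //; apply: measurable_funM; first by meas.
  by apply: (measurableT_comp (@measurable_inv R)); exact: measurable_funD.
have h0 y : (0 <= h y)%E.
  by rewrite lee_fin mulr_ge0 ?(ltW k0)// mulr_ge0 ?powR_ge0// invr_ge0 addr_ge0.
have mg (u : R) : measurable_fun [set: R] (fun b => (1 + u * `|b|)^-1).
  apply: (measurableT_comp (@measurable_inv R)); apply: measurable_funD => //.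
  exact: measurable_funM.
have E (u : R) : 0 <= u ->
    (\int[B]_b ((1 + u * `|b|)^-1)%:E = ((1 + u) `^ (- al))%:E * \int[mu]_(y in D1) h y)%E.
  move=> u0; have g0 (b : R) : 0 <= (1 + u * `|b|)^-1.
    by rewrite invr_ge0 addr_ge0// mulr_ge0.
  have u1 : 0 < 1 + u by rewrite ltr_wpDr.
  rewrite (lebesgue_density_integral mI kE); last 2 first.
  - exact/measurable_EFinP.
  - by move=> b; rewrite lee_fin.
  pose gg (b : R) : \bar R := ((1 + u * `|b|)^-1 * (k * (b `^ (al - 1) * (1 - b) `^ (1 - al - 1))))%:E.
  transitivity (\int[mu]_(b in I) gg b)%E; first by apply: eq_integral => b _; rewrite -EFinM.
  rewrite unit_interval_substitution; last 2 first.
  - apply/measurable_EFinP; apply: measurable_funM => //; meas.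
  - by move=> b; rewrite lee_fin mulr_ge0// mulr_ge0 ?(ltW k0)// mulr_ge0 ?powR_ge0.
  rewrite (ge0_integral_scale u1 mh)// muleA -EFinM.
  rewrite -ge0_integralZl; last 4 first.
  - exact: mD1.
  - by apply: measurable_funTS; apply: (measurableT_comp mh); exact: measurable_funM.
  - by move=> x _; exact: h0.
  - by rewrite lee_fin mulr_ge0 ?powR_ge0// ltW.
  apply: eq_integral => y /set_mem/=; rewrite in_itv/= andbT => y0.
  have t0 : 0 < 1 + y by rewrite addr_gt0.
  have uy : 0 < 1 + (1 + u) * y by rewrite addr_gt0 ?mulr_gt0.
  rewrite /gg /h -!EFinM; congr EFin.
  rewrite (ger0_norm (divr_ge0 (ltW y0) (ltW t0))) ger0_norm ?mulr_ge0 ?(ltW u1) ?(ltW y0)//.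
  have -> : 1 - y / (1 + y) = (1 + y)^-1 by field; rewrite gt_eqF.
  rewrite !powRM ?invr_ge0 ?(ltW y0) ?(ltW t0) ?(ltW u1)//.
  have e1 : (1 + y)^-1 `^ (al - 1) * (1 + y)^-1 `^ (1 - al - 1) = 1 + y.
    rewrite -powRD; last by rewrite (gt_eqF (_ : 0 < (1 + y)^-1)) ?implybT// invr_gt0.
    have -> : al - 1 + (1 - al - 1) = - 1 by ring.
    by rewrite powR_inv1 ?invrK// invr_ge0 ltW.
  have e2 : (1 + u) `^ (- al) * (1 + u) * (1 + u) `^ (al - 1) = 1.
    rewrite -mulrA mulr_powRB1 ?(ltW u1)// -powRD ?(gt_eqF u1) ?implybT//.
    by rewrite addNr powRr0.
  rewrite -[y `^ _ * _ * _]mulrA e1.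
  transitivity (((1 + u) `^ (- al) * (1 + u) * (1 + u) `^ (al - 1)) * (k * (y `^ (al - 1) / (1 + (1 + u) * y)))).
    rewrite e2 mul1r.
    have -> : 1 + u * (y / (1 + y)) = (1 + (1 + u) * y) / (1 + y) by field; rewrite gt_eqF.
    by field; rewrite !gt_eqF.
  by ring.
have h1 : (\int[mu]_(y in D1) h y = 1)%E.
  have := E 0 (lexx 0); rewrite addr0 powR1 mul1e => <-.
  under eq_integral do rewrite mul0r addr0 invr1.
  by rewrite integral_cst// mul1e; exact: probability_setT.
by move=> m0; rewrite E// h1 mule1.
Qed.

(** At fixed [m], averaging over the beta variable turns the exponent 1 into [al], so a beta factor
    converts a transform of order [al] into one of order 1. *)
Lemma beta_mix (M : probability R R) (lam : R) : M D = 1%E -> 0 <= lam ->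
  (\int[prod_law B M]_(x in D) ((1 + lam * x) `^ (- 1))%:E =
   \int[M]_(m in D) ((1 + lam * m) `^ (- al))%:E)%E.
Proof.
move=> MD lam0.
pose f (x : R) : R := (1 + lam * `|x|)^-1.
have mf : measurable_fun [set: R] f.
  apply: (measurableT_comp (@measurable_inv R)); apply: measurable_funD => //.
  exact: measurable_funM.
have f0 x : 0 <= f x by rewrite invr_ge0 addr_ge0// mulr_ge0.
transitivity (\int[prod_law B M]_(x in D) (f x)%:E)%E.
  apply: eq_integral => x /set_mem/=; rewrite in_itv/= andbT => x0.
  by rewrite powR_inv1 ?addr_ge0 ?mulr_ge0// /f ger0_norm.
rewrite integral_fullP//; last 2 first.
- by apply: prod_law_ge0 => //; exact: beta_law_ge0.
- exact/measurable_EFinP.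
rewrite integral_prod_law// -(integral_fullP mD MD); last first.
  apply: (@measurable_integral_param _ _ _ _ R B setT setT _ _ (fun y x => f (x * y))) => //.
  by apply: (measurableT_comp mf); meas.
apply: eq_integral => m /set_mem/=; rewrite in_itv/= andbT => m0.
rewrite -beta_stieltjes ?mulr_ge0//; apply: eq_integral => x _.
by rewrite /f normrM (ger0_norm m0); congr ((1 + _)^-1)%:E; ring.
Qed.

End beta.

Lemma zero_mixture_integral (R : realType) (r : R) (H K : probability R R) (D : set R)
    (f : R -> \bar R) : 0 <= r <= 1 -> same_law K (zero_mixture r H) ->
  measurable D -> D 0 -> measurable_fun D f -> (forall x, D x -> (0 <= f x)%E) ->
  (\int[K]_(x in D) f x = r%:E * \int[H]_(x in D) f x + (1 - r)%:E * f 0%R)%E.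
Proof.
move=> /andP[r0 r1] KE mD D0 mf f0.
have r1' : 0 <= 1 - r by rewrite subr_ge0.
pose m1 : {measure set R -> \bar R} := mscale (NngNum r0) H.
pose m2 : {measure set R -> \bar R} := mscale (NngNum r1') (\d_ (0 : R)).
pose m : {measure set R -> \bar R} := measure_add m1 m2.
have Km : same_law K m by move=> A mA; rewrite KE//; exact/esym/(measure_addE m1 m2).
rewrite (same_law_integral _ _ Km) ge0_integral_measure_add// !ge0_integral_mscale//=.
by rewrite integral_dirac// diracE mem_set// mul1e.
Qed.

Section size_bias.
Variables (R : realType) (al p c : R) (Lam G1 N : probability R R).
Hypotheses (al0 : 0 < al) (c0 : 0 < c) (pE : p = c `^ al / (1 + c `^ al)).
Hypotheses (LamE : skew_occupation_law al p Lam) (G1E : gamma_law 1 G1).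
Local Notation D := (`[0%R, +oo[%classic : set R).
Local Notation D1 := (`]0%R, +oo[%classic : set R).
Local Notation I := (`]0%R, 1%R[%classic : set R).
Let mD1 : measurable D1. Proof. exact: measurable_itv. Qed.
Let mD : measurable D. Proof. exact: measurable_itv. Qed.
Let mI : measurable I. Proof. exact: measurable_itv. Qed.
Hypothesis ND : N D = 1%E.
Hypothesis NE : forall lam : R, 0 <= lam ->
  (\int[N]_(x in D) ((1 + lam * x) `^ (- 1))%:E =
   ((1 - p + p * (1 + lam) `^ al)^-1)%:E)%E.

Let f (x : R) : R := (1 - x) / (1 - p).

Let q0 : 0 < 1 - p.
Proof.
rewrite pE; have c1 : 0 < 1 + c `^ al by rewrite ltr_wpDr ?powR_ge0.
by rewrite subr_gt0 ltr_pdivrMr// mul1r ltrDr.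
Qed.

Let f0 x : I x -> 0 <= f x.
Proof. by rewrite /= in_itv/= => /andP[_ /ltW x1]; rewrite divr_ge0 ?subr_ge0// -subr_ge0 ltW. Qed.

Let mf : measurable_fun [set: R] f. Proof. by rewrite /f; meas. Qed.

Let F (x : R) : \bar R := (f x * \1_I x)%:E.

Let mF : measurable_fun [set: R] F.
Proof. by apply/measurable_EFinP; apply: measurable_funM => //; exact: measurable_indic. Qed.

Let F0 x : (0 <= F x)%E.
Proof.
rewrite lee_fin indicE; case: (boolP (x \in I)) => xI; last by rewrite mulr0.
by rewrite mulr1 f0//; exact: set_mem.
Qed.

Let size_bias_stieltjes (lam : R) : 0 <= lam ->
  (\int[Lam]_x (((1 + lam * `|x|)^-1)%:E * F x) =
   ((1 - p + p * (1 + lam) `^ al)^-1)%:E)%E.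
Proof.
move=> lam0; pose g (x : R) : \bar R := (((1 + lam * `|x|)^-1)%:E * F x)%E.
have mg : measurable_fun [set: R] g.
  apply: emeasurable_funM => //; apply/measurable_EFinP.
  apply: (measurableT_comp (@measurable_inv R)); apply: measurable_funD => //.
  exact: measurable_funM.
have g0 x : (0 <= g x)%E.
  by rewrite mule_ge0// lee_fin invr_ge0 addr_ge0// mulr_ge0.
rewrite -/(g _) -(integral_fullP mD1 (skew_occupation_gt0 al0 c0 pE LamE) mg).
have [rho rhoE ->//] := skew_occupation_integral al0 c0 pE LamE; last exact: measurable_funTS.
pose a := c * (1 + lam).
have a0 : 0 < a by rewrite mulr_gt0// ltr_wpDr.
have h0 x : D1 x -> 0 < 1 + a * x.
  by rewrite /= in_itv/= andbT => x0; rewrite ltr_wpDr// mulr_ge0// ltW.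
transitivity (\int[rho]_(x in D1) ((1 - p)^-1%:E * ((1 + a * x)^-1)%:E))%E.
  apply: eq_integral => x /set_mem xD; have := h0 _ xD; move: xD; rewrite /= in_itv/= andbT => x0 ax.
  have cx : 0 < c * x by rewrite mulr_gt0.
  have cx1 : 0 < 1 + c * x by rewrite addr_gt0.
  have y0 : 0 < c * x / (1 + c * x) by rewrite divr_gt0.
  have y1 : c * x / (1 + c * x) < 1 by rewrite ltr_pdivrMr// mul1r ltrDr.
  rewrite /g /F indicE mem_set; last by rewrite /= in_itv/= y0.
  rewrite mulr1 -!EFinM /f (gtr0_norm y0); congr EFin; rewrite /a in ax *.
  by field; rewrite !gt_eqF// [X in 0 < X](_ : _ = 1 + c * (1 + lam) * x)//; ring.
rewrite ge0_integralZl//; last 3 first.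
- apply: measurable_funTS; apply/measurable_EFinP; by meas.
- by move=> x xD; rewrite lee_fin invr_ge0 ltW// h0.
- by rewrite lee_fin invr_ge0 ltW.
rewrite (lamperti_stieltjes al0 rhoE a0) -EFinM -invfM; congr (_^-1)%:E.
rewrite /a powRM ?(ltW c0)//; last by rewrite addr_ge0.
rewrite pE; field; by rewrite gt_eqF// ltr_wpDr// powR_ge0.
Qed.

(** The measure with density [f] is a probability, by its transform at [lam = 0], and its transform
    of order 1 is that of [N]; uniqueness of order 1 concludes. *)
Lemma size_biased_density : has_density Lam I f N.
Proof.
have [m mE] := density_measure_ex Lam mF F0.
have m1 : m [set: R] = 1%E.
  rewrite mE//; transitivity (\int[Lam]_x (((1 + 0 * `|x|)^-1)%:E * F x))%E.
    by apply: eq_integral => x _; rewrite mul0r addr0 invr1 mul1e.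
  by rewrite size_bias_stieltjes// addr0 powR1 mulr1 subrK invr1.
have [P PE] := probability_ex m1.
have fE A : measurable A -> P A = (\int[Lam]_(x in A `&` I) (f x)%:E)%E.
  move=> mA; rewrite PE mE// integral_mkcondr.
  apply: eq_integral => x _; rewrite /F patchE indicE.
  by case: (x \in I); rewrite ?mulr1 ?mulr0.
have PI : P I = 1%E.
  apply: probability_null_full => //; rewrite fE; last exact: measurableC.
  by rewrite setICl integral_set0.
have PD : P D = 1%E.
  apply/eqP; rewrite eq_le probability_le1//= -PI.
  by apply: le_measure; rewrite ?inE// => x /=; rewrite !in_itv/= andbT => /andP[/ltW].
have NP : same_law N P.
  apply: (stieltjes_unique G1E ND PD) => lam lam0; rewrite NE//.
  have mg : measurable_fun [set: R] (fun x : R => ((1 + lam * `|x|)^-1)%:E).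
    apply/measurable_EFinP.
    apply: (measurableT_comp (@measurable_inv R)); apply: measurable_funD => //.
    exact: measurable_funM.
  have g0 (x : R) : (0 <= ((1 + lam * `|x|)^-1)%:E)%E.
    by rewrite lee_fin invr_ge0 addr_ge0// mulr_ge0.
  transitivity (\int[P]_(x in D) ((1 + lam * `|x|)^-1)%:E)%E; last first.
    apply: eq_integral => x /set_mem/=; rewrite in_itv/= andbT => x0.
    by rewrite (ger0_norm x0) powR_inv1// addr_ge0// mulr_ge0.
  rewrite (integral_fullP mD PD mg) -size_bias_stieltjes//.
  have PF A : measurable A -> P A = (\int[Lam]_(x in A) F x)%E.
    by move=> mA; rewrite PE mE.
  exact/esym/(integral_density mF F0 PF mg g0).
split => //; first exact: measurable_funTS.
by move=> A mA; rewrite NP// fE.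
Qed.

End size_bias.

(** The atom at 0 contributes [ln 1 = 0], so mixing with weight [r] only multiplies the exponent by
    [r]. *)
Lemma zero_mixture_expR_log (R : realType) (r lam : R) (H K : probability R R) :
  0 < r <= 1 -> 0 <= lam -> same_law K (zero_mixture r H) ->
  expR (- (1 * \int[K]_(x in `[0, +oo[) ln (1 + lam * x))) =
  expR (- (r * \int[H]_(x in `[0, +oo[) ln (1 + lam * x))).
Proof.
move=> /andP[r0 r1] lam0 KE; congr (expR (- _)); rewrite mul1r /Rintegral -fineZl//.
congr fine; rewrite (zero_mixture_integral _ KE); last 5 first.
- by rewrite (ltW r0).
- exact: measurable_itv.
- by rewrite /= in_itv/= lexx.
- by apply: measurable_funTS; meas.
- by move=> x /=; rewrite in_itv/= andbT => x0; rewrite lee_fin ln_ge0// lerDl mulr_ge0.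
by rewrite mulr0 addr0 ln1 mule0 adde0.
Qed.

(** * The proposition *)

Section occupation.
Variables (R : realType) (al p c : R) (Lam : probability R R).
Hypotheses (al0 : 0 < al) (c0 : 0 < c) (pE : p = c `^ al / (1 + c `^ al)).
Hypothesis LamE : skew_occupation_law al p Lam.
Local Notation D := (`[0%R, +oo[%classic : set R).

Lemma skew_dirichlet_transform (theta : R) (M : probability R R) :
  dirichlet_mean_law (al * theta) Lam M ->
  M D = 1%E /\ forall lam : R, 0 <= lam ->
  (\int[M]_(m in D) ((1 + lam * m) `^ (- (al * theta)))%:E =
   ((1 - p + p * (1 + lam) `^ al) `^ (- theta))%:E)%E.
Proof.
move=> [_ _ MD ME]; split => // lam lam0; rewrite ME//.
by rewrite (skew_occupation_expR_log al0 c0 pE LamE theta lam0) (skew_ratio c0 pE lam0).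
Qed.

Lemma skew_GGC_transform (theta : R) (L : probability R R) :
  GGC_law (al * theta) Lam L ->
  L D = 1%E /\ forall lam : R, 0 <= lam ->
  (\int[L]_(x in D) (expR (- (lam * x)))%:E =
   ((1 - p + p * (1 + lam) `^ al) `^ (- theta))%:E)%E.
Proof.
move=> LE; have [LD h] := skew_GGC_laplace al0 c0 pE LamE LE.
by split => // lam lam0; rewrite h// (skew_ratio c0 pE lam0).
Qed.

(** [tau] is kept apart from [al * theta]: the decompositions of part (iii) use [tau = 1] with
    [theta = 1]. *)
Lemma GGC_gamma_mix (theta tau : R) (L G M : probability R R) :
  GGC_law (al * theta) Lam L -> gamma_law tau G -> M D = 1%E ->
  (forall lam : R, 0 <= lam ->
    (\int[M]_(m in D) ((1 + lam * m) `^ (- tau))%:E =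
     ((1 - p + p * (1 + lam) `^ al) `^ (- theta))%:E)%E) ->
  same_law L (prod_law G M).
Proof.
move=> LE Gt MD ME; have [LD LL] := skew_GGC_transform LE.
apply: probability_laplace_unique => //.
  by apply: prod_law_ge0 => //; exact: gamma_law_ge0 Gt.
by move=> lam lam0; rewrite LL// (laplace_gamma_mix Gt)// ME.
Qed.

End occupation.

Theorem proposition4p5 (R : realType) (alpha theta b c p : R)
    (halpha : 0 < alpha < 1) (htheta : 0 < theta) (hb : 0 < b) (hc : 0 < c)
    (hp : p = c `^ alpha / (1 + c `^ alpha))
    (rho Lam : probability R R)
    (hrho : lamperti_law alpha rho) (hLam : skew_occupation_law alpha p Lam) :
  [/\ (forall nu : probability R R,
         GGC_tilted_law b c (alpha * theta) rho nu ->
         has_levy_density nu (fun s =>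
           alpha * theta * s^-1 * expR (- (c / b * s)) *
           \int[rho]_(x in `]0, +oo[) expR (- (s / (b * x))))),
      (forall nu : probability R R,
         GGC_tilted_law c c (alpha * theta) rho nu <->
         GGC_law (alpha * theta) Lam nu),
      (forall nu : probability R R,
         GGC_law (alpha * theta) Lam nu ->
         has_levy_density nu (fun s =>
           alpha * theta * s^-1 *
           \int[Lam]_(a in `]0, 1[) expR (- (s / a)))) &
      forall L : probability R R, GGC_law (alpha * theta) Lam L ->
      [/\ (forall G M PC : probability R R,
             gamma_law (theta * alpha) G ->
             dirichlet_mean_law (alpha * theta) Lam M ->
             PD_mass_law alpha (alpha * theta) p PC ->
             [/\ same_law L (prod_law G PC),
                 same_law L (prod_law G M) &
                 same_law M PC]),
          (theta = 1 ->
           forall M Abr : probability R R,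
             dirichlet_mean_law alpha Lam M ->
             skew_bridge_occupation_law alpha p Abr ->
             same_law Abr M) &
          (theta = 1 ->
           forall G1 B M PC Astar Lam_alpha M1 : probability R R,
             gamma_law 1 G1 ->
             beta_law alpha (1 - alpha) B ->
             dirichlet_mean_law alpha Lam M ->
             PD_mass_law alpha alpha p PC ->
             same_law Astar (prod_law B M) ->
             same_law Lam_alpha (zero_mixture alpha Lam) ->
             dirichlet_mean_law 1 Lam_alpha M1 ->
             [/\ [/\ same_law L (prod_law G1 Astar),
                     same_law L (prod_law G1 (prod_law B M)) &
                     same_law L (prod_law G1 (prod_law B PC))],
                 same_law Astar (prod_law B PC),
                 same_law Astar M1 &
                 has_density Lam `]0, 1[ (fun x => (1 - x) / (1 - p)) Astar])]].
Proof.
have [al0 al1] := andP halpha.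
split.
- by move=> nu; exact: tilted_levy_density.
- move=> nu; split; first exact: (GGC_tilted_skew al0 htheta hc hp hrho hLam).
  exact: (skew_GGC_tilted al0 htheta hc hp hrho hLam).
- by move=> nu; exact: (skew_levy_density al0 htheta hc hp hLam).
(* Part (ii) names no gamma law; the one inside [L] serves for the uniqueness argument. *)
move=> L LE; have [Gt [_ [GtE _ _]]] := LE.
split.
- move=> G M PC; rewrite mulrC => GE ME PCE.
  have [MD MT] := skew_dirichlet_transform al0 hc hp hLam ME.
  have [PD PT] := PD_mass_transform al0 al1 htheta GE PCE.
  split.
  + exact: (GGC_gamma_mix al0 hc hp hLam LE GE PD PT).
  + exact: (GGC_gamma_mix al0 hc hp hLam LE GE MD MT).
  + by apply: (stieltjes_unique GE MD PD) => lam lam0; rewrite MT// PT.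
- move=> th1 M Abr ME AE; rewrite th1 in LE GtE.
  have ME' : dirichlet_mean_law (alpha * 1) Lam M by rewrite mulr1.
  have AE' : PD_mass_law alpha (alpha * 1) p Abr by rewrite mulr1.
  have [MD MT] := skew_dirichlet_transform al0 hc hp hLam ME'.
  have [AD AT] := PD_mass_transform al0 al1 ltr01 GtE AE'.
  by apply: (stieltjes_unique GtE AD MD) => lam lam0; rewrite MT// AT.
- move=> th1 G1 B M PC Astar Lam_alpha M1 G1E BE ME PCE AE KE M1E.
  rewrite th1 in LE GtE.
  have ME' : dirichlet_mean_law (alpha * 1) Lam M by rewrite mulr1.
  have PCE' : PD_mass_law alpha (alpha * 1) p PC by rewrite mulr1.
  have [MD MT] := skew_dirichlet_transform al0 hc hp hLam ME'.
  have [PD PT] := PD_mass_transform al0 al1 ltr01 GtE PCE'.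
  rewrite mulr1 in MT PT.
  have BD := beta_law_ge0 BE.
  have BMD := prod_law_ge0 BD MD.
  have BPD := prod_law_ge0 BD PD.
  have AD : Astar `[0%R, +oo[%classic = 1%E by rewrite AE//; exact: measurable_itv.
  (* All candidates for the law of [Astar] share this transform of order 1. *)
  pose T (lam : R) := ((1 - p + p * (1 + lam) `^ alpha) `^ (- 1))%:E.
  have BMT (lam : R) : 0 <= lam ->
      (\int[prod_law B M]_(x in `[0%R, +oo[) ((1 + lam * x) `^ (- 1))%:E = T lam)%E.
    by move=> lam0; rewrite (beta_mix al0 BE)// MT.
  have BPT (lam : R) : 0 <= lam ->
      (\int[prod_law B PC]_(x in `[0%R, +oo[) ((1 + lam * x) `^ (- 1))%:E = T lam)%E.
    by move=> lam0; rewrite (beta_mix al0 BE)// PT.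
  have AT (lam : R) : 0 <= lam ->
      (\int[Astar]_(x in `[0%R, +oo[) ((1 + lam * x) `^ (- 1))%:E = T lam)%E.
    by move=> lam0; rewrite (same_law_integral _ _ AE) BMT.
  have [_ _ M1D M1T] := M1E.
  split.
  + split.
    * exact: (GGC_gamma_mix al0 hc hp hLam LE G1E AD AT).
    * exact: (GGC_gamma_mix al0 hc hp hLam LE G1E BMD BMT).
    * exact: (GGC_gamma_mix al0 hc hp hLam LE G1E BPD BPT).
  + by apply: (stieltjes_unique G1E AD BPD) => lam lam0; rewrite AT// BPT.
  (* Order 1 for the mixture of weight [alpha] amounts to order [alpha] for [Lam], that is, to the
     logarithmic transform at [theta = 1]. *)
  + apply: (stieltjes_unique G1E AD M1D) => lam lam0; rewrite AT// M1T//.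
    rewrite (zero_mixture_expR_log _ lam0 KE) ?al0 ?(ltW al1)//.
    rewrite -[X in expR (- (X * _))]mulr1 (skew_occupation_expR_log al0 hc hp hLam 1 lam0).
    by rewrite (skew_ratio hc hp lam0).
  + apply: (size_biased_density al0 hc hp hLam G1E AD) => lam lam0; rewrite AT// /T.
    by rewrite powR_inv1// -(skew_ratio hc hp lam0) divr_ge0// addr_ge0// powR_ge0.
Qed.
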